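(* Let $p\in[1,\infty)$ with conjugate exponent $q$, $\kappa$ an infinite cardinal, $(M,\Sigma,\mu)$ a measure space such that $\mathrm{dens}(L_p(\mu))=\kappa$, and $Y$ a real normed space with $\mathrm{dens}(Y)<\kappa$. Then: (i) For $1\le r\le p$, $$\min\left\{\frac{2}{2^{1/p}},\frac{2}{2^{1/q}}\right\}\le\gamma(L_p(\mu)\oplus_rY)\le\gamma^*(L_p(\mu)\oplus_rY)\le\frac{2}{2^{1/p}}.$$ (ii) For $p\le r<\infty$, $$\min\left\{\frac{2}{2^{1/p}},\frac{2}{2^{1/q}}\right\}\le\gamma(L_p(\mu)\oplus_rY)\le\gamma^*(L_p(\mu)\oplus_rY)\le\frac{2}{2^{1/r}}.$$ (iii) For $r=\infty$, $$\min\left\{\frac{2}{2^{1/p}},\frac{2}{2^{1/q}}\right\}\le\gamma(L_p(\mu)\oplus_\infty Y)\le\gamma^*(L_p(\mu)\oplus_\infty Y)\le\max\left\{\frac{2}{2^{1/p}},\gamma^*(Y)\right\}.$$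
   Context: $L_p(\mu)$ is the real Lebesgue space. The conjugate exponent satisfies $1/p+1/q=1$ (with $1/q=0$ if $p=1$). $\mathrm{dens}(Y)$ is the smallest cardinality of a subset of $Y$ whose linear span is dense in $Y$ (so $\mathrm{dens}(Y)<\omega$ means $Y$ is finite-dimensional). $X\oplus_rY$ is $X\times Y$ with norm $(\|x\|^r+\|y\|^r)^{1/r}$ (maximum if $r=\infty$). A set $P\subseteq X$ is $s$-separated if $\|x-y\|\ge s$ for all distinct $x,y\in P$, and $s$-dense if for every $x\in X$ there is $u\in P$ with $\|x-u\|\le s$. $\gamma(X)$ (resp. $\gamma^*(X)$) is the infimum of all $s>0$ such that there exists an $s$-dense and $2$-separated subset (resp. additive subgroup) of $X$. *)

(* Defs.v *)
From HB Require Import structures.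
From mathcomp Require Import all_boot all_order all_algebra generic_quotient.
From mathcomp Require Import all_classical all_reals all_analysis.
From mathcomp Require Import ess_sup_inf measurable_realfun.

Set Implicit Arguments.
Unset Strict Implicit.
Unset Printing Implicit Defensive.
Import Order.TTheory GRing.Theory Num.Theory.
Import numFieldNormedType.Exports.

Local Open Scope classical_set_scope.
Local Open Scope ring_scope.

Section Lspace_normed.
Context d (T : measurableType d) (R : realType).
Variables (mu : {measure set T -> \bar R}) (p : \bar R) (p1 : (1 <= p)%E).

(* LspaceType mu p1 comes from the library as a bare type of a.e.-classes; the
   vector space structure and the Lp-norm are transported to it from the
   seminormed space LfunType mu p1 of representatives. *)

Local Notation Lf := (LfunType mu p1).
Local Notation Ls := (LspaceType mu p1).

Lemma ae_eq_Lnorm (f g : T -> R) :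
  measurable_fun setT f -> measurable_fun setT g -> f = g %[ae mu] ->
  'N[mu]_p[EFin \o f]%E = 'N[mu]_p[EFin \o g]%E.
Proof.
move=> mf mg fg; rewrite unlock /Lnorm; case: p p1 => [r r1|_|//].
  have mpow (h : T -> R) : measurable_fun setT h ->
      measurable_fun setT (fun x => (`|(EFin \o h) x| `^ r)%E : \bar R).
    move=> mh.
    apply: (@measurableT_comp _ _ _ _ _ _ (fun x : \bar R => x `^ r)%E) => //.
      exact: measurable_poweR.
    apply: (@measurableT_comp _ _ _ _ _ _ abse) => //; exact/measurable_EFinP.
  congr (_ `^ _)%E; apply: ge0_ae_eq_integral => //.
  - exact: mpow.
  - exact: mpow.
  - by move=> x _; exact: poweR_ge0.
  - by move=> x _; exact: poweR_ge0.
  - by apply: filterS fg => x /= fg Dx; rewrite fg.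
case: ifPn => // _; apply: eq_ess_sup.
by apply: filterS fg => x /= /(_ I) ->.
Qed.

Definition Lspace_repr_fun (F : Ls) : T -> R := (F : {mfun_ mu, T >-> measurableTypeR R}).

Lemma Lspace_repr_subproof (F : Ls) : Lspace_repr_fun F \in Lfun mu p.
Proof.
rewrite inE; apply/andP; split; rewrite inE /=; last exact: Lebesgue_finite.
exact: (@measurable_funPT _ _ _ _ (repr (F : {mfun_ mu, T >-> measurableTypeR R}))).
Qed.

Definition Lspace_repr (F : Ls) : Lf := Lfun_Sub p1 (Lspace_repr_subproof F).

Let mfun_of_Lfun (f : Lf) : {mfun T >-> measurableTypeR R} :=
  HB.pack_for {mfun T >-> measurableTypeR R} (f : T -> R)
    (isMeasurableFun.Build _ _ T (measurableTypeR R) f (@measurable_funPT _ _ _ _ f)).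

Local Open Scope quotient_scope.

Let class_of (f : Lf) : {mfun_ mu, T >-> measurableTypeR R} :=
  \pi_({mfun_ mu, T >-> measurableTypeR R}) (mfun_of_Lfun f).

Let class_ofP (f : Lf) : (class_of f : T -> R) = (f : T -> R) %[ae mu].
Proof.
have /eqmodP /asboolP := reprK (class_of f).
by [].
Qed.

Let class_of_fin (f : Lf) : finite_norm mu p (class_of f).
Proof.
rewrite /finite_norm (ae_eq_Lnorm _ _ (class_ofP f)) //.
  exact: Lfunction_finite.
exact: (@measurable_funPT _ _ _ _ (repr (class_of f))).
Qed.

Definition Lspace_class (f : Lf) : Ls :=
  LebesgueSpace.Pack
    (LebesgueSpace.Class (isFinLebesgue.phant_Build p1 (class_of_fin f))).

Let Lspace_inj (F G : Ls) :
  (F : {mfun_ mu, T >-> measurableTypeR R}) = G -> F = G.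
Proof.
case: F G => [F [[HF]]] [G [[HG]]] /= FG; subst G.
by rewrite (Prop_irrelevance HF HG).
Qed.

Lemma eq_Lspace_class (f g : Lf) :
  (f : T -> R) = g %[ae mu] -> Lspace_class f = Lspace_class g.
Proof. by move=> fg; apply: Lspace_inj; apply/eqmodP/asboolP. Qed.

Lemma Lspace_reprK (f : Lf) :
  (Lspace_repr (Lspace_class f) : T -> R) = f %[ae mu].
Proof. exact: class_ofP. Qed.

Lemma Lspace_classK (F : Ls) : Lspace_class (Lspace_repr F) = F.
Proof.
apply: Lspace_inj; rewrite -[RHS]reprK; apply/eqmodP/asboolP.
exact: ae_eq_refl.
Qed.

HB.instance Definition _ := gen_eqMixin Ls.
HB.instance Definition _ := gen_choiceMixin Ls.

Definition Lspace_zero : Ls := Lspace_class 0.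
Definition Lspace_add (F G : Ls) : Ls :=
  Lspace_class (Lspace_repr F + Lspace_repr G).
Definition Lspace_opp (F : Ls) : Ls := Lspace_class (- Lspace_repr F).
Definition Lspace_scale (a : R) (F : Ls) : Ls :=
  Lspace_class (a *: Lspace_repr F).

Let LspaceD (f g : Lf) :
  Lspace_add (Lspace_class f) (Lspace_class g) = Lspace_class (f + g).
Proof.
apply: eq_Lspace_class; have := Lspace_reprK f; have := Lspace_reprK g.
by apply: filterS2 => x /= gx fx _; rewrite !fctE gx// fx.
Qed.

Let LspaceN (f : Lf) : Lspace_opp (Lspace_class f) = Lspace_class (- f).
Proof.
apply: eq_Lspace_class; have := Lspace_reprK f.
by apply: filterS => x /= fx _; rewrite !fctE fx.
Qed.

Let LspaceZ (a : R) (f : Lf) :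
  Lspace_scale a (Lspace_class f) = Lspace_class (a *: f).
Proof.
apply: eq_Lspace_class; have := Lspace_reprK f.
by apply: filterS => x /= fx _; rewrite !fctE fx.
Qed.

Let Lspace_ind (P : Ls -> Prop) : (forall f, P (Lspace_class f)) -> forall F, P F.
Proof. by move=> Pc F; rewrite -(Lspace_classK F). Qed.

Let addA : associative Lspace_add.
Proof.
by elim/Lspace_ind=> f; elim/Lspace_ind=> g; elim/Lspace_ind=> h;
  rewrite !LspaceD addrA.
Qed.

Let addC : commutative Lspace_add.
Proof. by elim/Lspace_ind=> f; elim/Lspace_ind=> g; rewrite !LspaceD addrC. Qed.

Let add0 : left_id Lspace_zero Lspace_add.
Proof. by elim/Lspace_ind=> f; rewrite LspaceD add0r. Qed.

Let addN : left_inverse Lspace_zero Lspace_opp Lspace_add.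
Proof. by elim/Lspace_ind=> f; rewrite LspaceN LspaceD addNr. Qed.

HB.instance Definition _ := GRing.isZmodule.Build Ls addA addC add0 addN.

Let scaleA (a b : R) (F : Ls) :
  Lspace_scale a (Lspace_scale b F) = Lspace_scale (a * b) F.
Proof. by elim/Lspace_ind: F => f; rewrite !LspaceZ scalerA. Qed.

Let scale1 : left_id 1 Lspace_scale.
Proof. by elim/Lspace_ind=> f; rewrite LspaceZ scale1r. Qed.

Let scaleDr : right_distributive Lspace_scale +%R.
Proof.
by move=> a; elim/Lspace_ind=> f; elim/Lspace_ind=> g;
  rewrite -[_ + _]/(Lspace_add _ _) !(LspaceD, LspaceZ) scalerDr;
  rewrite -[_ + _ in RHS]/(Lspace_add _ _) LspaceD.
Qed.

Let scaleDl (F : Ls) : {morph Lspace_scale^~ F : a b / a + b}.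
Proof.
by move=> a b; elim/Lspace_ind: F => f;
  rewrite -[_ + _ in RHS]/(Lspace_add _ _) !(LspaceD, LspaceZ) scalerDl.
Qed.

HB.instance Definition _ :=
  GRing.Zmodule_isLmodule.Build R Ls scaleA scale1 scaleDr scaleDl.

Definition Lspace_norm (F : Ls) : R :=
  fine 'N[mu]_p[EFin \o (Lspace_repr F : T -> R)].

Let Lspace_norm_class (f : Lf) :
  Lspace_norm (Lspace_class f) = fine 'N[mu]_p[EFin \o (f : T -> R)].
Proof.
congr fine; apply: (@ae_eq_Lnorm (Lspace_repr (Lspace_class f)) f) => //.
exact: Lspace_reprK.
Qed.

Let Lspace_normD (F G : Ls) :
  Lspace_norm (F + G) <= Lspace_norm F + Lspace_norm G.
Proof.
by rewrite [X in X <= _]Lspace_norm_class; exact: ler_LnormD.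
Qed.

Let Lspace_normZ (a : R) (F : Ls) :
  Lspace_norm (a *: F) = `|a| * Lspace_norm F.
Proof.
rewrite [LHS]Lspace_norm_class.
have /= -> := LnormZ (Lspace_repr F) a.
by rewrite -(finite_norm_fine (Lspace_repr F)).
Qed.

Let Lspace_norm_eq0 (F : Ls) : Lspace_norm F = 0 -> F = 0.
Proof.
move=> /fine_Lnormr_eq0 F0; rewrite -[F]Lspace_classK.
exact: eq_Lspace_class.
Qed.

HB.instance Definition _ :=
  Lmodule_isNormed.Build R Ls Lspace_normD Lspace_normZ Lspace_norm_eq0.

End Lspace_normed.

Lemma minkowski2 (R : realType) (a1 a2 b1 b2 s : R) :
  0 <= a1 -> 0 <= a2 -> 0 <= b1 -> 0 <= b2 -> 1 <= s ->
  ((a1 + b1) `^ s + (a2 + b2) `^ s) `^ s^-1 <=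
  (a1 `^ s + a2 `^ s) `^ s^-1 + (b1 `^ s + b2 `^ s) `^ s^-1.
Proof.
move=> a10 a20 b10 b20 s1.
have s0 : 0 < s by exact: lt_le_trans s1.
pose f a b n : R := match n with 0%N => a | 1%N => b | _ => 0 end.
have mf a b : measurable_fun setT (f a b) by [].
have normE a b : 0 <= a -> 0 <= b ->
    'N[counting]_(s%:E)[EFin \o f a b]%E = ((a `^ s + b `^ s) `^ s^-1)%:E.
  move=> a0 b0; rewrite Lnorm_counting//.
  rewrite (nneseries_split 0 2); last by move=> k; rewrite lee_fin powR_ge0.
  rewrite add0n ereal_series_cond eseries0 ?adde0; last first.
    by move=> [//|] [//|n _]; rewrite /f /= normr0 powR0// gt_eqF.
  rewrite big_mkord 2!big_ord_recr/= big_ord0 add0e -EFinD poweR_EFin.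
  by rewrite !ger0_norm.
have := minkowski_EFin counting (mf a1 a2) (mf b1 b2) s1.
rewrite (_ : f a1 a2 \+ f b1 b2 = f (a1 + b1) (a2 + b2)).
  by rewrite !normE ?addr_ge0// -EFinD lee_fin.
by apply/funext => -[|[|n]] //=; rewrite addr0.
Qed.

(* The value at -oo is irrelevant: the exponent is always at least 1. *)
Definition lr_norm2 (R : realType) (r : \bar R) (a b : R) : R :=
  match r with
  | s%:E => (a `^ s + b `^ s) `^ s^-1
  | +oo%E => Num.max a b
  | -oo%E => 0
  end.

Section lr_norm2_theory.
Context (R : realType) (r : \bar R) (r1 : (1 <= r)%E).
Implicit Types a b c : R.

Lemma lr_norm2D a1 a2 b1 b2 : 0 <= a1 -> 0 <= a2 -> 0 <= b1 -> 0 <= b2 ->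
  lr_norm2 r (a1 + b1) (a2 + b2) <= lr_norm2 r a1 a2 + lr_norm2 r b1 b2.
Proof.
move=> a10 a20 b10 b20; rewrite /lr_norm2; case: r r1 => [s s1|_|//].
  exact: minkowski2.
by rewrite ge_max !lerD// le_max lexx ?orbT.
Qed.

Lemma ler_lr_norm2 a1 a2 b1 b2 : 0 <= a1 -> 0 <= a2 -> a1 <= b1 -> a2 <= b2 ->
  lr_norm2 r a1 a2 <= lr_norm2 r b1 b2.
Proof.
move=> a10 a20 ab1 ab2; rewrite /lr_norm2; case: r r1 => [s s1|_|//].
  have b10 := le_trans a10 ab1; have b20 := le_trans a20 ab2.
  have s0 : 0 <= s by rewrite (le_trans ler01).
  apply: ge0_ler_powR; rewrite ?nnegrE ?invr_ge0 ?addr_ge0 ?powR_ge0//.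
  by apply: lerD; apply: ge0_ler_powR; rewrite ?nnegrE.
by rewrite ge_max !le_max ab1 ab2 orbT.
Qed.

Lemma lr_norm2Z c a b : 0 <= c -> 0 <= a -> 0 <= b ->
  lr_norm2 r (c * a) (c * b) = c * lr_norm2 r a b.
Proof.
move=> c0 a0 b0; rewrite /lr_norm2; case: r r1 => [s s1|_|//].
  have s0 : s != 0 by rewrite gt_eqF// (lt_le_trans ltr01).
  rewrite !powRM// -mulrDr powRM ?addr_ge0 ?powR_ge0//.
  by rewrite -powRrM mulfV// powRr1.
by rewrite maxr_pMr.
Qed.

Lemma lr_norm2_eq0 a b : 0 <= a -> 0 <= b -> lr_norm2 r a b = 0 ->
  a = 0 /\ b = 0.
Proof.
move=> a0 b0; rewrite /lr_norm2; case: r r1 => [s s1|_|//].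
  move=> /powR_eq0_eq0 /eqP; rewrite paddr_eq0 ?powR_ge0//.
  by move=> /andP[/eqP/powR_eq0_eq0-> /eqP/powR_eq0_eq0->].
move=> m0; split; apply/eqP; rewrite eq_le -{1}m0 ?a0 ?b0 andbT.
  by rewrite le_max lexx.
by rewrite le_max lexx orbT.
Qed.

End lr_norm2_theory.

(* The r-direct sum is an alias of the product, which already carries the
   maximum norm; r1 is only there to make the norm axioms provable. *)
Definition dsum (R : realType) (r : \bar R) (r1 : (1 <= r)%E)
  (X Y : normedModType R) : Type := (X * Y)%type.

Section dsum_normed.
Context (R : realType) (r : \bar R) (r1 : (1 <= r)%E) (X Y : normedModType R).

HB.instance Definition _ := GRing.Lmodule.copy (dsum r1 X Y) (X * Y)%type.

Definition dsum_norm (z : dsum r1 X Y) : R := lr_norm2 r `|z.1| `|z.2|.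

Let dsum_normD (z w : dsum r1 X Y) :
  dsum_norm (z + w) <= dsum_norm z + dsum_norm w.
Proof.
apply: le_trans (lr_norm2D r1 _ _ _ _) => //.
by apply: ler_lr_norm2 => //; exact: ler_normD.
Qed.

Let dsum_normZ (a : R) (z : dsum r1 X Y) :
  dsum_norm (a *: z) = `|a| * dsum_norm z.
Proof. by rewrite /dsum_norm !normrZ lr_norm2Z. Qed.

Let dsum_norm_eq0 (z : dsum r1 X Y) : dsum_norm z = 0 -> z = 0.
Proof.
case: z => x y; rewrite /dsum_norm /= => /(lr_norm2_eq0 r1).
by case=> // /normr0_eq0-> /normr0_eq0->.
Qed.

HB.instance Definition _ :=
  Lmodule_isNormed.Build R (dsum r1 X Y) dsum_normD dsum_normZ dsum_norm_eq0.

End dsum_normed.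

Section packing_covering.
Context (R : realType) (X : normedModType R).

Definition s_separated (s : R) (P : set X) :=
  forall x y, P x -> P y -> x <> y -> s <= `|x - y|.

Definition s_dense (s : R) (P : set X) :=
  forall x, exists2 u, P u & `|x - u| <= s.

(* The infima are taken in \bar R, where the infimum of the empty set is +oo. *)
Definition gamma : \bar R :=
  ereal_inf [set s%:E | s in
    [set s : R | 0 < s /\ exists P : set X, s_dense s P /\ s_separated 2 P]].

Definition gamma_star : \bar R :=
  ereal_inf [set s%:E | s in
    [set s : R | 0 < s /\ exists P : set X,
      [/\ zmod_closed (mem P), s_dense s P & s_separated 2 P]]].

Definition linear_span (A : set X) : set X :=
  [set x | exists n (a : 'I_n -> R) (v : 'I_n -> X),
    (forall i, A (v i)) /\ x = \sum_(i < n) a i *: v i].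

Definition densely_spans (A : set X) := closure (linear_span A) = [set: X].

Local Open Scope card_scope.

(* A cardinal is represented by a set B of that cardinality, living in an
   arbitrary type U: has_dens X B says dens(X) = |B|, dens_lt X B that
   dens(X) < |B|. *)
Definition has_dens (U : Type) (B : set U) :=
  (exists2 A : set X, densely_spans A & A #= B) /\
  (forall A : set X, densely_spans A -> B #<= A).

Definition dens_lt (U : Type) (B : set U) :=
  exists A : set X, [/\ has_dens A, A #<= B & ~~ (B #<= A)].

End packing_covering.
Arguments gamma {R} X.
Arguments gamma_star {R} X.
Arguments has_dens {R} X {U} B.
Arguments dens_lt {R} X {U} B.

(* Main.v *)
Require Import Defs.
From HB Require Import structures.
From mathcomp Require Import all_boot all_order all_algebra.
From mathcomp Require Import all_classical all_reals all_analysis.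
From mathcomp Require Import finmap ess_sup_inf measurable_realfun.
From mathcomp Require Import ring lra.
From mathcomp Require wochoice.

Set Implicit Arguments.
Unset Strict Implicit.
Unset Printing Implicit Defensive.
Import Order.TTheory GRing.Theory Num.Theory.
Import numFieldNormedType.Exports.

Local Open Scope classical_set_scope.
Local Open Scope card_scope.

(** Call a set small if it does not have cardinality at least kappa.  Both estimates
    rest on one property of [E = L_p(mu)], named [escaping] below, which only uses that
    no small set spans a dense subspace of [E]: for every small set S and every [e > 0]
    there is a unit vector v that is almost disjoint from all of span S at once, i.e.
    [|x + t v| >= (1 - e) (|x|^p + t^p)^(1/p)] for all x in span S and all [t >= 0].

    Why [E] has it ([Lp_escaping]).  It is enough to find a set B of positive finite
    measure that carries at most a fraction e of the norm of each member of span S; v is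
    then the normalized indicator of B.  The unit ball of span S has an e-net that is not
    larger than S (or is finite), and the members of the net may be replaced by simple
    functions, so finitely many level sets per member of the net have to be dealt with.
    Let G be the family of finite intersections of these sets.  If some set B0 of positive
    finite measure has no non-null subset on which the traces of G span all indicators,
    then a Hahn decomposition cuts every non-null B inside B0 down to a non-null B' with
    [2 mu (F n B') <= mu (F n B)] for all F in the sigma-algebra generated by G
    simultaneously ([halving]); after enough halvings every simple function in question
    is small on what is left.  Otherwise a maximal almost disjoint family of sets on which
    the traces of G suffice fills the whole space ([filled_densely_spans]).  That family
    is not small, since its traces span a dense subspace of [E]; a given simple function
    is large on only finitely many of its members ([finite_heavy]), so one of its members
    serves all the simple functions ([avoid_simple_functions]).

    Upper bounds.  If a space is escaping with exponent m and has a dense subset of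
    cardinality at most kappa, a greedy transfinite construction along that dense subset
    gives a 2-separated subgroup ([greedy_subgroup]): a point x that is still far from the
    subgroup obtained so far gets the new generator [x + s v], where v escapes from
    everything used before; all nonzero multiples of the generator then stay at distance 2 from
    the old subgroup as soon as [s 2^(1/m) >= 2], up to an error.  By a Minkowski type
    inequality ([lr_norm2_mixed]) the r-sum of [E] and Y is escaping with exponent
    [max p r] ([dsum_escaping]).  For [r = oo] the product of two subgroups is used.

    Lower bound.  Let P be s-dense and 2-separated in the sum.  The first coordinates of
    those points of P whose second coordinate has norm at most s form an s-dense subset U
    of [E].  Some ball of radius [s + e] contains at least kappa points of U, for
    otherwise one could move away from U along an escaping direction ([crowded_ball]).
    As Y is spanned by a small set, infinitely many of these points come with almost the
    same second coordinate, hence are almost 2 apart in [E].  But N points u_i of [E]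
    satisfy [sum_ij |u_i - u_j|^p <= max(2, 2^(p-1)) N sum_i |u_i|^p] ([Lp_pairs]), and
    N -> oo bounds s from below. *)

(** * Cardinal arithmetic *)

Lemma card_le_of_inj (T U : Type) (A : set T) (B : set U) (f : T -> U) :
  (forall x, A x -> B (f x)) ->
  (forall x y, A x -> A y -> f x = f y -> x = y) -> A #<= B.
Proof.
move=> fAB finj.
have [g] : $|{injfun A >-> B}|.
  apply/injfunPex; exists f; first by move=> x; exact: fAB.
  by move=> x y /set_mem Ax /set_mem Ay; exact: finj.
exact: inj_card_le g.
Qed.

Lemma inj_of_card_le (T U : Type) (u0 : U) (A : set T) (B : set U) : A #<= B ->
  exists f : T -> U, (forall x, A x -> B (f x)) /\
    (forall x y, A x -> A y -> f x = f y -> x = y).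
Proof.
elim/Ppointed: U => U in u0 B *; first by case: (no u0).
move=> /pcard_leP[f]; exists f; split; first by move=> x Ax; exact: funS.
by move=> x y Ax Ay; apply: inj; exact: mem_set.
Qed.

Lemma surj_of_card_le (T U : Type) (t0 : T) (A : set T) (B : set U) : A #<= B ->
  exists f : U -> T, forall x, A x -> exists2 y, B y & f y = x.
Proof.
elim/Ppointed: T => T in t0 A *; first by case: (no t0).
by move=> /pcard_surjP[f fs]; exists f => x /fs[y By <-]; exists y.
Qed.

Lemma card_le_of_surj (T U : Type) (A : set T) (B : set U) (f : U -> T) :
  (forall x, A x -> exists2 y, B y & f y = x) -> A #<= B.
Proof.
move=> fs; apply: card_le_trans (card_image_le f B).
by apply: subset_card_le => x /fs[y By <-]; exists y.
Qed.

(** Zorn's lemma on the graphs of partial injections: a maximal one is total on one of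
    the two sides, as otherwise one more pair could be added. *)
Lemma card_le_total (T U : Type) (A : set T) (B : set U) : A #<= B \/ B #<= A.
Proof.
(* G is the graph of an injection from a part of A to a part of B. *)
pose P (G : set (T * U)) := [/\ G `<=` A `*` B,
  forall x y y', G (x, y) -> G (x, y') -> y = y' &
  forall x x' y, G (x, y) -> G (x', y) -> x = x'].
have [F FP Ftot|G [[GAB Gf Gi] Gmax]] := @Zorn_bigcup _ P.
  split.
  - by move=> z [G FG Gz]; have [GAB _ _] := FP _ FG; exact: GAB.
  - move=> x y y' [G FG Gxy] [G' FG' Gxy'].
    have [_ Gf _] := FP _ FG; have [_ Gf' _] := FP _ FG'.
    by have [S|S] := Ftot _ _ FG FG'; [apply: Gf' Gxy'|apply: Gf Gxy _]; exact: S.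
  - move=> x y y' [G FG Gxy] [G' FG' Gxy'].
    have [_ _ Gf] := FP _ FG; have [_ _ Gf'] := FP _ FG'.
    by have [S|S] := Ftot _ _ FG FG'; [apply: Gf' Gxy'|apply: Gf Gxy _]; exact: S.
have [[a [Aa Ga]]|dA] := pselect (exists a, A a /\ forall b, ~ G (a, b)); last first.
  have [[u0]|nU] := pselect (exists u0 : U, True); last first.
    left; have -> : A = set0; last exact: card_ge0.
    apply/seteqP; split=> // x Ax; apply: dA; exists x; split=> // b _.
    by apply: nU; exists b.
  left; have : forall a, exists b, A a -> G (a, b).
    move=> a; have [Aa|] := pselect (A a); last by exists u0.
    apply: contrapT => nb; apply: dA; exists a; split=> // b Gab.
    by apply: nb; exists b.
  move=> /choice[f fP]; apply: (@card_le_of_inj _ _ _ _ f) => [x /fP /GAB[]//|].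
  by move=> x y /fP Gx /fP Gy E; apply: Gi Gx _; rewrite E.
have [[b [Bb Gb]]|dB] := pselect (exists b, B b /\ forall a, ~ G (a, b)); last first.
  right; have : forall b, exists a, B b -> G (a, b).
    move=> b; have [Bb|] := pselect (B b); last by exists a.
    apply: contrapT => na; apply: dB; exists b; split=> // a' Gab.
    by apply: na; exists a'.
  move=> /choice[f fP]; apply: (@card_le_of_inj _ _ _ _ f) => [x /fP /GAB[]//|].
  by move=> x y /fP Gx /fP Gy E; apply: Gf Gx _; rewrite E.
exfalso; apply: (Gmax (G `|` [set (a, b)])); last first.
  split.
  - by move=> z [/GAB//|-> //].
  - move=> x y y' [Gy|[? ->]] [Gy'|[? ->]] //; subst; first exact: Gf Gy Gy'.
    + by case: (Ga y).
    + by case: (Ga y').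
  - move=> x y y' [Gy|[-> ?]] [Gy'|[-> ?]] //; subst; first exact: Gi Gy Gy'.
    + by case: (Gb x).
    + by case: (Gb y).
split; first by move=> z; left.
by move=> /(_ (a, b) (or_intror erefl)); exact: Ga.
Qed.

Section square.
Variables (U : Type) (L : set U).
Let field (G : set ((U * U) * U)) := [set x | exists y b, G ((x, y), b)].
Let sqinj (G : set ((U * U) * U)) := [/\ field G `<=` L,
  forall q b b', G (q, b) -> G (q, b') -> b = b',
  forall q q' b, G (q, b) -> G (q', b) -> q = q' &
  (forall x y, field G x -> field G y -> exists2 b, field G b & G ((x, y), b)) /\
  (forall x y b, G ((x, y), b) -> field G y)].

Let mk (M : set U) (f : U * U -> U) : set ((U * U) * U) :=
  [set z | [/\ M z.1.1, M z.1.2 & z.2 = f z.1]].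

Let fieldmk M f : field (mk M f) = M.
Proof.
apply/seteqP; split=> [x [y [b [/= Mx _ _]]]//|x Mx].
by exists x, (f (x, x)).
Qed.

Let sqinj_mk (M : set U) (f : U * U -> U) : M `<=` L ->
  (forall x y, M x -> M y -> M (f (x, y))) ->
  (forall x y x' y', M x -> M y -> M x' -> M y' -> f (x, y) = f (x', y') ->
     x = x' /\ y = y') -> sqinj (mk M f).
Proof.
move=> ML Mf fi; rewrite /sqinj fieldmk; split=> //.
- by move=> q b b' [_ _ /= ->] [_ _ /= ->].
- move=> [x y] [x' y'] b [/= Mx My /= ->] [/= Mx' My' /= E].
  by have [-> ->] := fi _ _ _ _ Mx My Mx' My' E.
- split; last by move=> x y b [].
  by move=> x y Mx My; exists (f (x, y)); [exact: Mf|split].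
Qed.

(** Zorn's lemma again, on the injections [M x M -> M] with M an infinite subset of L,
    encoded by their graphs. If a maximal M absorbs its complement in L, then L embeds
    into [M x bool], hence into M. If not, the complement contains a disjoint copy of M,
    and the injection extends to the union of M and its copy. *)
Lemma card_le_square : infinite_set L -> L `*` L #<= L.
Proof.
move=> Linf.
have [l0 Ll0] := infinite_setN0 Linf.
have [e eL einj] : exists2 e : nat -> U, (forall n, L (e n)) & injective e.
  have [e [eL ei]] := inj_of_card_le l0 ((infiniteP _).1 Linf).
  by exists e => [n|x y]; [exact: eL|exact: ei].
pose P G := sqinj G /\ (G = set0 \/ infinite_set (field G)).
have P0 : P set0.
  have f0 : field set0 = set0 by apply/seteqP; split=> // x [y []].
  by split; [rewrite /sqinj f0; split=> //; split=> // x y []|left].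
have [F FP Ftot|G [[[GL Gf Gi [Gt Gs]] G0] Gmax]] := @Zorn_bigcup _ P.
  have [->|] := pselect (F = set0); first by rewrite bigcup_set0.
  move=> /eqP/set0P[G0 FG0].
  have fieldU x : field (\bigcup_(X in F) X) x <-> exists2 G, F G & field G x.
    split=> [[y [b [G FG Gx]]]|[G FG [y [b Gx]]]].
      by exists G => //; exists y, b.
    by exists y, b, G.
  split; first split.
  - by move=> x /fieldU[G FG]; have [[GL _ _ _] _] := FP _ FG; exact: GL.
  - move=> q b b' [G FG Gq] [G' FG' Gq'].
    have [[_ Gf _ _] _] := FP _ FG; have [[_ Gf' _ _] _] := FP _ FG'.
    by have [S|S] := Ftot _ _ FG FG'; [apply: Gf' Gq'|apply: Gf Gq _]; exact: S.
  - move=> q b b' [G FG Gq] [G' FG' Gq'].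
    have [[_ _ Gf _] _] := FP _ FG; have [[_ _ Gf' _] _] := FP _ FG'.
    by have [S|S] := Ftot _ _ FG FG'; [apply: Gf' Gq'|apply: Gf Gq _]; exact: S.
  - split=> [x y /fieldU[G FG Gx] /fieldU[G' FG' Gy]|x y b [G FG]]; last first.
      have [[_ _ _ [_ Gs]] _] := FP _ FG.
      by move=> /Gs Gy; apply/fieldU; exists G.
    have [S|S] := Ftot _ _ FG FG'.
      have [[_ _ _ [Gt _]] _] := FP _ FG'.
      have [||b bG Gb] := Gt x y => //.
        by case: Gx => y' [b /S Gxb]; exists y', b.
      by exists b; [apply/fieldU; exists G'|exists G'].
    have [[_ _ _ [Gt _]] _] := FP _ FG.
    have [||b bG Gb] := Gt x y => //.
      by case: Gy => y' [b /S Gyb]; exists y', b.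
    by exists b; [apply/fieldU; exists G|exists G].
  - have [F0|] := pselect (forall G, F G -> G = set0).
      by left; apply/seteqP; split=> // z [G /F0 ->].
    move=> /existsNP[G /not_implyP[FG nG]]; right.
    have [_ [//|]] := FP _ FG; apply: sub_infinite_set => x Gx.
    by apply/fieldU; exists G.
(* The maximal injection is not empty: L contains a copy of nat. *)
have Minf : infinite_set (field G).
  case: G0 => // G0; exfalso.
  have [c cinj] : exists c : nat * nat -> nat, injective c.
    by exists choice.pickle; exact: pcan_inj choice.pickleK.
  have [k [kL kP]] : exists k : U -> nat, (forall n, k (e n) = n) /\
      forall x, range e x -> e (k x) = x.
    have : forall x, exists n, range e x -> e n = x.
      move=> x; have [[n _ <-]|] := pselect (range e x); first by exists n.
      by move=> nx; exists 0.
    move=> /choice[k kP]; exists k; split=> // n.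
    by apply: einj; apply: kP; exists n.
  pose f q := e (c (k q.1, k q.2)).
  apply: (Gmax (mk (range e) f)); last first.
    split; last first.
      right; rewrite fieldmk; apply/infiniteP.
      by apply: (@card_le_of_inj _ _ _ _ e) => [n _|n m _ _ /einj//]; exists n.
    apply: sqinj_mk => [_ [n _ <-]//|x y _ _|x y x' y' Mx My Mx' My' /einj/cinj[]].
      by exists (c (k x, k y)).
    by move=> /(congr1 e) + /(congr1 e); rewrite !kP.
  rewrite G0; split; first by [].
  move=> /(_ (e 0, e 0, f (e 0, e 0))) /=; apply.
  by split=> //; exists 0.
set M := field G in Minf Gt Gs GL Gmax *.
have [f fP] : exists f : U * U -> U, forall x y, M x -> M y ->
    M (f (x, y)) /\ G ((x, y), f (x, y)).
  have : forall q : U * U, exists b, M q.1 -> M q.2 -> M b /\ G (q, b).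
    move=> [x y] /=; have [Mx|] := pselect (M x); last by exists l0.
    have [My|] := pselect (M y); last by exists l0.
    by have [b Mb Gb] := Gt _ _ Mx My; exists b.
  by move=> /choice[f fP]; exists f => x y; exact: (fP (x, y)).
have fM x y : M x -> M y -> M (f (x, y)) by move=> Mx My; have [] := fP x y.
have fi x y x' y' : M x -> M y -> M x' -> M y' -> f (x, y) = f (x', y') ->
    x = x' /\ y = y'.
  move=> Mx My Mx' My' E; have [_ H] := fP x y Mx My.
  have [_] := fP x' y' Mx' My'; rewrite -E => H'.
  by have [] := Gi _ _ _ H H'.
have GE : G = mk M f.
  apply/seteqP; split=> [[[x y] b] Gq|[[x y] b] [/= Mx My ->]].
    have Mx : M x by exists y, b.
    have My : M y by exact: Gs Gq.
    by split=> //=; apply: Gf Gq _; have [] := fP x y Mx My.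
  by have [] := fP x y Mx My.
have [m0 [m1 [Mm0 Mm1 m01]]] : exists m0 m1, [/\ M m0, M m1 & m0 <> m1].
  have [m [mM mi]] := inj_of_card_le l0 ((infiniteP _).1 Minf).
  by exists (m 0), (m 1); split; [exact: mM|exact: mM|move=> /mi H; have := H I I].
(* The two distinct points m0 and m1 serve as the elements of bool. *)
have [CM|MC] := card_le_total (L `\` M) M.
  have [j [jM ji]] := inj_of_card_le l0 CM.
  pose g x := if x \in M then f (m0, x) else f (m1, j x).
  have gM x : L x -> M (g x).
    move=> Lx; rewrite /g; case: ifPn => [/set_mem ?|/negP nM]; apply: fM => //.
    by apply: jM; split=> // Mx; apply: nM; exact: mem_set.
  have gi x y : L x -> L y -> g x = g y -> x = y.
    move=> Lx Ly; rewrite /g.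
    case: ifPn => [/set_mem Mx|/negP nx]; case: ifPn => [/set_mem My|/negP ny].
    - by move=> /fi[].
    - have Cy : (L `\` M) y by split=> // ?; apply: ny; exact: mem_set.
      by move=> /fi[]//; exact: jM.
    - have Cx : (L `\` M) x by split=> // ?; apply: nx; exact: mem_set.
      move=> /fi[]//; first exact: jM. by move=> /esym.
    - have Cy : (L `\` M) y by split=> // ?; apply: ny; exact: mem_set.
      have Cx : (L `\` M) x by split=> // ?; apply: nx; exact: mem_set.
      by move=> /fi[]//; [exact: jM|exact: jM|move=> _; exact: ji].
  apply: (@card_le_of_inj _ _ _ _ (fun q => f (g q.1, g q.2))).
    by move=> [x y] [/= Lx Ly]; apply: GL; apply: fM; exact: gM.
  move=> [x y] [x' y'] [/= Lx Ly] [/= Lx' Ly'] /fi[]; try exact: gM.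
  by move=> /gi -> // /gi ->.
exfalso.
have [j [jC ji]] := inj_of_card_le l0 MC.
pose N := M `|` j @` M.
have : forall x, exists y, N x -> M y /\ (x = y \/ ~ M x /\ x = j y).
  move=> x; have [[Mx|[y My <-]]|] := pselect (N x); last by exists l0.
    by exists x => _; split=> //; left.
  exists y => _; split=> //; right; split=> //; by case: (jC _ My).
move=> /choice[r rP].
pose t x := if x \in M then m0 else m1.
have tM x : M (t x) by rewrite /t; case: ifP.
pose h (q : U * U) := if (q.1 \in M) && (q.2 \in M) then f q else
   j (f (f (t q.1, t q.2), f (r q.1, r q.2))).
have rM x : N x -> M (r x) by move=> /rP[].
have rt x y : N x -> N y -> r x = r y -> t x = t y -> x = y.
  move=> /rP[Mx Hx] /rP[My Hy] E; rewrite /t.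
  case: ifPn => [/set_mem xM|/negP nx]; case: ifPn => [/set_mem yM|/negP ny].
  - case: Hx => [->|[]//]; case: Hy => [->|[]//]; by rewrite E.
  - by [].
  - by move=> /esym.
  - case: Hx => [xE|[_ ->]]; first by case: nx; apply/mem_set; rewrite xE.
    case: Hy => [yE|[_ ->]]; first by case: ny; apply/mem_set; rewrite yE.
    by rewrite E.
have kM x y : N x -> N y -> M (f (f (t x, t y), f (r x, r y))).
  by move=> Nx Ny; apply: (fM); apply: (fM); (exact: tM || exact: rM).
apply: (Gmax (mk N h)); last first.
  split; last first.
    right; rewrite fieldmk; apply: sub_infinite_set Minf => x; by left.
  apply: sqinj_mk.
  - by move=> x [/GL//|[y /jC[Ly _] <-]].
  - move=> x y Nx Ny; rewrite /h /=; case: ifPn => [/andP[/set_mem ? /set_mem ?]|_].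
      by left; exact: fM.
    by right; exists (f (f (t x, t y), f (r x, r y))) => //; exact: kM.
  - move=> x y x' y' Nx Ny Nx' Ny'; rewrite /h /=.
    case: ifPn => [/andP[/set_mem ? /set_mem ?]|_];
      case: ifPn => [/andP[/set_mem ? /set_mem ?]|_].
    + exact: fi.
    + move=> E; have [_ []] := jC _ (kM _ _ Nx' Ny'); rewrite -E; exact: fM.
    + move=> E; have [_ []] := jC _ (kM _ _ Nx Ny); rewrite E; exact: fM.
    + move=> /ji E; have {E} := E (kM _ _ Nx Ny) (kM _ _ Nx' Ny').
      move=> /fi[]; try (by apply: fM => //; exact: rM).
      move=> /fi[]// tx ty /fi[]; try exact: rM.
      by move=> rx ry; split; exact: rt.
rewrite GE; split.
  move=> [[x y] b] [/= Mx My ->]; split=> /=; [by left|by left|].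
  by rewrite /h /= (mem_set Mx) (mem_set My).
move=> /(_ (j m0, j m0, h (j m0, j m0)))[] //=.
  by split=> //; right; exists m0.
move=> Mj _ _; by have [_ []] := jC _ Mm0.
Qed.
End square.

Section tiny.
Variables (V : Type) (L : set V).

(** The cardinals of the nets and families that a generating set L produces: finite if L
    is finite, at most |L| otherwise. Stated in this way the class is closed under
    unions, products and finite subsets in both cases, so that finite and infinite L
    need no separate treatment. *)
Definition tiny (U : Type) (A : set U) :=
  finite_set A \/ (infinite_set L /\ A #<= L).

Lemma finite_card_le_infinite (U U' : Type) (A : set U) (B : set U') :
  finite_set A -> infinite_set B -> A #<= B.
Proof.
move=> Afin Binf; have [//|BA] := card_le_total A B.
by case: Binf; exact: card_le_finite BA Afin.
Qed.

Lemma tiny_le (U U' : Type) (A : set U) (B : set U') :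
  A #<= B -> tiny B -> tiny A.
Proof.
move=> AB [Bfin|[Linf BL]]; first by left; exact: card_le_finite AB Bfin.
by right; split=> //; exact: card_le_trans AB BL.
Qed.

Lemma tiny_image (U U' : Type) (f : U -> U') (A : set U) : tiny A -> tiny (f @` A).
Proof. exact/tiny_le/card_image_le. Qed.

Lemma sub_tiny (U : Type) (A B : set U) : A `<=` B -> tiny B -> tiny A.
Proof. by move=> AB; apply: tiny_le; exact: subset_card_le. Qed.

Lemma tiny_card_le (U : Type) (A : set U) : infinite_set L -> tiny A -> A #<= L.
Proof. by move=> Linf [Afin|[]//]; exact: finite_card_le_infinite. Qed.

Lemma tiny_countable (U : Type) (A : set U) :
  infinite_set L -> countable A -> tiny A.
Proof.
move=> Linf Ac; right; split=> //; apply: card_le_trans Ac _.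
exact/infiniteP.
Qed.

Lemma tiny_bigcup (I U : Type) (D : set I) (F : I -> set U) :
  tiny D -> (forall i, D i -> tiny (F i)) -> tiny (\bigcup_(i in D) F i).
Proof.
move=> Dt Ft; have [Lfin|Linf] := pselect (finite_set L).
  have fin (T : Type) (A : set T) : tiny A -> finite_set A by case=> [//|[]].
  by left; apply: bigcup_finite => [|i /Ft]; exact: fin.
have [[i0 Di0]|D0] := pselect (exists i, D i); last first.
  by left; rewrite bigcup0// => i Di; case: D0; exists i.
have [[u0]|U0] := pselect (exists u : U, True); last first.
  rewrite (_ : \bigcup_(_ in _) _ = set0); first by left; exact: finite_set0.
  by apply/seteqP; split=> // u _; apply: U0; exists u.
have [g gP] := surj_of_card_le i0 (tiny_card_le Linf Dt).
have : forall i, exists h : V -> U, D i -> forall u, F i u -> exists2 l, L l & h l = u.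
  move=> i; have [Di|] := pselect (D i); last by exists (fun=> u0).
  by have [h hP] := surj_of_card_le u0 (tiny_card_le Linf (Ft _ Di)); exists h.
move=> /choice[h hP] _; right; split=> //.
apply: card_le_trans (card_le_square Linf).
apply: (@card_le_of_surj _ _ _ _ (fun q => h (g q.1) q.2)) => u [i Di Fu].
have [l Ll gl] := gP _ Di; have [l' Ll' hl] := hP _ Di _ Fu.
by exists (l, l') => //=; rewrite gl.
Qed.

Lemma tiny_setX (U U' : Type) (A : set U) (B : set U') :
  tiny A -> tiny B -> tiny (A `*` B).
Proof.
move=> tA tB; apply: (@sub_tiny _ _ (\bigcup_(a in A) (pair a @` B))).
  by move=> [a b] [/= Aa Bb]; exists a => //; exists b.
by apply: tiny_bigcup => // a _; exact: tiny_image.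
Qed.

(** A finite subset is the image of a word, and the words are a countable union of
    iterated products. *)
Lemma tiny_finite_subsets (U : Type) (A : set U) :
  tiny A -> tiny [set B | B `<=` A /\ finite_set B].
Proof.
elim/Pchoice: U => U in A *; move=> [Afin|[Linf AL]].
  left; have /finite_seqP[s ->] := Afin.
  have fT : finite_set [set: {ffun 'I_(size s) -> bool}] by exact: finite_finset.
  apply: sub_finite_set (finite_image
    (fun f : {ffun 'I_(size s) -> bool} =>
       [set x | exists2 i, f i & tnth (in_tuple s) i = x]) fT).
  move=> B [Bs _]; exists [ffun i => tnth (in_tuple s) i \in B] => //.
  apply/seteqP; split=> x /=; first by move=> [i]; rewrite ffunE => /set_mem Bi <-.
  move=> Bx; have /(tnthP (in_tuple s))[i xE] : x \in s by exact: Bs.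
  by exists i => //; rewrite ffunE -xE mem_set.
have tA : tiny A by right.
pose F := fix F n : set (seq U) :=
  if n is n.+1 then (fun q => q.1 :: q.2) @` (A `*` F n) else [set [::]].
have tF n : tiny (F n).
  elim: n => [|n IH /=]; first by left; exact: finite_set1.
  by apply: tiny_image; exact: tiny_setX.
apply: (@tiny_le _ _ _ (\bigcup_(n in [set: nat]) F n)); last first.
  apply: tiny_bigcup => // ; apply: tiny_countable => //; exact: countableP.
apply: (@card_le_of_surj _ _ _ _ (fun s : seq U => [set` s])) => B [BA /finite_seqP[s Bs]].
exists s; last by rewrite Bs.
have {Bs} : forall x, x \in s -> A x by move=> x xs; apply: BA; rewrite Bs.
move=> sA; exists (size s) => //; elim: s sA => //= a s IH sA.
exists (a, s) => //; split=> /=; first by apply: sA; exact: mem_head.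
by apply: IH => x xs; apply: sA; rewrite inE xs orbT.
Qed.

End tiny.

Lemma small_tiny (K U : Type) (A : set U) : ~ ([set: K] #<= A) -> tiny A A.
Proof.
move=> _; have [?|?] := pselect (finite_set A); [by left|right].
by split=> //; exact: card_lexx.
Qed.

Lemma tiny_small (K U U' : Type) (A : set U) (B : set U') :
  infinite_set [set: K] -> ~ ([set: K] #<= A) -> tiny A B -> ~ ([set: K] #<= B).
Proof.
move=> Kinf KA [Bfin KB|[_ BA] KB]; first exact: Kinf (card_le_finite KB Bfin).
by apply: KA; exact: card_le_trans KB BA.
Qed.

(** This plays the role of the initial ordinal of the cardinality of K: in a well-order
    of K, cut at the first element that has at least [|K|] predecessors, if there is
    one. *)
Lemma initial_well_order (K : Type) : exists (I : set K) (lt : K -> K -> Prop),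
  [/\ well_founded lt,
      forall a b c, lt a b -> lt b c -> lt a c,
      forall a b, lt a b \/ a = b \/ lt b a,
      [set: K] #<= I &
      forall a, I a -> ~ ([set: K] #<= [set b | I b /\ lt b a])].
Proof.
elim/Pchoice: K => K.
have [R Rwo] := wochoice.well_ordering_principle K.
have minP (A : set K) x : A x -> exists2 z, A z & forall y, A y -> R z y.
  move=> Ax; have [|z [[/set_mem Az zA] _]] := Rwo (mem A).
    by exists x; exact: mem_set.
  by exists z => // y Ay; apply: zA; exact: mem_set.
have anti a b : R a b -> R b a -> a = b.
  move=> Rab Rba; have [|z [[zA _] zu]] := Rwo (mem [set a; b]).
    by exists a; apply/mem_set; left.
  have refl x : R x x.
    by have [//|y -> /(_ x)] := minP [set x] x; apply.
  rewrite -(zu a) ?(zu b)//; split.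
  - by apply/mem_set; right.
  - by move=> x /set_mem[]->.
  - by apply/mem_set; left.
  - by move=> x /set_mem[]->.
pose lt a b := R a b /\ a <> b.
have total a b : R a b \/ R b a.
  have [|z [->|->] zP] := minP [set a; b] a; first by left.
    by left; apply: zP; right.
  by right; apply: zP; left.
have trans a b c : lt a b -> lt b c -> lt a c.
  move=> [ab nab] [bc nbc]; have nac : a <> c.
    by move=> ac; subst; apply: nab; exact: anti.
  split=> //; have [|z zE zP] := minP [set a; b; c] a; first by left; left.
  case: zE zP => [[->|->]|->] zP.
  - by apply: zP; right.
  - by case: nab; apply: anti => //; apply: zP; left; left.
  - by case: nbc; apply: anti => //; apply: zP; left; right.
have wf : well_founded lt.
  move=> a; apply: contrapT => na.
  have [z nz zP] := minP [set a | ~ Acc lt a] a na.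
  apply: nz; constructor => y [yz nyz]; apply: contrapT => /zP zy.
  by apply: nyz; exact: anti.
have tri a b : lt a b \/ a = b \/ lt b a.
  have [->|nab] := pselect (a = b); first by right; left.
  by have [?|?] := total a b; [left|right; right; split=> //; exact: nesym].
have [[a0 Ka0]|nK] := pselect (exists a, [set: K] #<= [set b | lt b a]); last first.
  exists setT, lt; split=> // a _; apply: contra_not nK => Ka; exists a.
  by apply: card_le_trans Ka _; apply: subset_card_le => b [].
have [a Ka aP] := minP [set a | [set: K] #<= [set b | lt b a]] a0 Ka0.
exists [set b | lt b a], lt; split=> // b [ba nba] Kb; apply: nba; apply: anti => //.
by apply: aP; apply: card_le_trans Kb _; apply: subset_card_le => c [].
Qed.

Local Close Scope card_scope.
Local Open Scope ring_scope.

(** * Linear spans and their nets *)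

Section spans.
Context (R : realType) (V : normedModType R).
Implicit Types (A B S : set V) (x y f g v : V).

Lemma linear_span_min A B :
  A `<=` B -> B 0 -> (forall x y, B x -> B y -> B (x + y)) ->
  (forall a x, B x -> B (a *: x)) -> linear_span A `<=` B.
Proof.
move=> AB B0 BD BZ _ [n [a [v [Av ->]]]].
by elim/big_ind: _ => // i _; apply: BZ; exact: AB.
Qed.

Lemma linear_span_incl A : A `<=` linear_span A.
Proof.
move=> x Ax; exists 1%N, (fun=> 1), (fun=> x); split=> //.
by rewrite big_ord1 scale1r.
Qed.

Lemma linear_span0 A : linear_span A 0.
Proof.
by exists 0%N, (fun=> 0), (fun=> 0); split; [case|rewrite big_ord0].
Qed.

Lemma linear_spanD A x y : linear_span A x -> linear_span A y -> linear_span A (x + y).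
Proof.
move=> [n [a [v [Av ->]]]] [m [b [w [Aw ->]]]].
exists (n + m)%N, (fun i => match fintype.split i with inl j => a j | inr k => b k end),
  (fun i => match fintype.split i with inl j => v j | inr k => w k end); split.
  by move=> i; case: fintype.split.
rewrite big_split_ord /=; congr (_ + _); apply: eq_bigr => i _.
  by rewrite (unsplitK (inl i)).
by rewrite (unsplitK (inr i)).
Qed.

Lemma linear_spanZ A a x : linear_span A x -> linear_span A (a *: x).
Proof.
move=> [n [b [v [Av ->]]]]; exists n, (fun i => a * b i), v; split=> //.
by rewrite scaler_sumr; apply: eq_bigr => i _; rewrite scalerA.
Qed.

Lemma linear_spanB A x y : linear_span A x -> linear_span A y -> linear_span A (x - y).
Proof.
by move=> Ax Ay; rewrite -scaleN1r; apply: linear_spanD => //; exact: linear_spanZ.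
Qed.

Lemma linear_spanS A B : A `<=` B -> linear_span A `<=` linear_span B.
Proof.
move=> AB; apply: linear_span_min.
- by apply: subset_trans AB _; exact: linear_span_incl.
- exact: linear_span0.
- exact: linear_spanD.
- exact: linear_spanZ.
Qed.

Lemma closure_normP A x :
  closure A x <-> forall e, 0 < e -> exists2 y, A y & `|x - y| <= e.
Proof.
split=> [cA e e0|H B /nbhs_ballP[e /= e0 eB]].
  have [|y [Ay]] := cA (ball x e); first exact: nbhsx_ballx.
  by rewrite -ball_normE /= => /ltW ye; exists y.
have [|y Ay xy] := H (e / 2); first by rewrite divr_gt0.
exists y; split=> //; apply: eB; rewrite -ball_normE /=.
by rewrite (le_lt_trans xy)// gtr_pMr// invf_lt1// ltr1n.
Qed.

Lemma closure_span0 A : closure (linear_span A) 0.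
Proof. exact/subset_closure/linear_span0. Qed.

Lemma closure_spanD A x y : closure (linear_span A) x -> closure (linear_span A) y ->
  closure (linear_span A) (x + y).
Proof.
move=> /closure_normP Ax /closure_normP Ay; apply/closure_normP => e e0.
have e20 : 0 < e / 2 by rewrite divr_gt0.
have [x' Ax' xx'] := Ax _ e20; have [y' Ay' yy'] := Ay _ e20.
exists (x' + y'); first exact: linear_spanD.
rewrite opprD addrACA (le_trans (ler_normD _ _))//.
by rewrite (le_trans (lerD xx' yy'))// -splitr.
Qed.

Lemma closure_spanZ A a x : closure (linear_span A) x ->
  closure (linear_span A) (a *: x).
Proof.
move=> /closure_normP Ax; apply/closure_normP => e e0.
have a1 : 0 < `|a| + 1 by rewrite ltr_wpDl.
have [|x' Ax' xx'] := Ax (e / (`|a| + 1)); first by rewrite divr_gt0.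
exists (a *: x'); first exact: linear_spanZ.
rewrite -scalerBr normrZ (le_trans (ler_wpM2l _ xx'))//.
by rewrite mulrCA ger_pMr// ler_pdivrMr// mul1r lerDl.
Qed.

Lemma closure_spanB A x y : closure (linear_span A) x -> closure (linear_span A) y ->
  closure (linear_span A) (x - y).
Proof.
by move=> Ax Ay; rewrite -scaleN1r; apply: closure_spanD => //; exact: closure_spanZ.
Qed.

(** Induction on the length of the family. If the family is linearly dependent, one of
    its members can be dropped. If it is independent, the coefficients are controlled by
    the norm of the combination, by compactness of the unit sphere of the coefficients,
    so that the combinations in question form a compact set. *)
Lemma finite_family_net n (v : 'I_n -> V) (M e : R) : 0 < e ->
  exists2 C : set V, finite_set C & forall c : 'I_n -> R,
    `|\sum_(i < n) c i *: v i| <= M ->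
    exists2 x, C x & `|\sum_(i < n) c i *: v i - x| <= e.
Proof.
move=> e0; pose T (n : nat) (v : 'I_n -> V) (x : 'rV[R]_n) := \sum_(i < n) x 0 i *: v i.
have Tcont m (w : 'I_m -> V) : continuous (T m w).
  apply: continuous_big => [|i _ x]; first exact: add_continuous.
  by apply: (@cvgZr_tmp R V _ (nbhs x) _ (fun y : 'rV[R]_m => y 0 i)); exact: (@coord_continuous R 1 m 0 i x).
elim: n v => [|n IH] v.
  exists [set 0]; first exact: finite_set1.
  by move=> c _; exists 0 => //; rewrite big_ord0 subr0 normr0 ltW.
have [[c [i [c0 cv]]]|ind] := pselect (exists c : 'I_n.+1 -> R, exists i,
    c i != 0 /\ \sum_(i < n.+1) c i *: v i = 0).
  have [C Cfin CP] := IH (v \o lift i); exists C => // a.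
  suff -> : \sum_(j < n.+1) a j *: v j =
      \sum_(j < n) (a (lift i j) - a i / c i * c (lift i j)) *: v (lift i j) by exact: CP.
  transitivity (\sum_(j < n.+1) a j *: v j - (a i / c i) *: \sum_(j < n.+1) c j *: v j).
    by rewrite cv scaler0 subr0.
  rewrite scaler_sumr -sumrB (bigD1_ord i)//=.
  rewrite scalerA divfK// subrr add0r; apply: eq_bigr => j _.
  by rewrite scalerA scalerBl.
pose K := [set x : 'rV[R]_n.+1 | `|x| = 1].
have Kc : compact K.
  apply: bounded_closed_compact.
    by exists 1; split; [exact: num_real|move=> y y1 x /= ->; exact: ltW].
  rewrite (_ : K = (fun x : 'rV[R]_n.+1 => `|x|) @^-1` [set 1])//.
  apply: closed_comp => [x _|]; first exact: norm_continuous.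
  exact: closed_eq.
have gc : continuous (fun x : 'rV[R]_n.+1 => `|T n.+1 v x|).
  by move=> x; apply: continuous_comp; [exact: Tcont|exact: norm_continuous].
have iKc : compact ((fun x : 'rV[R]_n.+1 => `|T n.+1 v x|) @` K).
  by apply: continuous_compact Kc; exact: continuous_subspaceT.
have : (~` ((fun x : 'rV[R]_n.+1 => `|T n.+1 v x|) @` K)) 0.
  move=> [x /= x1 /eqP]; rewrite normr_eq0 => /eqP Tx.
  apply: ind; exists (x 0).
  have : x != 0 by rewrite -normr_eq0 x1 oner_eq0.
  by move=> /rV0Pn[i xi]; exists i.
move=> K0; have : nbhs (0 : R) (~` ((fun x : 'rV[R]_n.+1 => `|T n.+1 v x|) @` K)).
  apply: open_nbhs_nbhs; split=> //; apply: closed_openC.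
  by apply: compact_closed => //; exact: Rhausdorff.
move=> /nbhs_ballP[d /= d0 dK].
(* By homogeneity, d bounds the coefficients in terms of the combination. *)
have Td (x : 'rV[R]_n.+1) : d * `|x| <= `|T n.+1 v x|.
  have [->|x0] := eqVneq x 0; first by rewrite normr0 mulr0.
  rewrite leNgt; apply/negP => Tx.
  have nx0 : 0 < `|x| by rewrite normr_gt0.
  apply: (dK (`|T n.+1 v (`|x|^-1 *: x)|)); last first.
    exists (`|x|^-1 *: x) => //; rewrite /K /= normrZ normfV normr_id mulVf//.
    by rewrite gt_eqF.
  rewrite -ball_normE /= sub0r normrN normr_id.
  rewrite (_ : T _ _ _ = `|x|^-1 *: T n.+1 v x); last first.
    by rewrite /T scaler_sumr; apply: eq_bigr => i _; rewrite mxE scalerA.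
  by rewrite normrZ normfV normr_id mulrC ltr_pdivrMr.
pose B := [set x : 'rV[R]_n.+1 | `|x| <= M / d].
have Bc : compact B.
  apply: bounded_closed_compact.
    by exists (M / d); split; [exact: num_real|move=> y y1 x /= /le_trans; apply; exact: ltW].
  rewrite (_ : B = (fun x : 'rV[R]_n.+1 => `|x|) @^-1` [set y | y <= M / d])//.
  by apply: closed_comp => [x _|]; [exact: norm_continuous|exact: closed_le].
have : compact (T n.+1 v @` B).
  by apply: continuous_compact Bc; apply: continuous_subspaceT; exact: Tcont.
rewrite compact_cover => /(_ V setT (fun x => ball x e)) [|x _|D _ DP].
- by move=> x _; exact: ball_open.
- by exists x => //; exact: ballxx.
exists [set` D]; first exact: finite_fset.
move=> c cM; have [|x Dx] := DP (\sum_(i < n.+1) c i *: v i).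
  exists (\row_i c i); last by rewrite /T; apply: eq_bigr => i _; rewrite mxE.
  rewrite /B /= ler_pdivlMr// [leLHS]mulrC (le_trans (Td _))// /T.
  by under eq_bigr do rewrite mxE.
by rewrite -ball_normE /= distrC => /ltW xe; exists x.
Qed.

Lemma finite_span_net S (M e : R) : finite_set S -> 0 < e ->
  exists2 C : set V, finite_set C & forall f, linear_span S f -> `|f| <= M ->
    exists2 x, C x & `|f - x| <= e.
Proof.
move=> /finite_seqP[s ->] e0.
have [C Cfin CP] := @finite_family_net _ (tnth (in_tuple s)) M e e0.
exists C => // f; suff : linear_span [set` s] `<=`
    [set f | exists c : 'I_(size s) -> R, f = \sum_i c i *: tnth (in_tuple s) i].
  by move=> H /H[c ->]; exact: CP.
apply: linear_span_min.
- move=> x /= /(tnthP (in_tuple s))[i ->]; exists (fun j => (j == i)%:R).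
  rewrite (bigD1 i)//= eqxx scale1r big1 ?addr0// => j /negPf ->.
  by rewrite scale0r.
- by exists (fun=> 0); rewrite big1// => i _; rewrite scale0r.
- move=> _ _ [c ->] [d ->]; exists (fun i => c i + d i).
  by rewrite -big_split; apply: eq_bigr => i _; rewrite scalerDl.
- move=> a _ [c ->]; exists (fun i => a * c i).
  by rewrite scaler_sumr; apply: eq_bigr => i _; rewrite scalerA.
Qed.

(** Finite combinations with rational coefficients. *)
Lemma tiny_dense (W : Type) (L : set W) S : infinite_set L -> tiny L S ->
  exists2 D : set V, tiny L D & forall f, closure (linear_span S) f ->
    forall e, 0 < e -> exists2 c, D c & `|f - c| <= e.
Proof.
move=> Linf tS.
pose F := fix F n : set V :=
  if n is n.+1 then (fun q : V * (rat * V) => q.1 + ratr q.2.1 *: q.2.2) @`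
    (F n `*` ([set: rat] `*` S)) else [set 0].
have tF n : tiny L (F n).
  elim: n => [|n IH /=]; first by left; exact: finite_set1.
  apply: tiny_image; apply: tiny_setX => //; apply: tiny_setX => //.
  by apply: tiny_countable => //; exact: countableP.
(* F n is the set of rational combinations of n members of S. *)
exists (\bigcup_(n in [set: nat]) F n).
  by apply: tiny_bigcup => //; apply: tiny_countable => //; exact: countableP.
move=> f /closure_normP cf e e0.
have e20 : 0 < e / 2 by rewrite divr_gt0.
have [_ [n [a [v [Sv ->]]]] fg] := cf _ e20.
suff [c Fc cP] : exists2 c, F n c & `|\sum_(i < n) a i *: v i - c| <= e / 2.
  exists c; first by exists n.
  apply: le_trans (ler_distD (\sum_(i < n) a i *: v i) _ _) _.
  by rewrite (le_trans (lerD fg cP))// -splitr.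
clear fg; elim: n a v Sv (e / 2) e20 => [|n IH] a v Sv d d0.
  by exists 0 => //; rewrite big_ord0 subr0 normr0 ltW.
have d20 : 0 < d / 2 by rewrite divr_gt0.
have [||c Fc cP] := IH (a \o widen_ord (leqnSn n)) (v \o widen_ord (leqnSn n)) _ (d / 2) => //.
  by move=> i; exact: Sv.
have v1 : 0 < `|v ord_max| + 1 by rewrite ltr_wpDl.
have h0 : 0 < d / 2 / (`|v ord_max| + 1) by rewrite divr_gt0.
have [q] : exists q, ratr q \in
    `]a ord_max - d / 2 / (`|v ord_max| + 1), a ord_max + d / 2 / (`|v ord_max| + 1)[.
  by apply: rat_in_itvoo; lra.
rewrite in_itv /= => /andP[q1 q2].
exists (c + ratr q *: v ord_max).
  by exists (c, (q, v ord_max)) => //; split=> //; split=> //; exact: Sv.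
rewrite big_ord_recr /= opprD addrACA (le_trans (ler_normD _ _))//.
rewrite [leRHS]splitr lerD// -scalerBl normrZ.
have aq : `|a ord_max - ratr q| <= d / 2 / (`|v ord_max| + 1).
  by rewrite ler_norml; apply/andP; split; lra.
rewrite (le_trans (ler_wpM2r _ aq))// mulrAC ler_pdivrMr// ler_pM2l//.
by rewrite lerDl.
Qed.

(** A bounded part of a span has an e-net of no more than the size of the spanning set;
    when that set is finite the net must be finite too, which is why the part has to be
    bounded. *)
Lemma tiny_net (W : Type) (L : set W) S (M e : R) : tiny L S -> 0 < e ->
  exists2 C : set V, tiny L C & forall f, closure (linear_span S) f -> `|f| <= M ->
    exists2 x, C x & `|f - x| <= e.
Proof.
move=> tS e0; have e20 : 0 < e / 2 by rewrite divr_gt0.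
have [Sfin|Sinf] := pselect (finite_set S).
  have [C Cfin CP] := @finite_span_net S (M + e / 2) (e / 2) Sfin e20.
  exists C; first by left.
  move=> f /closure_normP /(_ _ e20)[g Sg fg] fM; have [//||x Cx gx] := CP g.
    rewrite -[g](subrKC f) (le_trans (ler_normD _ _))// lerD// distrC //.
  exists x => //.
  by rewrite (le_trans (ler_distD g _ _))// (le_trans (lerD fg gx))// -splitr.
case: tS => [//|[Linf SL]].
have [|D tD DP] := @tiny_dense _ L S Linf; first by right.
by exists D => // f cf _; exact: DP.
Qed.

End spans.

(** * Restrictions and indicators in Lp *)

Section Lp_restriction.
Context d (T : measurableType d) (R : realType) (mu : {measure set T -> \bar R}).
Context (p : R) (p1 : (1 <= p%:E)%E).
Local Notation E := (LspaceType mu p1).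
Implicit Types (F G : E) (f g : T -> R) (A B : set T).

Let p_ge1 : 1 <= p. Proof. by rewrite -lee_fin. Qed.
Let p_gt0 : 0 < p. Proof. exact: lt_le_trans p_ge1. Qed.

Definition lrep F : T -> R := Lspace_repr F.

Definition integral_powR f : \bar R := (\int[mu]_x (`|f x| `^ p)%:E)%E.

Lemma measurable_lrep F : measurable_fun setT (lrep F).
Proof. exact: (@measurable_funPT _ _ _ _ (Lspace_repr F)). Qed.

Lemma measurable_abs_powR f D : measurable_fun D f ->
  measurable_fun D (fun x => (`|f x| `^ p)%:E : \bar R).
Proof.
move=> mf; apply/measurable_EFinP.
apply: (measurableT_comp (measurable_powR p)) => //.
exact: measurableT_comp.
Qed.

Lemma eq_Lspace F G : lrep F = lrep G %[ae mu] -> F = G.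
Proof.
move=> FG; rewrite -(Lspace_classK F) -(Lspace_classK G).
exact: eq_Lspace_class.
Qed.

Lemma norm_integral_powR F : (`|F| `^ p)%:E = integral_powR (lrep F).
Proof.
have -> : `|F| = fine ('N[mu]_p%:E[EFin \o (Lspace_repr F : T -> R)])%E by [].
rewrite -poweR_EFin (finite_norm_fine (Lspace_repr F)) poweR_Lnorm; last first.
  by rewrite gt_eqF.
by [].
Qed.

Lemma ae_integral_powR f g : measurable_fun setT f -> measurable_fun setT g ->
  f = g %[ae mu] -> integral_powR f = integral_powR g.
Proof.
move=> mf mg fg; apply: ge0_ae_eq_integral => //.
- exact: measurable_abs_powR.
- exact: measurable_abs_powR.
- by apply: filterS fg => x /= fg _; rewrite fg.
Qed.

Lemma Lclass_ex f : measurable_fun setT f -> (integral_powR f < +oo)%E ->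
  exists F, lrep F = f %[ae mu].
Proof.
move=> mf fi; have fL : f \in Lfun mu p%:E.
  rewrite inE; apply/andP; split; apply: mem_set => //=.
  rewrite /finite_norm unlock /Lnorm.
  exact: poweR_lty.
exists (Lspace_class (Lfun_Sub p1 fL)).
exact: (Lspace_reprK (Lfun_Sub p1 fL)).
Qed.

(** The value is meaningful only for measurable f with a finite p-th power integral; the
    default value 0 spares every later statement a proof of this. *)
Definition Lclass f : E := xget 0 [set F | lrep F = f %[ae mu]].

Lemma LclassE f : measurable_fun setT f -> (integral_powR f < +oo)%E ->
  lrep (Lclass f) = f %[ae mu].
Proof.
move=> mf /(Lclass_ex mf)[F FE]; rewrite /Lclass.
by case: xgetP => [G _ //|/(_ F)].
Qed.

Lemma lrepD F G : lrep (F + G) = lrep F \+ lrep G %[ae mu].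
Proof. exact: (Lspace_reprK (Lspace_repr F + Lspace_repr G)). Qed.

Lemma lrepZ (a : R) F : lrep (a *: F) = (fun x => a * lrep F x) %[ae mu].
Proof. exact: (Lspace_reprK (a *: Lspace_repr F)). Qed.

Lemma lrep0 : lrep 0 = cst 0 %[ae mu].
Proof. exact: (Lspace_reprK (0 : LfunType mu p1)). Qed.

Lemma lrepB F G : lrep (F - G) = lrep F \- lrep G %[ae mu].
Proof.
rewrite -scaleN1r; have := lrepZ (-1) G; have := lrepD F (-1 *: G).
by apply: filterS2 => x + + _ => /= -> // ->//; rewrite mulN1r.
Qed.

Lemma integral_powR_lty F : (integral_powR (lrep F) < +oo)%E.
Proof. by rewrite -norm_integral_powR ltry. Qed.

Definition restr A F : E := Lclass (lrep F \* \1_A).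

Lemma integral_powR_restr A f : measurable A -> measurable_fun setT f ->
  integral_powR (f \* \1_A) = (\int[mu]_(x in A) (`|f x| `^ p)%:E)%E.
Proof.
move=> mA mf; rewrite /integral_powR [RHS]integral_mkcond; apply: eq_integral => x _.
rewrite patchE /= indicE; case: (x \in A); rewrite ?mulr1//.
by rewrite mulr0 normr0 powR0// gt_eqF.
Qed.

Lemma measurable_restr A f : measurable A -> measurable_fun setT f ->
  measurable_fun setT (f \* \1_A).
Proof. by move=> mA mf; apply: measurable_funM. Qed.

Lemma lrep_restr A F : measurable A -> lrep (restr A F) = lrep F \* \1_A %[ae mu].
Proof.
move=> mA; have mF := measurable_lrep F.
apply: LclassE; first exact: measurable_restr.
rewrite integral_powR_restr//; apply: le_lt_trans (integral_powR_lty F).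
apply: ge0_subset_integral => //; exact: measurable_abs_powR.
Qed.

Lemma norm_restr A F : measurable A ->
  (`|restr A F| `^ p)%:E = (\int[mu]_(x in A) (`|lrep F x| `^ p)%:E)%E.
Proof.
move=> mA; rewrite norm_integral_powR -(integral_powR_restr mA (measurable_lrep F)).
apply: ae_integral_powR; [exact: measurable_lrep| |exact: lrep_restr].
by apply: measurable_restr => //; exact: measurable_lrep.
Qed.

Lemma restrD A F G : measurable A -> restr A (F + G) = restr A F + restr A G.
Proof.
move=> mA; apply: eq_Lspace.
have H : lrep (restr A F + restr A G) = lrep F \* \1_A \+ lrep G \* \1_A %[ae mu].
  have := lrepD (restr A F) (restr A G); have := lrep_restr F mA; have := lrep_restr G mA.
  by apply: filterS3 => x + + + _ => /= Gx Fx -> //; rewrite Gx// Fx.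
have := lrepD F G; have := lrep_restr (F + G) mA.
by move: H; apply: filterS3 => x + + + _ => /= -> // -> // -> //; rewrite mulrDl.
Qed.

Lemma restrZ A (a : R) F : measurable A -> restr A (a *: F) = a *: restr A F.
Proof.
move=> mA; apply: eq_Lspace.
have H : lrep (a *: restr A F) = (fun x => a * (lrep F x * \1_A x)) %[ae mu].
  have := lrepZ a (restr A F); have := lrep_restr F mA.
  by apply: filterS2 => x + + _ => /= Fx -> //; rewrite Fx.
have := lrepZ a F; have := lrep_restr (a *: F) mA.
by move: H; apply: filterS3 => x + + + _ => /= -> // -> // -> //; rewrite mulrA.
Qed.

Lemma restrI A B F : measurable A -> measurable B ->
  restr A (restr B F) = restr (A `&` B) F.
Proof.
move=> mA mB; apply: eq_Lspace.
have := lrep_restr (restr B F) mA; have := lrep_restr F mB.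
have := lrep_restr F (measurableI _ _ mA mB); apply: filterS3 => x + + + _ => /=.
by move=> -> // Fx -> //; rewrite Fx// indicI /=; ring.
Qed.

Lemma normp_restr_le A B F : measurable A -> measurable B -> A `<=` B ->
  `|restr A F| `^ p <= `|restr B F| `^ p.
Proof.
move=> mA mB AB; rewrite -lee_fin !norm_restr//; apply: ge0_subset_integral => //.
by apply: measurable_abs_powR; apply: measurable_funTS; exact: measurable_lrep.
Qed.

Lemma normp_restrT F : `|restr setT F| `^ p = `|F| `^ p.
Proof. by apply: EFin_inj; rewrite norm_restr// norm_integral_powR. Qed.

(** Additivity of the p-th power of the norm over almost disjoint sets is what lets a
    function concentrated on one set act as the second summand of a p-sum. *)
Lemma normp_restrU A B F : measurable A -> measurable B -> mu (A `&` B) = 0%E ->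
  `|restr (A `|` B) F| `^ p = `|restr A F| `^ p + `|restr B F| `^ p.
Proof.
move=> mA mB AB0; apply: EFin_inj; rewrite EFinD !norm_restr//; last exact: measurableU.
have mF D : measurable_fun D (fun x => (`|lrep F x| `^ p)%:E : \bar R).
  by apply: measurable_abs_powR; apply: measurable_funTS; exact: measurable_lrep.
have mBA := measurableD mB mA; have mAB := measurableI _ _ mA mB.
have -> : A `|` B = A `|` B `\` A.
  by apply/seteqP; split=> x []; have := pselect (A x); rewrite /setU/setD/=; tauto.
rewrite ge0_integral_setU//; last by rewrite disj_set2E setDIK.
congr (_ + _)%E.
have BU : B = B `&` A `|` B `\` A by rewrite setUIDK.
rewrite [in RHS]BU ge0_integral_setU//; last 2 first.
- exact: measurableI.
- by rewrite disj_set2E; apply/eqP/seteqP; split=> // x [[]] /[swap] ? ? [].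
rewrite [X in _ = (X + _)%E]null_set_integral ?add0e//; last by rewrite setIC.
exact: measurableI.
Qed.

Lemma measure_sub_lty A B : measurable A -> measurable B -> A `<=` B ->
  (mu B < +oo)%E -> (mu A < +oo)%E.
Proof.
by move=> mA mB AB; apply: le_lt_trans; apply: le_measure => //; exact: mem_set.
Qed.

Definition ind A : E := Lclass \1_A.

Lemma integral_powR_ind A : measurable A -> integral_powR \1_A = mu A.
Proof.
move=> mA; rewrite -[in RHS](setIT A) -integral_indic//.
apply: eq_integral => x _; rewrite indicE; case: (x \in A) => /=.
  by rewrite normr1 powR1.
by rewrite normr0 powR0// gt_eqF.
Qed.

Lemma lrep_ind A : measurable A -> (mu A < +oo)%E -> lrep (ind A) = \1_A %[ae mu].
Proof. by move=> mA Afin; apply: LclassE; rewrite ?integral_powR_ind. Qed.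

Lemma norm_ind A : measurable A -> (mu A < +oo)%E -> (`|ind A| `^ p)%:E = mu A.
Proof.
move=> mA Afin; rewrite norm_integral_powR -(integral_powR_ind mA).
by apply: ae_integral_powR; [exact: measurable_lrep|exact: measurable_indic|exact: lrep_ind].
Qed.

Lemma restr_ind A B : measurable A -> measurable B -> (mu A < +oo)%E ->
  restr B (ind A) = ind (A `&` B).
Proof.
move=> mA mB Afin; have mAB := measurableI _ _ mA mB.
have ABfin : (mu (A `&` B) < +oo)%E.
  by apply: (measure_sub_lty _ mA) => // x [].
apply: eq_Lspace; have := lrep_restr (ind A) mB; have := lrep_ind mA Afin.
have := lrep_ind mAB ABfin; apply: filterS3 => x + + + _ => /= -> // AE -> //.
by rewrite AE// indicI.
Qed.

Lemma ae_ind A B : measurable A -> measurable B -> (mu A < +oo)%E ->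
  mu (A `\` B) = 0%E -> mu (B `\` A) = 0%E -> ind A = ind B.
Proof.
move=> mA mB Afin AB BA; have mAB := measurableD mA mB; have mBA := measurableD mB mA.
rewrite /ind; suff E (f : T -> R) : f = \1_A %[ae mu] <-> f = \1_B %[ae mu].
  by rewrite /Lclass; congr (xget _ _); apply/seteqP; split=> F /= /E.
have N : (\1_A : T -> R) = \1_B %[ae mu].
  exists (A `\` B `|` B `\` A); split; first exact: measurableU.
    by rewrite null_set_setU.
  move=> x /= /not_implyP[_]; rewrite !indicE /setU /setD /=.
  have [xA|xA] := pselect (A x); have [xB|xB] := pselect (B x).
  - by rewrite !mem_set.
  - by left.
  - by right.
  - by rewrite !memNset.
by split=> H; move: H N; apply: filterS2 => x + + _ => /= -> // ->.
Qed.

Lemma indU A B : measurable A -> measurable B -> (mu A < +oo)%E -> (mu B < +oo)%E ->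
  A `&` B = set0 -> ind (A `|` B) = ind A + ind B.
Proof.
move=> mA mB Afin Bfin AB0.
have ABfin : (mu (A `|` B) < +oo)%E.
  apply: le_lt_trans (measureU2 mu mA mB) _; exact: lte_add_pinfty.
apply: eq_Lspace.
have H : lrep (ind A + ind B) = \1_A \+ \1_B %[ae mu].
  have := lrepD (ind A) (ind B); have := lrep_ind mA Afin; have := lrep_ind mB Bfin.
  by apply: filterS3 => x + + + _ => /= Bx Ax -> //; rewrite Bx// Ax.
have := lrep_ind (measurableU _ _ mA mB) ABfin; move: H.
apply: filterS2 => x + + _ => /= -> // -> //; rewrite !indicE in_setU.
have [/set_mem xA|] := boolP (x \in A); last by rewrite /= add0r.
have [/set_mem xB|] := boolP (x \in B); last by rewrite /= addr0.
by have : (A `&` B) x by []; rewrite AB0.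
Qed.

Lemma indD A B : measurable A -> measurable B -> (mu A < +oo)%E ->
  B `<=` A -> ind (A `\` B) = ind A - ind B.
Proof.
move=> mA mB Afin BA; have mAB := measurableD mA mB.
have Bfin : (mu B < +oo)%E by exact: (measure_sub_lty mB mA).
have ABfin : (mu (A `\` B) < +oo)%E.
  by apply: (measure_sub_lty _ mA) => // x [].
apply/esym/eqP; rewrite subr_eq -indU//; last by rewrite setIC setDIK.
by rewrite setUC setDUK.
Qed.

Lemma ind_null A : measurable A -> mu A = 0%E -> ind A = 0.
Proof.
move=> mA A0; apply/eqP; rewrite -normr_eq0; apply/eqP/(@powR_eq0_eq0 _ _ p).
by apply: EFin_inj; rewrite norm_ind// A0.
Qed.

End Lp_restriction.

Section Lp_simple.
Context d (T : measurableType d) (R : realType) (mu : {measure set T -> \bar R}).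
Context (p : R) (p1 : (1 <= p%:E)%E).
Local Notation E := (LspaceType mu p1).
Implicit Types (F G : E) (f g : T -> R) (A B : set T).

Let p_ge1 : 1 <= p. Proof. by rewrite -lee_fin. Qed.
Let p_gt0 : 0 < p. Proof. exact: lt_le_trans p_ge1. Qed.

Lemma normp_le F (e : R) : 0 <= e -> `|F| `^ p <= e `^ p -> `|F| <= e.
Proof.
move=> e0; apply: contraTT; rewrite -!ltNge => eF.
by apply: gt0_ltr_powR; rewrite ?nnegrE.
Qed.

Lemma norm_ind_bigcup (A : (set T)^nat) (e : R) : (forall n, measurable (A n)) ->
  nondecreasing_seq A -> (mu (\bigcup_n A n) < +oo)%E -> 0 < e ->
  exists n, `|ind mu p1 (\bigcup_n A n) - ind mu p1 (A n)| <= e.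
Proof.
move=> mA Ai Ufin e0; set U := \bigcup_n A n.
have mU : measurable U by exact: bigcup_measurable.
have AU n : A n `<=` U by move=> x Ax; exists n.
have ufin : mu U \is a fin_num by rewrite ge0_fin_numE.
have : mu \o A @ \oo --> (fine (mu U))%:E.
  by rewrite fineK//; exact: nondecreasing_cvg_mu.
move=> /fine_cvgP[_ /cvgrPdist_le /(_ (e `^ p))].
rewrite powR_gt0// => /(_ isT)[n _ /(_ _ (leqnn n)) /= En].
exists n; rewrite -indD//; apply: normp_le; first exact: ltW.
have Anfin := measure_sub_lty (mA n) mU (AU n) Ufin.
have mUA := measurableD mU (mA n).
rewrite -lee_fin norm_ind//; last exact: (measure_sub_lty mUA mU (@subDsetl _ _ _)).
have anfin : mu (A n) \is a fin_num by rewrite ge0_fin_numE.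
have -> : (mu (U `\` A n) = (fine (mu U) - fine (mu (A n)))%:E)%E.
  by rewrite EFinB !fineK// measureD// setIidr.
rewrite lee_fin; exact: le_trans (ler_norm _) En.
Qed.

Lemma lrep_sum_ind n (c : 'I_n -> R) (A : 'I_n -> set T) :
  (forall i, measurable (A i)) -> (forall i, mu (A i) < +oo)%E ->
  lrep (\sum_i c i *: ind mu p1 (A i)) = (fun x => \sum_i c i * \1_(A i) x) %[ae mu].
Proof.
move=> mA Afin; elim: (index_enum 'I_n) => [|i s IH].
  rewrite big_nil; have := lrep0 mu p1.
  by apply: filterS => x /= /[apply] ->; rewrite big_nil.
have H : lrep (c i *: ind mu p1 (A i)) = (fun x => c i * \1_(A i) x) %[ae mu].
  have := lrepZ (c i) (ind mu p1 (A i)); have := @lrep_ind _ _ _ mu _ p1 _ (mA i) (Afin i).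
  by apply: filterS2 => x + + _ => /= Ax -> //; rewrite Ax.
rewrite big_cons.
have := lrepD (c i *: ind mu p1 (A i)) (\sum_(i <- s) c i *: ind mu p1 (A i)).
by move: H IH; apply: filterS3 => x + + + _ => /= cx sx -> //; rewrite big_cons cx// sx.
Qed.

Lemma disjoint_sum_ind n (c : 'I_n -> R) (A : 'I_n -> set T) x :
  (forall i j, i != j -> A i `&` A j = set0) ->
  `|\sum_i c i * \1_(A i) x| `^ p = \sum_i `|c i| `^ p * \1_(A i) x.
Proof.
move=> Adisj; have [[i Aix]|noA] := pselect (exists i, A i x).
  have Ajx j : j != i -> \1_(A j) x = 0 :> R.
    move=> ji; rewrite indicE memNset// => Ajx.
    by have := Adisj _ _ ji; rewrite -subset0 => /(_ x); apply.
  rewrite (bigD1 i)//= big1 ?addr0; last by move=> j /Ajx ->; rewrite mulr0.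
  rewrite [RHS](bigD1 i)//= big1 ?addr0; last by move=> j /Ajx ->; rewrite mulr0.
  by rewrite indicE mem_set// !mulr1.
have Ajx j : \1_(A j) x = 0 :> R.
  by rewrite indicE memNset// => Ajx; apply: noA; exists j.
rewrite !big1 ?normr0 ?powR0//; first by rewrite gt_eqF.
  by move=> j _; rewrite Ajx mulr0.
by move=> j _; rewrite Ajx mulr0.
Qed.

Lemma normp_restr_simple n (c : 'I_n -> R) (A : 'I_n -> set T) B :
  (forall i, measurable (A i)) -> (forall i, mu (A i) < +oo)%E ->
  (forall i j, i != j -> A i `&` A j = set0) -> measurable B ->
  `|restr B (\sum_i c i *: ind mu p1 (A i))| `^ p =
  \sum_i `|c i| `^ p * fine (mu (A i `&` B)).
Proof.
move=> mA Afin Adisj mB; apply: EFin_inj; rewrite norm_restr//.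
transitivity (\int[mu]_(x in B) (\sum_i (`|c i| `^ p * \1_(A i) x)%:E))%E.
  apply: ae_eq_integral => //.
  - apply: measurable_abs_powR; apply: measurable_funTS; exact: measurable_lrep.
  - apply: emeasurable_sum => i; apply/measurable_EFinP.
    by apply: measurable_funTS; exact: measurable_funM.
  - have := lrep_sum_ind c mA Afin; apply: filterS => x /= -> // _.
    by rewrite disjoint_sum_ind// sumEFin.
rewrite ge0_integral_sum//; last first.
  move=> i; apply/measurable_EFinP.
  by apply: measurable_funTS; exact: measurable_funM.
rewrite -sumEFin; apply: eq_bigr => i _.
under eq_integral do rewrite EFinM.
rewrite ge0_integralZl_EFin ?powR_ge0//; last first.
  by apply/measurable_EFinP; exact: measurable_funTS.
rewrite integral_indic// EFinM fineK// ge0_fin_numE//.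
by apply: measure_sub_lty (mA i) _ (Afin i) => //; exact: measurableI.
Qed.

Import HBNNSimple.

(** Approximate the positive and the negative part from below and conclude by dominated
    convergence. The level sets at nonzero values are disjoint and have finite measure
    by Chebyshev's inequality. *)
Lemma simple_dense F (e : R) : 0 < e -> exists n (c : 'I_n -> R) (A : 'I_n -> set T),
  [/\ forall i, measurable (A i), forall i, (mu (A i) < +oo)%E,
      forall i j, i != j -> A i `&` A j = set0 &
      `|F - \sum_i c i *: ind mu p1 (A i)| <= e].
Proof.
move=> e0; pose f := lrep F; have mf : measurable_fun setT f by exact: measurable_lrep.
have mpos : measurable_fun setT (EFin \o f^\+) by apply/measurable_EFinP; exact: measurable_funrpos.
have mneg : measurable_fun setT (EFin \o f^\-) by apply/measurable_EFinP; exact: measurable_funrneg.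
pose u k : T -> R := nnsfun_approx measurableT mpos k.
pose v k : T -> R := nnsfun_approx measurableT mneg k.
have u0 k x : 0 <= u k x by exact: fun_ge0.
have v0 k x : 0 <= v k x by exact: fun_ge0.
have mu_ k : measurable_fun setT (u k) by exact: measurable_funPT.
have mv_ k : measurable_fun setT (v k) by exact: measurable_funPT.
have fu k : finite_set (range (u k)) by exact: fimfunP.
have fv k : finite_set (range (v k)) by exact: fimfunP.
pose g k : T -> R := u k \- v k.
have uf k x : u k x <= f^\+ x.
  rewrite -lee_fin /u nnsfun_approxE.
  by apply: (@le_approx _ _ _ _ (EFin \o f^\+)) => // y _; rewrite lee_fin.
have vf k x : v k x <= f^\- x.
  rewrite -lee_fin /v nnsfun_approxE.
  by apply: (@le_approx _ _ _ _ (EFin \o f^\-)) => // y _; rewrite lee_fin.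
have fE x : f x = f^\+ x - f^\- x by rewrite -[in LHS](funrposBneg f).
have afE x : `|f x| = f^\+ x + f^\- x.
  by have := congr1 (fun h => h x) (funrposDneg f).
have gf k x : `|f x - g k x| <= `|f x|.
  rewrite afE ler_norml /g /= fE.
  by move: (u0 k x) (v0 k x) (uf k x) (vf k x) => *; apply/andP; split; lra.
have g2f k x : `|g k x| <= `|f x|.
  rewrite afE ler_norml /g /=.
  by move: (u0 k x) (v0 k x) (uf k x) (vf k x) => *; apply/andP; split; lra.
have mg k : measurable_fun setT (g k) by exact: measurable_funB.
have gcvg x : g ^~ x @ \oo --> f x.
  rewrite fE; apply: cvgB.
    rewrite (_ : u ^~ x = approx setT (EFin \o f^\+) ^~ x); last first.
      by apply/funext => k; rewrite /u nnsfun_approxE.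
    by apply: (@cvg_approx _ _ _ _ (EFin \o f^\+)) => // [y _|]; rewrite ?lee_fin ?ltry.
  rewrite (_ : v ^~ x = approx setT (EFin \o f^\-) ^~ x); last first.
    by apply/funext => k; rewrite /v nnsfun_approxE.
  by apply: (@cvg_approx _ _ _ _ (EFin \o f^\-)) => // [y _|]; rewrite ?lee_fin ?ltry.
have [k gk] : exists k, (integral_powR mu p (f \- g k)%R <= (e `^ p)%:E)%E.
  pose h k x : \bar R := (`|f x - g k x| `^ p)%:E.
  pose h0 x : \bar R := (`|f x| `^ p)%:E.
  have mh k : measurable_fun setT (h k).
    by apply: measurable_abs_powR; exact: measurable_funB.
  have [||||] := @dominated_convergence _ _ _ mu setT measurableT
    h (cst 0%E) h0 mh.
  - exact: measurable_cst.
  - apply: aeW => x _ /=; apply/fine_cvgP; split; first exact: nearW.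
    rewrite /comp /=; apply/cvgrPdist_le => r r0.
    have /cvgrPdist_le /(_ (r `^ p^-1)) := gcvg x.
    rewrite powR_gt0// => /(_ isT); apply: filterS => k fg.
    rewrite sub0r normrN ger0_norm ?powR_ge0//.
    have -> : r = (r `^ p^-1) `^ p by rewrite -powRrM mulVf ?gt_eqF// powRr1// ltW.
    by apply: ge0_ler_powR; rewrite ?nnegrE ?powR_ge0// ltW.
  - apply/integrableP; split; first exact: measurable_abs_powR.
    have := integral_powR_lty F; rewrite /integral_powR; congr (_ < _)%E; apply: eq_integral => x _.
    by rewrite gee0_abs// lee_fin powR_ge0.
  - apply: aeW => x k _ /=; rewrite lee_fin ger0_norm ?powR_ge0//.
    by apply: ge0_ler_powR; rewrite ?nnegrE // ltW.
  rewrite integral0 => _ _ /fine_cvgP[fin /cvgrPdist_le /(_ (e `^ p))].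
  rewrite powR_gt0// => /(_ isT) => H; have := filterI fin H.
  move=> [k _ /(_ _ (leqnn k)) /= [kfin kle]]; exists k.
  rewrite /integral_powR -(fineK kfin) lee_fin; move: kle; rewrite sub0r normrN.
  exact: le_trans (ler_norm _).
have fg : finite_set (range (g k)).
  apply: sub_finite_set (finite_image2 (fun a b => a - b) (fu k) (fv k)).
  by move=> _ [x _ <-]; exists (u k x); [exists x|exists (v k x); [exists x|]].
have [s gs] := (finite_seqP _).1 fg.
pose s' := [seq y <- undup s | y != 0].
have us' : uniq s' by rewrite filter_uniq// undup_uniq.
pose c i := tnth (in_tuple s') i; pose A i := g k @^-1` [set c i].
have c0 i : c i != 0 by have := mem_tnth i (in_tuple s'); rewrite mem_filter => /andP[].
have mA i : measurable (A i) by rewrite -[A i]setTI; exact: mg.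
have cinj : injective c by exact/(tuple_uniqP (in_tuple s')).
have Afin i : (mu (A i) < +oo)%E.
  have c0p : 0 < `|c i| `^ p by rewrite powR_gt0// normr_gt0.
  have : ((`|c i| `^ p)%:E * mu (A i) < +oo)%E.
    rewrite -integral_cst//; apply: le_lt_trans (integral_powR_lty F).
    apply: (@le_trans _ _ (\int[mu]_(x in A i) (`|f x| `^ p)%:E)%E).
      apply: ge0_le_integral => //.
      - by move=> x _; rewrite lee_fin powR_ge0.
      - by apply: measurable_abs_powR; exact: measurable_funTS.
      move=> x Ax; rewrite /cst lee_fin -(Ax : g k x = c i).
      by apply: ge0_ler_powR; rewrite ?nnegrE // ltW.
    by apply: ge0_subset_integral => //; exact: measurable_abs_powR.
  by apply: contraTT; rewrite -!leNgt !leye_eq => /eqP ->; rewrite gt0_muley ?lte_fin.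
have Adisj i j : i != j -> A i `&` A j = set0.
  by move=> ij; apply/seteqP; split=> // x [Ai Aj]; move: ij; rewrite (cinj i j) ?eqxx// -Ai -Aj.
exists (size s'), c, A; split=> //.
apply: normp_le; first exact: ltW.
have gE x : \sum_i c i * \1_(A i) x = g k x.
  have [g0|g0] := eqVneq (g k x) 0.
    rewrite big1 ?g0// => i _; rewrite indicE memNset ?mulr0// => /= Ai.
    by have := c0 i; rewrite -Ai g0 eqxx.
  have : g k x \in s'.
    rewrite mem_filter g0 mem_undup; have : range (g k) (g k x) by exists x.
    by rewrite gs.
  move=> /(tnthP (in_tuple s'))[i gi]; rewrite (bigD1 i)//= big1 ?addr0.
    by rewrite indicE mem_set// mulr1 gi.
  move=> j ji; rewrite indicE memNset ?mulr0// => /= Aj.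
  by move: ji; rewrite (cinj j i) ?eqxx// /c -gi Aj.
rewrite -lee_fin norm_integral_powR; apply: le_trans gk; rewrite le_eqVlt; apply/orP; left; apply/eqP.
apply: ae_integral_powR; [exact: measurable_lrep|exact: measurable_funB|].
have := lrepB F (\sum_i c i *: ind mu p1 (A i)); have := lrep_sum_ind c mA Afin.
by apply: filterS2 => x + + _ => /= cx -> //; rewrite cx// gE.
Qed.

End Lp_simple.

(** * Halving a set against a small sigma-algebra *)

(** The hypotheses are parameters of the function so that they can be recovered from
    it when its charge structure is inferred. *)
Definition trace_charge d (T : measurableType d) (R : realType)
    (mu : {measure set T -> \bar R}) (G : set (set T)) (A : set T)
    (_ : G `<=` measurable) (_ : measurable A) (_ : (mu A < +oo)%E)
    (B : set (g_sigma_algebraType G)) : \bar R := mu (B `&` A).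

Section trace_charge.
Context d (T : measurableType d) (R : realType) (mu : {measure set T -> \bar R}).
Context (G : set (set T)) (Gm : G `<=` measurable).
Context (A : set T) (mA : measurable A) (Afin : (mu A < +oo)%E).

Lemma sub_g_sigma_measurable : <<s G >> `<=` (measurable : set (set T)).
Proof.
apply: smallest_sub => //; split; first exact: measurable0.
  by move=> B mB; rewrite setTD; exact: measurableC.
by move=> F mF; exact: bigcup_measurable.
Qed.

Local Notation trace := (trace_charge Gm mA Afin).

Let trace0 : trace set0 = 0%E.
Proof. by rewrite /trace set0I measure0. Qed.

Let trace_fin B : measurable B -> trace B \is a fin_num.
Proof.
move=> /sub_g_sigma_measurable mB; rewrite ge0_fin_numE//.
by apply: measure_sub_lty Afin => //; exact: measurableI.
Qed.

Let trace_additive : semi_sigma_additive trace.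
Proof.
move=> F mF tF mU; apply: (@measure_semi_sigma_additive _ _ _ (mrestr mu mA)) => //.
  by move=> i; exact: (sub_g_sigma_measurable (mF i)).
exact: (sub_g_sigma_measurable mU).
Qed.

HB.instance Definition _ := isCharge.Build _ _ _ trace
  trace0 trace_fin trace_additive.

End trace_charge.

(** A Hahn decomposition, relative to the sigma-algebra generated by G alone, of the
    charge [F |-> mu (F n A) - mu (F n B)]. *)
Lemma trace_hahn d (T : measurableType d) (R : realType)
    (mu : {measure set T -> \bar R}) (G : set (set T)) (A B : set T) :
  G `<=` measurable -> measurable A -> measurable B ->
  (mu A < +oo)%E -> (mu B < +oo)%E ->
  exists P, [/\ <<s G >> P,
    forall F, <<s G >> F -> F `<=` P -> (mu (F `&` B) <= mu (F `&` A))%E &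
    forall F, <<s G >> F -> F `<=` ~` P -> (mu (F `&` A) <= mu (F `&` B))%E].
Proof.
move=> Gm mA mB Afin Bfin.
pose nA : {charge set (g_sigma_algebraType G) -> \bar R} :=
  trace_charge Gm mA Afin.
pose nB : {charge set (g_sigma_algebraType G) -> \bar R} :=
  trace_charge Gm mB Bfin.
pose nu : {charge set (g_sigma_algebraType G) -> \bar R} := cadd nA (cscale (-1) nB).
have nuE F : nu F = (mu (F `&` A) - mu (F `&` B))%E.
  by rewrite /nu /= /cadd /= /cscale EFinN mulNe mul1e.
have Ffin F C : <<s G >> F -> measurable C -> (mu C < +oo)%E -> mu (F `&` C) \is a fin_num.
  move=> /(sub_g_sigma_measurable Gm) mF mC Cfin; rewrite ge0_fin_numE//.
  by apply: measure_sub_lty Cfin => //; exact: measurableI.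
have [P [N [[mP Pp] [mN Np] PN _]]] := Hahn_decomposition nu.
exists P; split=> // F mF FP.
  by have := Pp _ mF FP; rewrite nuE sube_ge0// Ffin.
have : F `<=` N.
  move=> x Fx; have : (P `|` N) x by rewrite PN.
  by case=> // Px; case: (FP _ Fx).
by move=> /(Np _ mF); rewrite nuE sube_le0.
Qed.

Section halving.
Context d (T : measurableType d) (R : realType) (mu : {measure set T -> \bar R}).
Context (p : R) (p1 : (1 <= p%:E)%E).
Local Notation E := (LspaceType mu p1).
Local Notation ind := (ind mu p1).
Context (G : set (set T)) (Gm : G `<=` measurable) (GI : setI_closed G) (GT : G setT).

(** G cut down to B, as elements of L_p. *)
Definition traces (B : set T) : set E := [set ind (X `&` B) | X in G].

(** Up to approximation by linear combinations, G sees every measurable subset of B. *)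
Definition approximable (B : set T) := forall A, measurable A -> A `<=` B ->
  closure (linear_span (traces B)) (ind A).

(** Dynkin's lemma: G is stable under intersection, and the sets F with the required
    property form a lambda-system. *)
Lemma trace_approx (B F : set T) : measurable B -> (mu B < +oo)%E ->
  <<s G >> F -> closure (linear_span (traces B)) (ind (F `&` B)).
Proof.
move=> mB Bfin GF.
pose H := [set F | measurable F /\ closure (linear_span (traces B)) (ind (F `&` B))].
suff : <<s G >> `<=` H by move=> /(_ _ GF)[].
have mI C : measurable C -> measurable (C `&` B) by move=> mC; exact: measurableI.
have If C : measurable C -> (mu (C `&` B) < +oo)%E.
  by move=> mC; apply: measure_sub_lty Bfin => //; exact: mI.
have trG C : G C -> closure (linear_span (traces B)) (ind (C `&` B)).
  by move=> GC; apply/subset_closure/linear_span_incl; exists C.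
apply: lambda_system_subset => //; last by move=> C GC; split; [exact: Gm|exact: trG].
split=> //.
- by split; [exact: measurableT|exact: trG].
- move=> C D DC [mC cC] [mD cD]; split; first exact: measurableD.
  rewrite (_ : _ `&` _ = (C `&` B) `\` (D `&` B)).
    rewrite indD//; [exact: closure_spanB|exact: mI|exact: mI|exact: If|].
    by move=> x [/DC].
  apply/seteqP; split=> [x [[Cx nDx] Bx]|x [[Cx Bx] nDB]].
    by split=> // -[].
  by split=> //; split=> // Dx; apply: nDB.
- move=> C ndC HC; have mU : measurable (\bigcup_n C n).
    by apply: bigcup_measurable => k _; case: (HC k).
  split=> //; rewrite (_ : closure _ = closure (closure (linear_span (traces B)))).
    apply/closure_normP => e e0; rewrite setI_bigcupl.
    have [||||n ne] := @norm_ind_bigcup _ _ _ mu _ p1 (fun n => C n `&` B) e.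
    + by move=> n; apply: mI; case: (HC n).
    + move=> m n mn; apply/subsetPset => x [Cx Bx]; split=> //.
      by have /subsetPset := ndC _ _ mn; apply.
    + by rewrite -setI_bigcupl; exact: If.
    + exact: e0.
    by exists (ind (C n `&` B)) => //; case: (HC n).
  by apply/closure_id; exact: closed_closure.
Qed.

(** Pick a subset A of B whose indicator is not approximable and let P be the part
    where, for the sigma-algebra of G, A outweighs [B \ A]. If both [A \ P] and [(B \ A)
    n P] were null, A would be almost everywhere the trace of P on B, hence
    approximable. Whichever of the two is not null is outweighed, on every F of the
    sigma-algebra, by a disjoint part of B. *)
Lemma halving (B : set T) : measurable B -> (mu B < +oo)%E -> ~ approximable B ->
  exists B', [/\ measurable B', B' `<=` B, (0 < mu B')%E &
    forall F, <<s G >> F -> (mu (F `&` B') + mu (F `&` B') <= mu (F `&` B))%E].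
Proof.
move=> mB Bfin /existsNP[A /not_implyP[mA /not_implyP[AB nA]]].
have mBA := measurableD mB mA.
have Afin := measure_sub_lty mA mB AB Bfin.
have BAfin : (mu (B `\` A) < +oo)%E by apply: measure_sub_lty Bfin => // x [].
have [P [GP Pp Pn]] := trace_hahn Gm mA mBA Afin BAfin.
have sm := sub_g_sigma_measurable Gm; have mP := sm _ GP.
have sI F : <<s G >> F -> <<s G >> (F `&` P).
  by move=> GF; apply: (@measurableI _ (g_sigma_algebraType G)).
have sD F : <<s G >> F -> <<s G >> (F `\` P).
  by move=> GF; apply: (@measurableD _ (g_sigma_algebraType G)).
have half X Y Z : measurable X -> measurable Y -> measurable Z -> X `&` Y = set0 ->
    X `|` Y `<=` Z -> (mu X <= mu Y)%E -> (mu X + mu X <= mu Z)%E.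
  move=> mX mY mZ XY XYZ le; apply: le_trans (leeD (lexx _) le) _.
  rewrite -measureU//; apply: le_measure => //; apply: mem_set => //.
  exact: measurableU.
have [B1|B1] := ltP 0%E (mu (A `\` P)).
  exists (A `\` P); split=> //; [exact: measurableD|by move=> x [/AB]|].
  move=> F GF; have mF := sm _ GF.
  have -> : F `&` (A `\` P) = (F `\` P) `&` A.
    by apply/seteqP; split=> x; rewrite /setI/setD/=; tauto.
  apply: (half _ ((F `\` P) `&` (B `\` A))).
  - by apply: measurableI => //; exact: measurableD.
  - by apply: measurableI => //; exact: measurableD.
  - exact: measurableI.
  - by apply/seteqP; split=> x //; rewrite /setI/setD/=; tauto.
  - by move=> x [] [] [? ?] => [/AB ?|[? _]]; split.
  - by apply: Pn; [exact: sD|move=> x []].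
have [B2|B2] := ltP 0%E (mu ((B `\` A) `&` P)).
  exists ((B `\` A) `&` P); split=> //; [exact: measurableI|by move=> x [[]]|].
  move=> F GF; have mF := sm _ GF.
  have -> : F `&` ((B `\` A) `&` P) = (F `&` P) `&` (B `\` A).
    by apply/seteqP; split=> x; rewrite /setI/setD/=; tauto.
  apply: (half _ ((F `&` P) `&` A)).
  - by apply: measurableI => //; exact: measurableI.
  - by apply: measurableI => //; exact: measurableI.
  - exact: measurableI.
  - by apply/seteqP; split=> x //; rewrite /setI/setD/=; tauto.
  - by move=> x [] [] [? ?] => [[? _]|/AB ?]; split.
  - by apply: Pp; [exact: sI|move=> x []].
case: nA; have -> : ind A = ind (P `&` B); last exact: trace_approx.
have mPB := measurableI _ _ mP mB.
apply: ae_ind => //; apply/eqP; rewrite eq_le measure_ge0 andbT.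
  rewrite (_ : _ `\` _ = A `\` P)//; apply/seteqP.
  by split=> x; have := AB x; rewrite /setI/setD/=; tauto.
rewrite (_ : _ `\` _ = (B `\` A) `&` P)//; apply/seteqP.
by split=> x; rewrite /setI/setD/=; tauto.
Qed.

End halving.

(** * Exhausting the measure space *)

Section exhaustion.
Context d (T : measurableType d) (R : realType) (mu : {measure set T -> \bar R}).
Context (p : R) (p1 : (1 <= p%:E)%E).
Local Notation E := (LspaceType mu p1).
Local Notation ind := (ind mu p1).
Context (S : set E).
Local Notation V := (closure (linear_span S)).

(** On C, the span of S already exhausts L_p. *)
Definition filled (C : set T) := [/\ measurable C, (mu C < +oo)%E &
  forall X, measurable X -> X `<=` C -> V (ind X)].

Lemma filledU C D : filled C -> filled D -> filled (C `|` D).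
Proof.
move=> [mC Cfin CV] [mD Dfin DV]; split; first exact: measurableU.
  by apply: le_lt_trans (measureU2 mu mC mD) _; exact: lte_add_pinfty.
move=> X mX XCD; have mXC := measurableI _ _ mX mC; have mXD := measurableD mX mC.
have XDD : X `\` C `<=` D by move=> x [/XCD[]].
rewrite -(setUIDK X C) indU//.
- by apply: closure_spanD; [apply: CV => // x []|exact: DV].
- by apply: measure_sub_lty Cfin => // x [].
- exact: (measure_sub_lty mXD mD).
- by apply/seteqP; split=> // x [[_ ?] []].
Qed.

Lemma filled_bigcup (C : (set T)^nat) : (forall n, filled (C n)) ->
  (mu (\bigcup_n C n) < +oo)%E -> filled (\bigcup_n C n).
Proof.
move=> fC Ufin; have mC n : measurable (C n) by case: (fC n).
pose D n := \big[setU/set0]_(i < n.+1) C i.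
have fD n : filled (D n).
  rewrite /D; elim: n => [|n IH]; first by rewrite big_ord1.
  by rewrite big_ord_recr; exact: filledU.
have UD : \bigcup_n C n = \bigcup_n D n.
  apply/seteqP; split=> x [n _].
    by move=> Cx; exists n => //; rewrite /D big_ord_recr; right.
  by rewrite /D -bigcup_mkord => -[k /= _ Cx]; exists k.
split=> //; first exact: bigcup_measurable.
move=> X mX XU; rewrite (_ : V = closure V); last first.
  by apply/closure_id; exact: closed_closure.
have mD n : measurable (D n) by case: (fD n).
have XE : X = \bigcup_n (X `&` D n) by rewrite -setI_bigcupr -UD setIidl.
apply/closure_normP => e e0.
have [||||n ne] := @norm_ind_bigcup _ _ _ mu _ p1 (fun n => X `&` D n) e.
- by move=> n; exact: measurableI.
- move=> m n mn; apply/subsetPset => x [Xx]; rewrite /D -!bigcup_mkord.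
  by move=> [k /= km Cx]; split=> //; exists k => //=; exact: leq_trans km _.
- rewrite -XE; apply: (measure_sub_lty mX _ XU Ufin); exact: bigcup_measurable.
- exact: e0.
rewrite -XE in ne; exists (ind (X `&` D n)) => //.
by have [_ _] := fD n; apply; [exact: measurableI|move=> x []].
Qed.

Hypothesis fill : forall A, measurable A -> (0 < mu A)%E -> (mu A < +oo)%E ->
  exists C, [/\ C `<=` A, (0 < mu C)%E & filled C].

(** The usual exhaustion argument: a union of filled subsets of A of almost maximal
    measure is filled, and what is left of A is null, since otherwise it would contain
    another filled set of positive measure. *)
Lemma filled_fin A : measurable A -> (mu A < +oo)%E -> filled A.
Proof.
move=> mA Afin.
pose M := [set fine (mu C) | C in [set C | C `<=` A /\ filled C]].
have f0 : filled set0.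
  split=> [//||X _]; first by rewrite measure0.
  by rewrite subset0 => ->; rewrite ind_null//; exact: closure_span0.
have finA C : measurable C -> C `<=` A -> mu C \is a fin_num.
  by move=> mC CA; rewrite ge0_fin_numE//; exact: (measure_sub_lty mC mA).
have lefin C D : measurable C -> measurable D -> C `<=` D -> D `<=` A ->
    fine (mu C) <= fine (mu D).
  move=> mC mD CD DA; apply: fine_le; [exact: finA (subset_trans CD DA)|exact: finA|].
  by apply: le_measure => //; exact: mem_set.
have supM : has_sup M.
  split; first by exists 0; exists set0; [split|rewrite measure0].
  by exists (fine (mu A)) => _ [C [CA [mC _ _]] <-]; exact: lefin.
have : forall n : nat, exists C, [/\ C `<=` A, filled C & sup M - n.+1%:R^-1 < fine (mu C)].
  move=> n; have [|_ [C [CA fC] <-] ltC] := @sup_adherent _ M n.+1%:R^-1 _ supM.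
    by rewrite invr_gt0.
  by exists C.
move=> /choice[C CP]; set U := \bigcup_n C n.
have mC n : measurable (C n) by case: (CP n) => _ [].
have UA : U `<=` A by move=> x [n _]; case: (CP n) => + _ _; apply.
have mU : measurable U by exact: bigcup_measurable.
have fU : filled U.
  apply: filled_bigcup; first by move=> n; case: (CP n).
  exact: (measure_sub_lty mU mA).
(* U has the largest measure among the filled subsets of A. *)
have supU : sup M <= fine (mu U).
  rewrite leNgt; apply/negP => lt.
  have := lt; rewrite -subr_gt0 => /ltr_add_invr[n]; rewrite add0r => nlt.
  have [_ _ CU] := CP n.
  have := lefin _ _ (mC n) mU (fun x Cx => ex_intro2 _ _ n I Cx) UA.
  move=> /(lt_le_trans CU); rewrite ltrBlDr; move: nlt; rewrite ltrBrDl => nlt.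
  by move=> /(lt_trans nlt); rewrite ltxx.
have mAU := measurableD mA mU.
have AU0 : mu (A `\` U) = 0%E.
  apply/eqP; rewrite eq_le measure_ge0 andbT leNgt; apply/negP => AUpos.
  have [|D [DAU Dpos fD]] := fill mAU AUpos.
    by apply: measure_sub_lty Afin => // x [].
  have fUD := filledU fU fD; have [mD _ _] := fD; have [mUD _ _] := fUD.
  have UDA : U `|` D `<=` A by move=> x [/UA//|/DAU[]].
  have : M (fine (mu (U `|` D))) by exists (U `|` D).
  move=> /(sup_upper_bound supM); rewrite measureU//; last first.
    by apply/seteqP; split=> // x [Ux /DAU[]].
  have Dfin : mu D \is a fin_num by apply: finA => // x /DAU[].
  rewrite fineD//; last exact: finA.
  have : 0 < fine (mu D) by rewrite fine_gt0// Dpos -ge0_fin_numE.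
  by move: supU; lra.
split=> // X mX XA; have mXU := measurableI _ _ mX mU.
have -> : ind X = ind (X `&` U).
  apply: ae_ind => //; first exact: (measure_sub_lty mX mA).
    apply: subset_measure0 mAU _ AU0 => //; first exact: measurableD.
    by move=> x [Xx nXU]; split; [exact: XA|move=> Ux; exact: nXU].
  rewrite (_ : _ `\` _ = set0) ?measure0//.
  by apply/seteqP; split=> x // [[]].
by have [_ _] := fU; apply => // x [].
Qed.

Lemma filled_densely_spans : densely_spans S.
Proof.
apply/seteqP; split=> // F _; rewrite (_ : V = closure V); last first.
  by apply/closure_id; exact: closed_closure.
apply/closure_normP => e e0; have [n [c [A [mA Afin _ Fe]]]] := simple_dense F e0.
exists (\sum_i c i *: ind (A i)) => //.
elim/big_ind: _ => [|f g|i _]; [exact: closure_span0|exact: closure_spanD|].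
by apply: closure_spanZ; have [_ _] := filled_fin (mA i) (Afin i); apply.
Qed.

End exhaustion.

(** * A set that avoids a small subspace *)

Section avoidance.
Context d (T : measurableType d) (R : realType) (mu : {measure set T -> \bar R}).
Context (p : R) (p1 : (1 <= p%:E)%E).
Local Notation E := (LspaceType mu p1).
Local Notation ind := (ind mu p1).
Implicit Types (F : E) (A B : set T).

Let p_ge1 : 1 <= p. Proof. by rewrite -lee_fin. Qed.
Let p_gt0 : 0 < p. Proof. exact: lt_le_trans p_ge1. Qed.

Definition ae_disjoint (BB : set (set T)) := forall A B, BB A -> BB B -> A <> B ->
  mu (A `&` B) = 0%E.

(** The p-th power of the norm is additive over an almost disjoint family, so F can have
    norm more than e on at most [|F|^p / e^p] of its members. *)
Lemma finite_heavy (BB : set (set T)) F (e : R) : BB `<=` measurable ->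
  ae_disjoint BB -> 0 < e -> finite_set [set B | BB B /\ e < `|restr B F|].
Proof.
move=> BBm BBd e0; apply: contrapT => inf.
have sumU (s : seq (set T)) : uniq s -> (forall B, B \in s -> BB B) ->
    [/\ measurable (\big[setU/set0]_(B <- s) B),
     forall A, BB A -> A \notin s -> mu (A `&` \big[setU/set0]_(B <- s) B) = 0%E &
     \sum_(B <- s) `|restr B F| `^ p <= `|restr (\big[setU/set0]_(B <- s) B) F| `^ p].
  elim: s => [_ _|B s IH /= /andP[Bs us] sBB].
    rewrite !big_nil; split=> //.
    by move=> A _ _; rewrite setI0 measure0.
  have [|mU UN sU] := IH us; first by move=> A As; apply: sBB; rewrite inE As orbT.
  have BBB : BB B by apply: sBB; exact: mem_head.
  have mB := BBm _ BBB.
  rewrite !big_cons; split; first exact: measurableU.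
    move=> A BBA; rewrite inE negb_or => /andP[/eqP AB As].
    have mA := BBm _ BBA; rewrite setIUr null_set_setU//.
    + exact: measurableI.
    + exact: measurableI.
    + exact: BBd.
    + exact: UN.
  by rewrite normp_restrU// ?lerD2l//; exact: UN.
have ep0 : 0 < e `^ p by rewrite powR_gt0.
pose N := (Num.truncn (`|F| `^ p / e `^ p)).+1.
have [X Xsub XN] := infinite_set_fset N inf.
have [|mU _ sU] := sumU _ (fset_uniq X).
  by move=> B BX; have [] := Xsub _ BX.
have : N%:R * e `^ p <= `|F| `^ p.
  apply: (@le_trans _ _ (\sum_(B <- enum_fset X) `|restr B F| `^ p)).
    apply: (@le_trans _ _ (\sum_(B <- enum_fset X) e `^ p)).
      rewrite big_const_seq count_predT iter_addr_0 -[leRHS]mulr_natl.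
      by rewrite ler_pM2r// ler_nat; exact: XN.
    rewrite big_seq [leRHS]big_seq; apply: ler_sum => B BX.
    have [_ eB] := Xsub _ BX.
    by apply: ge0_ler_powR; rewrite ?nnegrE //; exact: ltW.
  apply: le_trans sU _; rewrite -[leRHS]normp_restrT; exact: normp_restr_le.
rewrite -ler_pdivlMr// leNgt => /negP; apply.
by rewrite truncnS_gt.
Qed.

(** Tiny many simple functions can be made small on one set B, as long as no tiny set
    spans a dense subspace. Let G consist of the finite intersections of their level
    sets. Either every non-null subset of some B0 can be halved against G, and enough
    halvings make all the functions small; or the approximable sets exhaust the space, a
    maximal almost disjoint family of them is not tiny, and each function is large on
    only finitely many members of it. *)
Lemma avoid_simple_functions (U I : Type) (L : set U) (D : set I) (M e : R) (n : I -> nat)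
    (c : forall i, 'I_(n i) -> R) (A : forall i, 'I_(n i) -> set T) :
  (forall S : set E, tiny L S -> ~ densely_spans S) -> tiny L D ->
  (forall i j, measurable (A i j)) -> (forall i j, mu (A i j) < +oo)%E ->
  (forall i j k, j != k -> A i j `&` A i k = set0) ->
  (forall i, D i -> `|\sum_j c i j *: ind (A i j)| <= M) -> 0 < e ->
  exists B, [/\ measurable B, (0 < mu B < +oo)%E &
    forall i, D i -> `|restr B (\sum_j c i j *: ind (A i j))| <= e].
Proof.
move=> Hdens tD mA Afin Adisj DM e0.
pose FF := \bigcup_(i in D) range (A i).
have tFF : tiny L FF.
  apply: tiny_bigcup => // i _; left; apply: finite_image; exact: finite_finset.
pose G := [set \bigcap_(X in B) X | B in [set B | B `<=` FF /\ finite_set B]].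
have tG : tiny L G by apply: tiny_image; exact: tiny_finite_subsets.
have Gm : G `<=` measurable.
  move=> _ [B [BFF Bfin] <-]; apply: fin_bigcap_measurable => // X /BFF[i _ [j _ <-]].
  exact: mA.
have GT : G setT by exists set0; [split|rewrite bigcap_set0].
have GI : setI_closed G.
  move=> _ _ [B [BFF Bfin] <-] [B' [BFF' Bfin'] <-]; exists (B `|` B').
    by split; [move=> X [/BFF|/BFF']|rewrite finite_setU].
  by rewrite bigcap_setU.
have AG i j : D i -> G (A i j).
  move=> Di; exists [set A i j]; last by rewrite bigcap_set1.
  by split; [move=> _ ->; exists i => //; exists j|exact: finite_set1].
have [[B0 [mB0 B0pos B0fin nB0]]|nB0] := pselect (exists B0, [/\ measurable B0,
    (0 < mu B0)%E, (mu B0 < +oo)%E & forall B, measurable B -> B `<=` B0 ->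
    (0 < mu B)%E -> ~ approximable mu p1 G B]).
  have subB0 B : measurable B -> B `<=` B0 -> (mu B < +oo)%E.
    by move=> mB BB; exact: (measure_sub_lty mB mB0).
  (* Every non-null subset of B0 can be halved. *)
  have iter k : exists B, [/\ measurable B, B `<=` B0, (0 < mu B)%E & forall F : set T,
      <<s G >> F -> 2 ^+ k * fine (mu (F `&` B)) <= fine (mu (F `&` B0))].
    elim: k => [|k [B [mB BB0 Bpos HB]]].
      by exists B0; split=> // F _; rewrite expr0 mul1r.
    have [||B' [mB' B'B B'pos HB']] := @halving _ _ _ mu _ p1 _ Gm GI GT B mB.
      exact: subB0.
      exact: nB0.
    exists B'; split=> //; first exact: subset_trans BB0.
    move=> F GF; have mF := sub_g_sigma_measurable Gm GF.
    have mFB := measurableI _ _ mF mB; have mFB' := measurableI _ _ mF mB'.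
    have fin C : measurable C -> C `<=` B0 -> mu (F `&` C) \is a fin_num.
      move=> mC CB; rewrite ge0_fin_numE//; apply: subB0; first exact: measurableI.
      by move=> x [_ /CB].
    apply: le_trans (HB _ GF); rewrite exprSr -mulrA ler_pM2l ?exprn_gt0//.
    have := HB' _ GF; have f1 := fin _ mB BB0; have f2 := fin _ mB' (subset_trans B'B BB0).
    by rewrite -(fineK f1) -(fineK f2) -EFinD lee_fin mulr_natl mulr2n.
  pose k := (Num.truncn (M `^ p / e `^ p)).+1.
  have [B [mB BB0 Bpos HB]] := iter k.
  exists B; split=> //; first by rewrite Bpos subB0.
  move=> i Di; apply: normp_le; first exact: ltW.
  have ep0 : 0 < e `^ p by rewrite powR_gt0.
  have k0 : 0 < 2 ^+ k :> R by rewrite exprn_gt0.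
  rewrite -(ler_pM2l k0); apply: (@le_trans _ _ (M `^ p)).
    apply: (@le_trans _ _ (`|\sum_j c i j *: ind (A i j)| `^ p)); last first.
      by apply: ge0_ler_powR; rewrite ?nnegrE ?(le_trans _ (DM _ Di))// ?ltW// DM.
    set g := \sum_j _; apply: (@le_trans _ _ (`|restr B0 g| `^ p)); last first.
      by rewrite -[leRHS]normp_restrT; exact: normp_restr_le.
    rewrite /g (normp_restr_simple p1 _ (mA i) (Afin i) (@Adisj i) mB).
    rewrite (normp_restr_simple p1 _ (mA i) (Afin i) (@Adisj i) mB0) mulr_sumr.
    apply: ler_sum => j _.
    rewrite mulrCA ler_wpM2l ?powR_ge0//; apply: HB.
    by apply: sub_sigma_algebra; exact: AG.
  rewrite -ler_pdivrMr//; apply: le_trans (ltW (truncnS_gt _)) _.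
  by rewrite -/k -natrX ler_nat; apply/ltnW/ltn_expl.
(* Every set of positive finite measure contains a good one. *)
pose good B := [/\ measurable B, (0 < mu B)%E, (mu B < +oo)%E &
  approximable mu p1 G B].
pose P (BB : set (set T)) := BB `<=` good /\ ae_disjoint BB.
have [FF' FP Ftot|BB [[BBgood BBd] BBmax]] := @Zorn_bigcup _ P.
  split=> [B [X FX XB]|B C [X FX XB] [Y FY YC] BC]; first by have [+ _] := FP _ FX; apply.
  have [_ Xd] := FP _ FX; have [_ Yd] := FP _ FY.
  by have [XY|YX] := Ftot _ _ FX FY; [apply: Yd => //; exact: XY|apply: Xd => //; exact: YX].
have BBm : BB `<=` measurable by move=> B /BBgood[].
(* By maximality every non-null set of finite measure meets a member of BB in
   a non-null good set, so the traces on the members of BB exhaust L_p. *)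
have ntBB : ~ tiny L BB.
  move=> tBB; pose S := \bigcup_(B in BB) @traces _ _ _ mu _ p1 G B.
  apply: (Hdens S); first by apply: tiny_bigcup => // B _; exact: tiny_image.
  apply: filled_densely_spans => C mC Cpos Cfin.
  have : ~ (forall B, measurable B -> B `<=` C -> (0 < mu B)%E ->
      ~ approximable mu p1 G B) by move=> H; apply: nB0; exists C.
  move=> /existsNP[B /not_implyP[mB /not_implyP[BC /not_implyP[Bpos /contrapT aB]]]].
  have Bfin : (mu B < +oo)%E by exact: (measure_sub_lty mB mC).
  have [B' BBB' BB'pos] : exists2 B', BB B' & (0 < mu (B `&` B'))%E.
    apply: contrapT => nB'.
    have B'0 B' : BB B' -> mu (B `&` B') = 0%E.
      move=> BBB'; apply/eqP; rewrite eq_le measure_ge0 andbT leNgt; apply/negP => ?.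
      by apply: nB'; exists B'.
    apply: (BBmax (BB `|` [set B])).
      split; first by move=> ?; left.
      move=> /(_ B (or_intror erefl)) /B'0; rewrite setIid => B0.
      by move: Bpos; rewrite B0 ltxx.
    split=> [X [/BBgood//|->]//|X Y [BX|->] [BY|->]]; first exact: BBd.
    + by rewrite setIC B'0.
    + by rewrite B'0.
    + by [].
  have [mB' _ B'fin aB'] := BBgood _ BBB'.
  have mBB' := measurableI _ _ mB mB'.
  exists (B `&` B'); split=> //; first by move=> x [/BC].
  split=> //; first by apply: measure_sub_lty Bfin => // x [].
  move=> X mX XBB'; have /(_ X mX) := aB'.
  move=> /(_ (subset_trans XBB' (@subIsetr _ _ _))).
  apply: closureS; apply: linear_spanS => F tF; by exists B'.
have [B BBB nB] : exists2 B, BB B &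
    ~ exists2 i, D i & e < `|restr B (\sum_j c i j *: ind (A i j))|.
  apply: contrapT => H; apply: ntBB.
  apply: (@sub_tiny _ _ _ _ (\bigcup_(i in D) [set B | BB B /\
      e < `|restr B (\sum_j c i j *: ind (A i j))|])).
    move=> B BBB; apply: contrapT => nB; apply: H; exists B => // -[i Di eB].
    by apply: nB; exists i.
  by apply: tiny_bigcup => // i _; left; exact: finite_heavy.
have [mB Bpos Bfin _] := BBgood _ BBB.
exists B; split=> //; first by rewrite Bpos.
by move=> i Di; rewrite leNgt; apply/negP => ?; apply: nB; exists i.
Qed.

End avoidance.

(** * Escaping directions *)

Section escaping_def.
Context (R : realType).

(** Over any subspace spanned by a small set, v behaves like the second summand of an
    m-sum, up to the factor [1 - e]. *)
Definition escaping (K : Type) (m : R) (X : normedModType R) :=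
  forall S : set X, ~ ([set: K] #<= S)%card -> forall e : R, 0 < e ->
  exists2 v : X, `|v| = 1 & forall x, linear_span S x -> forall t : R, 0 <= t ->
    (1 - e) * lr_norm2 m%:E `|x| t <= `|x + t *: v|.

Lemma lr_norm2_ge0 (r : \bar R) (a b : R) : (1 <= r)%E -> 0 <= a -> 0 <= lr_norm2 r a b.
Proof.
by case: r => [s _ _|_ a0|//] /=; [exact: powR_ge0|rewrite le_max a0].
Qed.

Lemma lr_norm2_gel (r : \bar R) (a b : R) : (1 <= r)%E -> 0 <= a -> 0 <= b ->
  a <= lr_norm2 r a b.
Proof.
move=> r1 a0 b0; have := @ler_lr_norm2 _ r r1 a 0 a b a0 (lexx 0) (lexx a) b0.
apply: le_trans; case: r r1 => [s s1|_|//] /=; last by rewrite le_max lexx.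
have s0 : 0 < s by rewrite lee_fin in s1; exact: lt_le_trans ltr01 s1.
by rewrite powR0 ?gt_eqF// addr0 -powRrM mulfV ?gt_eqF// powRr1.
Qed.

Lemma lr_norm2C (r : \bar R) (a b : R) : lr_norm2 r a b = lr_norm2 r b a.
Proof. by rewrite /lr_norm2; case: r => [s||]; rewrite 1?addrC 1?maxC. Qed.

Lemma lr_norm2_ger (r : \bar R) (a b : R) : (1 <= r)%E -> 0 <= a -> 0 <= b ->
  b <= lr_norm2 r a b.
Proof. by move=> r1 a0 b0; rewrite lr_norm2C lr_norm2_gel. Qed.

Lemma scale_loss (e eta L a X : R) : e * a <= e * L ->
  0 <= (eta - 2 * e) * L -> (1 - e) * L <= X + e * a -> (1 - eta) * L <= X.
Proof. by lra. Qed.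

End escaping_def.

Section Lp_escaping.
Context d (T : measurableType d) (R : realType) (mu : {measure set T -> \bar R}).
Context (p : R) (p1 : (1 <= p%:E)%E).
Local Notation E := (LspaceType mu p1).
Local Notation ind := (ind mu p1).
Implicit Types (F : E) (A B : set T).

Let p_ge1 : 1 <= p. Proof. by rewrite -lee_fin. Qed.
Let p_gt0 : 0 < p. Proof. exact: lt_le_trans ltr01 p_ge1. Qed.

Lemma restr_split A F : measurable A -> F = restr A F + restr (~` A) F.
Proof.
move=> mA; apply: eq_Lspace.
have := lrepD (restr A F) (restr (~` A) F); have := lrep_restr F mA.
have := lrep_restr F (measurableC mA); apply: filterS3 => x + + + _ => /=.
move=> CE AE -> //; rewrite CE// AE// -mulrDr !indicE in_setC.
by case: (x \in A); rewrite /= ?addr0 ?add0r mulr1.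
Qed.

Lemma restr_set0 F : restr set0 F = 0.
Proof.
apply/eqP; rewrite -normr_eq0; apply/eqP/(@powR_eq0_eq0 _ _ p).
by apply: EFin_inj; rewrite norm_restr// integral_set0.
Qed.

Lemma norm_restr_le A F : measurable A -> `|restr A F| <= `|F|.
Proof.
move=> mA; apply: normp_le => //; rewrite -[leRHS]normp_restrT.
exact: normp_restr_le.
Qed.

(** By homogeneity only the unit ball of the span matters. It has a tiny net whose
    members are close to simple functions, for which [avoid_simple_functions] gives B. *)
Lemma avoid_span (K : Type) (S : set E) (e : R) :
  infinite_set [set: K] -> has_dens E [set: K] -> ~ ([set: K] #<= S)%card -> 0 < e ->
  exists B, [/\ measurable B, (0 < mu B < +oo)%E &
    forall f, linear_span S f -> `|restr B f| <= e * `|f|].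
Proof.
move=> Kinf [_ Kdens] KS e0; have e30 : 0 < e / 3 by rewrite divr_gt0.
have Hdens (A : set E) : tiny S A -> ~ densely_spans A.
  by move=> tA /Kdens; exact: tiny_small tA.
have [C tC CP] := @tiny_net _ E _ S S 1 _ (small_tiny KS) e30.
have : forall a : E, exists q : {n : nat & (('I_n -> R) * ('I_n -> set T))%type},
    [/\ forall i, measurable ((projT2 q).2 i), forall i, (mu ((projT2 q).2 i) < +oo)%E,
      forall i j, i != j -> (projT2 q).2 i `&` (projT2 q).2 j = set0 &
      `|a - \sum_i (projT2 q).1 i *: ind ((projT2 q).2 i)| <= e / 3].
  move=> a; have [n [c [A [mA Afin Ad Ae]]]] := simple_dense a e30.
  by exists (existT _ n (c, A)).
move=> /choice[q qP].
pose D := [set a : E | C a /\ `|a| <= 1 + e / 3].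
have [||||||B [mB Bfin BP]] := @avoid_simple_functions _ _ _ mu _ p1 _ E S D (1 + e / 3 + e / 3) (e / 3)
    (fun a => projT1 (q a)) (fun a => (projT2 (q a)).1) (fun a => (projT2 (q a)).2) Hdens.
- by apply: sub_tiny tC => a [].
- by move=> a i; have [h _ _ _] := qP a; exact: h.
- by move=> a i; have [_ h _ _] := qP a; exact: h.
- by move=> a i j; have [_ _ h _] := qP a; exact: h.
- move=> a [_ a1]; have [_ _ _ qa] := qP a.
  rewrite -[X in `|X|](subKr a) (le_trans (ler_normB _ _))//.
  by apply: lerD.
- exact: e30.
have sm f : linear_span S f -> `|f| <= 1 -> `|restr B f| <= e.
  move=> Sf f1; have [a Ca fa] := CP f (subset_closure Sf) f1.
  have a1 : `|a| <= 1 + e / 3.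
    by rewrite -[a](subKr f) (le_trans (ler_normB _ _))// lerD.
  have [_ _ _ qa] := qP a; have := BP a (conj Ca a1); move: qa.
  set g := \sum_i _ => ag gB.
  have -> : f = (f - a) + (a - g) + g by rewrite addrA !subrK.
  rewrite (restrD _ g mB) (restrD (f - a) (a - g) mB) (le_trans (ler_normD _ _))//.
  have -> : e = e / 3 + e / 3 + e / 3 by field.
  apply: lerD => //; rewrite (le_trans (ler_normD _ _))//.
  by apply: lerD; apply: le_trans (norm_restr_le _ mB) _.
exists B; split=> // f Sf; have [->|f0] := eqVneq f 0.
  by have := restrZ (0 : R) (0 : E) mB; rewrite !scale0r => ->; rewrite normr0 mulr0.
have nf : 0 < `|f| by rewrite normr_gt0.
have := sm (`|f|^-1 *: f) (linear_spanZ _ Sf); rewrite normrZ normfV normr_id.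
rewrite mulVf ?gt_eqF// => /(_ (lexx _)).
by rewrite restrZ// normrZ normfV normr_id mulrC ler_pdivrMr.
Qed.

(** A function of norm 1 concentrated on a set that carries almost nothing of the
    members of the span is almost disjoint from all of them at once. *)
Lemma Lp_escaping (K : Type) : infinite_set [set: K] -> has_dens E [set: K] ->
  escaping K p E.
Proof.
move=> Kinf Kdens S KS eta eta0; pose e := Num.min (eta / 2) 1.
have e0 : 0 < e by rewrite lt_min ltr01 andbT divr_gt0.
have e1 : e <= 1 by rewrite ge_min lexx orbT.
have e2 : 2 * e <= eta.
  have : e <= eta / 2 by rewrite ge_min lexx.
  by lra.
have [B [mB /andP[Bpos Bfin] Be]] := avoid_span Kinf Kdens KS e0.
have mCB := measurableC mB.
have ind0 : 0 < `|ind B|.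
  rewrite normr_gt0; apply/eqP => B0; have := norm_ind p1 mB Bfin.
  by rewrite B0 normr0 powR0 ?gt_eqF// => E0; rewrite -E0 ltxx in Bpos.
pose v : E := `|ind B|^-1 *: ind B.
have v1 : `|v| = 1 by rewrite /v normrZ normfV normr_id mulVf// gt_eqF.
have Bv : restr B v = v by rewrite /v restrZ// restr_ind// setIid.
have CBv : restr (~` B) v = 0.
  by rewrite /v restrZ// restr_ind// setICr (ind_null p1 measurable0 (measure0 mu)) scaler0.
exists v => // f Sf t t0; set f' := restr (~` B) f.
have fE : f = restr B f + f' by exact: restr_split.
have f't : `|f' + t *: v| = lr_norm2 p%:E `|f'| t.
  transitivity ((`|f' + t *: v| `^ p) `^ p^-1).
    by rewrite -powRrM mulfV ?gt_eqF// powRr1.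
  rewrite /=; congr (_ `^ _).
  rewrite -[LHS]normp_restrT -(setUv B) normp_restrU//; last by rewrite setICr.
  rewrite !restrD// (restrZ t v mB) (restrZ t v mCB) Bv CBv /f' !restrI// setICr setIid scaler0 addr0.
  by rewrite restr_set0 add0r addrC normrZ v1 mulr1 ger0_norm.
have f'f : (1 - e) * `|f| <= `|f'|.
  have : `|f| <= `|restr B f| + `|f'| by rewrite {1}fE ler_normD.
  have : `|restr B f| <= e * `|f| by exact: Be.
  by lra.
have lr0 : 0 <= lr_norm2 p%:E `|f| t by exact: lr_norm2_ge0.
have fl : `|f| <= lr_norm2 p%:E `|f| t by exact: lr_norm2_gel.
have H : (1 - e) * lr_norm2 p%:E `|f| t <= `|f' + t *: v|.
  have e10 : 0 <= 1 - e by rewrite subr_ge0.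
  rewrite f't -(lr_norm2Z p1 e10 (normr_ge0 f) t0).
  apply: (ler_lr_norm2 p1) => //; [exact: mulr_ge0|exact: mulr_ge0|].
  by rewrite ler_piMl// gerBl ltW.
have : `|f' + t *: v| <= `|f + t *: v| + e * `|f|.
  have -> : f' + t *: v = (f + t *: v) - restr B f.
    by apply/eqP; rewrite eq_sym subr_eq addrAC (addrC f') -fE.
  apply: le_trans (ler_normB _ _) _; rewrite lerD2l; exact: Be.
move=> /(le_trans H) HX.
apply: (@scale_loss _ e eta _ `|f|) HX; first by rewrite ler_wpM2l// ltW.
by rewrite mulr_ge0// subr_ge0.
Qed.

End Lp_escaping.

(** * The greedy subgroup *)

Section integer_span.
Context (R : realType) (X : normedModType R).
Implicit Types (S H : set X).

(** The subgroup generated by S. *)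
Definition zspan S : set X := [set u | forall H, H 0 ->
  (forall a b, H a -> H b -> H (a - b)) -> S `<=` H -> H u].

Lemma zspan_incl S : S `<=` zspan S.
Proof. by move=> x Sx H _ _; apply. Qed.

Lemma zspan0 S : zspan S 0.
Proof. by move=> H H0. Qed.

Lemma zspanB S a b : zspan S a -> zspan S b -> zspan S (a - b).
Proof.
by move=> Sa Sb H H0 HB SH; apply: (HB); [exact: Sa|exact: Sb].
Qed.

Lemma zspanN S a : zspan S a -> zspan S (- a).
Proof. by move=> Sa; rewrite -sub0r; apply: zspanB => //; exact: zspan0. Qed.

Lemma zspanD S a b : zspan S a -> zspan S b -> zspan S (a + b).
Proof. by move=> Sa /zspanN Sb; rewrite -[b]opprK; exact: zspanB. Qed.

Lemma zspanMn S a n : zspan S a -> zspan S (a *+ n).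
Proof.
move=> Sa; elim: n => [|n IH]; first by rewrite mulr0n; exact: zspan0.
by rewrite mulrS; exact: zspanD.
Qed.

Lemma zspanMz S a (n : int) : zspan S a -> zspan S (a *~ n).
Proof.
move=> Sa; case: n => n; first by rewrite -pmulrn; exact: zspanMn.
by rewrite NegzE mulrNz -pmulrn; apply: zspanN; exact: zspanMn.
Qed.

Lemma zspanS S S' : S `<=` S' -> zspan S `<=` zspan S'.
Proof.
move=> SS x Sx; apply: Sx; [exact: zspan0|exact: zspanB|].
by apply: subset_trans SS _; exact: zspan_incl.
Qed.

Lemma zspan_linear S : zspan S `<=` linear_span S.
Proof.
move=> x; apply; [exact: linear_span0|exact: linear_spanB|exact: linear_span_incl].
Qed.

Lemma zspan_zmod_closed S : zmod_closed (mem (zspan S)).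
Proof.
split; first by apply: mem_set; exact: zspan0.
by move=> a b /set_mem Sa /set_mem Sb; apply: mem_set; exact: zspanB.
Qed.

End integer_span.

Section greedy.
Context (R : realType) (X : normedModType R) (K : Type) (m : R).
Hypotheses (Kinf : infinite_set [set: K]) (m1 : 1 <= m) (Xesc : escaping K m X).

Let s := 2 / 2 `^ m^-1 : R.

Let m0 : 0 < m. Proof. exact: lt_le_trans ltr01 m1. Qed.

Let s_ge1 : 1 <= s.
Proof.
rewrite /s ler_pdivlMr ?powR_gt0// mul1r -[leRHS]powRr1//.
by apply: ler_powR; rewrite ?ler1n// invf_le1.
Qed.

Lemma small_setU1 (S : set X) x : ~ ([set: K] #<= S)%card -> ~ ([set: K] #<= S `|` [set x])%card.
Proof.
move=> KS; apply: (tiny_small Kinf KS).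
rewrite (_ : _ `|` _ = \bigcup_(b in [set: bool]) if b then S else [set x]).
  apply: tiny_bigcup => [|[] _]; [left; exact: finite_finset|exact: small_tiny KS|].
  by left; exact: finite_set1.
apply/seteqP; split=> [y [Sy|->]|y [[] _]]; [by exists true|by exists false|by left|by right].
Qed.

(** What is asked of the generator g added for the target x, when S is what has been
    generated before: either g comes close to x and no positive multiple of g comes
    within 2 of the old subgroup, or nothing is added because the old subgroup is
    already close. *)
Definition greedy_choice (t : R) (S : set X) (x g : X) :=
  (`|x - g| <= t /\ forall u, zspan S u -> forall k, 2 <= `|u + g *+ k.+1|) \/
  (g = 0 /\ exists2 u, zspan S u & `|x - u| <= t).

(** Add [g = x + t v] with v escaping from S and x. In [u + k g] the component along v
    has size [k t]. For [k >= 2] this alone is at least 2, because [s >= 1]. For [k = 1]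
    the other component [u + x] has norm at least t, as x is far from the subgroup, and
    t in both components gives [t 2^(1/m)]. The loss e is chosen such that t becomes s,
    and [s 2^(1/m) = 2]. *)
Lemma greedy_step (t : R) (S : set X) x : ~ ([set: K] #<= S)%card -> s < t ->
  exists g, greedy_choice t S x g.
Proof.
move=> KS st; have t0 : 0 < t by apply: lt_trans st; exact: lt_le_trans s_ge1.
have [|far] := pselect (exists2 u, zspan S u & `|x - u| <= t).
  by exists 0; right.
have {}far u : zspan S u -> t < `|x - u|.
  by move=> Su; rewrite ltNge; apply/negP => ?; apply: far; exists u.
pose e := (t - s) / t.
have e0 : 0 < e by rewrite divr_gt0// subr_gt0.
have et : (1 - e) * t = s by rewrite mulrBl mul1r /e divfK ?gt_eqF// subKr.
have e1 : 0 <= 1 - e.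
  by rewrite -(pmulr_lge0 _ t0) et (le_trans _ s_ge1).
have m1' : (1 <= m%:E)%E by rewrite lee_fin.
have [v v1 vP] := Xesc (small_setU1 (x := x) KS) e0.
exists (x + t *: v); left; split.
  by rewrite opprD addNKr normrN normrZ v1 mulr1 gtr0_norm.
have Sx : linear_span (S `|` [set x]) x by apply: linear_span_incl; right.
move=> u Su; have Su' : linear_span (S `|` [set x]) u.
  by apply: linear_spanS (zspan_linear Su) => ?; left.
move=> k.
have -> : u + (x + t *: v) *+ k.+1 = (u + k.+1%:R *: x) + (k.+1%:R * t) *: v.
  by rewrite -scalerA !scaler_nat mulrnDl addrA.
have kt : 0 <= k.+1%:R * t by rewrite mulr_ge0// ltW.
have Skx : linear_span (S `|` [set x]) (u + k.+1%:R *: x).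
  by apply: linear_spanD => //; exact: linear_spanZ.
apply: le_trans (vP _ Skx _ kt); case: k kt Skx => [|k] kt Skx.
  rewrite mul1r scale1r; apply: (@le_trans _ _ ((1 - e) * lr_norm2 m%:E t t)).
    have -> : lr_norm2 m%:E t t = t * 2 `^ m^-1.
      rewrite /lr_norm2 (_ : t `^ m + t `^ m = t `^ m * 2); last by ring.
      by rewrite powRM ?powR_ge0// -powRrM mulfV ?gt_eqF// powRr1// ltW.
    by rewrite mulrA et /s divfK// gt_eqF// powR_gt0.
  apply: (ler_wpM2l e1).
  apply: (@ler_lr_norm2 _ m%:E m1' t t _ t (ltW t0) (ltW t0) _ (lexx t)).
  by rewrite -[u]opprK addrC ltW//; apply: far; exact: zspanN.
apply: (@le_trans _ _ ((1 - e) * (k.+2%:R * t))).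
  rewrite mulrCA et; apply: (@le_trans _ _ (2 * s)).
    by rewrite ler_pMr.
  by rewrite ler_pM2r ?(lt_le_trans _ s_ge1)// ler_nat.
by apply: (ler_wpM2l e1); apply: (lr_norm2_ger m1').
Qed.

(** Transfinite recursion along an order of type kappa, so that the generators chosen
    before any stage form a small set. Separation is proved by looking at the last
    generator that occurs in an element of the subgroup. *)
Lemma greedy_subgroup (D : set X) (e : R) : 0 < e -> (D #<= [set: K])%card ->
  (forall x, exists2 c, D c & `|x - c| <= e / 2) ->
  exists P : set X, [/\ zmod_closed (mem P), s_dense (s + e) P & s_separated 2 P].
Proof.
move=> e0 DK Ddense; have st : s < s + e / 2 by rewrite ltrDl divr_gt0.
have [I [lt [wf trans tri KI seg]]] := initial_well_order K.
have [x xP] := surj_of_card_le 0 (card_le_trans DK KI).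
pose step a (rec : forall b, lt b a -> X) :=
  xget 0 (greedy_choice (s + e / 2) [set y | exists b (h : lt b a), I b /\ y = rec b h] (x a)).
pose g := Fix wf (fun=> X) step.
pose Z a := zspan (g @` [set b | I b /\ lt b a]).
have gE a : I a -> greedy_choice (s + e / 2) (g @` [set b | I b /\ lt b a]) (x a) (g a).
  move=> Ia.
  have -> : g a = step a (fun b _ => g b).
    rewrite /g Fix_eq// => c f h fh; congr (step c _).
    by apply: functional_extensionality_dep => b; apply/funext => ?; exact: fh.
  rewrite /step (_ : [set y | _] = g @` [set b | I b /\ lt b a]); last first.
    apply/seteqP; split=> [_ [b [h [Ib ->]]]|_ [b [Ib h] <-]]; first by exists b.
    by exists b, h.
  apply: xgetPex; apply: greedy_step => // Kg; apply: (seg a Ia).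
  exact: card_le_trans Kg (card_image_le _ _).
(* z has a last generator g b: it is a combination of earlier ones plus a
   multiple of g b. *)
pose topped (Q : set K) z :=
  z = 0 \/ exists b, [/\ Q b, I b & exists u, Z b u /\ exists n : int, z = u + g b *~ n].
have zspanP (Q : set K) z : Q `<=` I -> zspan (g @` Q) z -> topped Q z.
  move=> QI zQ; apply: (zQ (topped Q)); first by left.
    have gZ a b : Q a -> lt a b -> Z b (g a).
      by move=> Qa ab; apply: zspan_incl; exists a => //; split => //; exact: QI.
    have ZZ a b : lt a b -> Z a `<=` Z b.
      by move=> ab; apply: zspanS => _ [c [Ic ca] <-]; exists c => //; split=> //; exact: trans ab.
    move=> z1 z2 [->|[a [Qa Ia [u [Zu [n ->]]]]]] [->|[b [Qb Ib [w [Zw [k ->]]]]]].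
    - by left; rewrite subrr.
    - right; exists b; split=> //; exists (- w); split; first exact: zspanN.
      by exists (- k); rewrite sub0r opprD mulrNz.
    - by right; exists a; split=> //; exists u; split=> //; exists n; rewrite subr0.
    right; case: (tri a b) => [ab|[ab|ba]].
    - exists b; split=> //; exists (u + g a *~ n - w); split.
        apply: zspanB => //; apply: zspanD; first exact: ZZ Zu.
        by apply: zspanMz; exact: gZ.
      by exists (- k); rewrite opprD addrA mulrNz.
    - subst b; exists a; split=> //; exists (u - w); split; first exact: zspanB.
      by exists (n - k); rewrite mulrzBr opprD addrACA.
    - exists a; split=> //; exists (u - w - g b *~ k); split.
        apply: zspanB; last by apply: zspanMz; exact: gZ.
        by apply: zspanB => //; exact: ZZ Zw.
      by exists n; rewrite opprD addrAC addrA (addrAC _ (- w)).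
  move=> _ [b Qb <-]; right; exists b; split=> //; first exact: QI.
  by exists 0; split; [exact: zspan0|exists 1; rewrite add0r mulr1z].
have sep (Q : set K) : Q `<=` I -> (forall b z, Q b -> Z b z -> z = 0 \/ 2 <= `|z|) ->
    forall z, zspan (g @` Q) z -> z = 0 \/ 2 <= `|z|.
  move=> QI QZ z /(zspanP _ _ QI)[->|[b [Qb Ib [u [Zu [n ->]]]]]]; first by left.
  case: (gE b Ib) => [[_ gb]|[-> _]]; last by rewrite mul0rz addr0; exact: QZ Qb _.
  case: n => -[|n].
  - by rewrite mulr0z addr0; exact: QZ Qb _.
  - by right; rewrite -pmulrn; exact: gb.
  - by right; rewrite NegzE mulrNz -pmulrn -normrN opprB addrC; apply: gb; exact: zspanN.
  - by right; rewrite NegzE mulrNz -pmulrn -normrN opprB addrC; apply: gb; exact: zspanN.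
have sepZ a : I a -> forall z, Z a z -> z = 0 \/ 2 <= `|z|.
  elim/(well_founded_ind wf): a => a IH Ia.
  apply: sep => [b []//|b z [Ib ba] Zbz]; exact: IH Zbz.
exists (zspan (g @` I)); split; first exact: zspan_zmod_closed.
  move=> y; have [c Dc yc] := Ddense y; have [a Ia xa] := xP c Dc.
  suff [u Pu xu] : exists2 u, zspan (g @` I) u & `|x a - u| <= s + e / 2.
    exists u => //; rewrite -xa in yc.
    apply: le_trans (ler_distD (x a) _ _) _; apply: le_trans (lerD yc xu) _.
    by rewrite addrCA -splitr.
  case: (gE a Ia) => [[xg _]|[_ [u Zu xu]]].
    by exists (g a) => //; apply: zspan_incl; exists a.
  by exists u => //; apply: zspanS Zu => _ [b [Ib _] <-]; exists b.
move=> u w Pu Pw uw; have [/eqP|//] := @sep I (@subset_refl _ I) (fun b z Ib => sepZ b Ib z)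
  (u - w) (zspanB Pu Pw).
by rewrite subr_eq0 => /eqP.
Qed.

Lemma gamma_star_escaping :
  (exists2 D : set X, (D #<= [set: K])%card &
    forall x e, 0 < e -> exists2 c, D c & `|x - c| <= e) ->
  (gamma_star X <= s%:E)%E.
Proof.
move=> [D DK Ddense]; apply/lee_addgt0Pr => e e0; rewrite -EFinD.
have [|P [Pz Pd Ps]] := greedy_subgroup e0 DK.
  by move=> x; apply: Ddense; rewrite divr_gt0.
apply: ereal_inf_lbound; exists (s + e) => //; split; last by exists P.
by rewrite addr_gt0// (lt_le_trans _ s_ge1).
Qed.

End greedy.

(** * Direct sums *)

Section lr_sums.
Context (R : realType).
Implicit Types (a b t p r : R).

Lemma powR_root p a : p != 0 -> 0 <= a -> (a `^ p) `^ p^-1 = a.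
Proof. by move=> p0 a0; rewrite -powRrM mulfV// powRr1. Qed.

Lemma root_powR p a : p != 0 -> 0 <= a -> (a `^ p^-1) `^ p = a.
Proof. by move=> p0 a0; rewrite -powRrM mulVf// powRr1. Qed.

Lemma lr_norm2E r a b : lr_norm2 r%:E a b = (a `^ r + b `^ r) `^ r^-1.
Proof. by []. Qed.

Local Opaque lr_norm2.

Lemma lr_norm2_powR r a b : 0 < r -> lr_norm2 r%:E a b `^ r = a `^ r + b `^ r.
Proof.
move=> r0; rewrite lr_norm2E root_powR ?gt_eqF//.
by apply: addr_ge0; exact: powR_ge0.
Qed.

Lemma lr_norm20 r a : 1 <= r -> 0 <= a -> lr_norm2 r%:E a 0 = a.
Proof.
move=> r1 a0; have r0 : r != 0 by rewrite gt_eqF// (lt_le_trans ltr01).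
by rewrite lr_norm2E (powR0 r0) addr0 powR_root.
Qed.

Lemma lr_norm2_addl r a b t : 1 <= r -> 0 <= a -> 0 <= b -> 0 <= t ->
  lr_norm2 r%:E (a + b) t <= lr_norm2 r%:E a t + b.
Proof.
move=> r1 a0 b0 t0; have re : (1 <= r%:E)%E by rewrite lee_fin.
have := lr_norm2D re a0 t0 b0 (lexx 0).
by rewrite (addr0 t) (lr_norm20 r1 b0).
Qed.

Lemma lr_norm2_scale p r a b : 0 < p -> 0 < r ->
  lr_norm2 p%:E a b `^ r = lr_norm2 (p / r)%:E (a `^ r) (b `^ r).
Proof.
move=> p0 r0; rewrite !lr_norm2E.
have E c : (c `^ r) `^ (p / r) = c `^ p by rewrite -powRrM mulrC divfK ?gt_eqF.
by rewrite (E a) (E b) invf_div -powRrM mulrC.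
Qed.

Lemma powR_le_cancel r a b : 0 < r -> 0 <= a -> 0 <= b -> a `^ r <= b `^ r -> a <= b.
Proof.
move=> r0 a0 b0; apply: contraTT; rewrite -!ltNge => ba.
by apply: gt0_ltr_powR; rewrite ?nnegrE.
Qed.

Lemma lr_norm2_anti p r a t : 1 <= p -> p <= r -> 0 <= a -> 0 <= t ->
  lr_norm2 r%:E a t <= lr_norm2 p%:E a t.
Proof.
move=> p1 pr a0 t0; have p0 : 0 < p by exact: lt_le_trans ltr01 p1.
have r0 : 0 < r by exact: lt_le_trans pr.
have pe : (1 <= p%:E)%E by rewrite lee_fin.
set M := lr_norm2 p%:E a t.
have M0 : 0 <= M by exact: lr_norm2_ge0.
have Mp : M `^ p = a `^ p + t `^ p.
  exact: lr_norm2_powR.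
have pw c : 0 <= c -> c <= M -> c `^ r <= c `^ p * M `^ (r - p).
  move=> c0 cM; have [->|cn0] := eqVneq c 0.
    by rewrite powR0 ?gt_eqF// mulr_ge0// powR_ge0.
  have -> : c `^ r = c `^ p * c `^ (r - p).
    by rewrite -powRD ?subrKC// cn0 implybT.
  rewrite ler_wpM2l ?powR_ge0//; apply: ge0_ler_powR; rewrite ?nnegrE//.
  by rewrite subr_ge0.
have aM : a <= M by exact: lr_norm2_gel.
have tM : t <= M by exact: lr_norm2_ger.
rewrite (lr_norm2E r a t).
rewrite -[leRHS](@powR_root r) ?gt_eqF//; apply: ge0_ler_powR.
- by rewrite invr_ge0 ltW.
- by rewrite nnegrE addr_ge0// powR_ge0.
- by rewrite nnegrE powR_ge0.
apply: le_trans (lerD (pw _ a0 aM) (pw _ t0 tM)) _.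
rewrite -mulrDl -Mp; have [->|Mn0] := eqVneq M 0.
  by rewrite (powR0 (lt0r_neq0 p0)) mul0r powR_ge0.
by rewrite -powRD ?subrKC// Mn0 implybT.
Qed.

(** The coordinates b and t change places. For [p <= r] the r-norm of three numbers does
    not depend on the order in which they are joined, and the r-norm is at most the
    p-norm; for [r < p], after raising to the power r, it is the triangle inequality for
    the exponent [p / r]. *)
Lemma lr_norm2_mixed p r a b t : 1 <= p -> 1 <= r -> 0 <= a -> 0 <= b -> 0 <= t ->
  lr_norm2 (Num.max p r)%:E (lr_norm2 r%:E a b) t <=
  lr_norm2 r%:E (lr_norm2 p%:E a t) b.
Proof.
move=> p1 r1 a0 b0 t0; have p0 : 0 < p by exact: lt_le_trans ltr01 p1.
have r0 : 0 < r by exact: lt_le_trans ltr01 r1.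
have re : (1 <= r%:E)%E by rewrite lee_fin.
have pe : (1 <= p%:E)%E by rewrite lee_fin.
have [pr|lrep] := leP p r.
  have E : lr_norm2 r%:E (lr_norm2 r%:E a b) t = lr_norm2 r%:E (lr_norm2 r%:E a t) b.
    apply: (eq_trans (lr_norm2E r (lr_norm2 r%:E a b) t)).
    apply: (eq_trans _ (esym (lr_norm2E r (lr_norm2 r%:E a t) b))).
    apply: (congr1 (fun c : R => c `^ r^-1)).
    apply: (eq_trans (congr1 (fun c => c + t `^ r) (lr_norm2_powR a b r0))).
    apply: (eq_trans _ (esym (congr1 (fun c => c + b `^ r) (lr_norm2_powR a t r0)))).
    exact: addrAC.
  apply: (@le_trans _ _ (lr_norm2 r%:E (lr_norm2 r%:E a t) b)).
    by apply: (eq_ind_r (fun c => c <= _) (lexx _) E).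
  apply: (@ler_lr_norm2 _ r%:E re _ b _ b (lr_norm2_ge0 _ re a0) b0 _ (lexx b)).
  exact: lr_norm2_anti.
have th1 : 1 <= p / r by rewrite ler_pdivlMr// mul1r ltW.
have scale x y : lr_norm2 p%:E x y `^ r = lr_norm2 (p / r)%:E (x `^ r) (y `^ r).
  exact: lr_norm2_scale.
have conv (x x' y y' : R) : x = x' -> y = y' -> x' <= y' -> x <= y by move=> -> ->.
have L0 : 0 <= lr_norm2 p%:E (lr_norm2 r%:E a b) t.
  exact: (lr_norm2_ge0 t pe (lr_norm2_ge0 b re a0)).
have R0 : 0 <= lr_norm2 r%:E (lr_norm2 p%:E a t) b.
  exact: (lr_norm2_ge0 b re (lr_norm2_ge0 t pe a0)).
apply: (powR_le_cancel r0 L0 R0).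
apply: (conv _ (lr_norm2 (p / r)%:E (a `^ r + b `^ r) (t `^ r))
  _ (lr_norm2 (p / r)%:E (a `^ r) (t `^ r) + b `^ r)).
- apply: (eq_trans (scale (lr_norm2 r%:E a b) t)).
  exact: (congr1 (fun c => lr_norm2 (p / r)%:E c (t `^ r)) (lr_norm2_powR a b r0)).
- apply: (eq_trans (lr_norm2_powR (lr_norm2 p%:E a t) b r0)).
  exact: (congr1 (fun c => c + b `^ r) (scale a t)).
- exact: (lr_norm2_addl th1 (powR_ge0 a r) (powR_ge0 b r) (powR_ge0 t r)).
Qed.

End lr_sums.

Section dsum_facts.
Context (R : realType) (r : \bar R) (r1 : (1 <= r)%E) (X Y : normedModType R).
Local Notation Z := (dsum r1 X Y).

Lemma dsum_normE (z : Z) : `|z| = lr_norm2 r `|z.1| `|z.2|.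
Proof. by []. Qed.

Lemma lr_norm2x0 (a : R) : 0 <= a -> lr_norm2 r a 0 = a.
Proof.
case: r r1 => [s s1 a0|_ a0|//]; first by apply: lr_norm20; rewrite -?lee_fin.
by rewrite /lr_norm2 max_l.
Qed.

Lemma lr_norm20x (a : R) : 0 <= a -> lr_norm2 r 0 a = a.
Proof. by move=> a0; rewrite lr_norm2C lr_norm2x0. Qed.

Lemma lr_norm2_le_sum (a b : R) : 0 <= a -> 0 <= b -> lr_norm2 r a b <= a + b.
Proof.
move=> a0 b0; have := lr_norm2D r1 a0 (lexx 0) (lexx 0) b0.
by rewrite (addr0 a) (add0r b) lr_norm2x0// lr_norm20x.
Qed.

Lemma dsum_norm_le (z : Z) : `|z| <= `|z.1| + `|z.2|.
Proof. exact: lr_norm2_le_sum. Qed.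

Lemma dsum_norm_ge1 (z : Z) : `|z.1| <= `|z|.
Proof. exact: (lr_norm2_gel r1). Qed.

Lemma dsum_norm_ge2 (z : Z) : `|z.2| <= `|z|.
Proof. exact: (lr_norm2_ger r1). Qed.

Lemma dense_dsum (K : Type) (S : set X) (S' : set Y) : infinite_set [set: K] ->
  densely_spans S -> (S #<= [set: K])%card ->
  densely_spans S' -> (S' #<= [set: K])%card ->
  exists2 D : set Z, (D #<= [set: K])%card &
    forall x e, 0 < e -> exists2 c, D c & `|x - c| <= e.
Proof.
move=> Kinf dS SK dS' SK'.
have [D tD DP] := @tiny_dense _ X _ [set: K] S Kinf (or_intror (conj Kinf SK)).
have [D' tD' DP'] := @tiny_dense _ Y _ [set: K] S' Kinf (or_intror (conj Kinf SK')).
exists (D `*` D'); first by apply: tiny_card_le => //; exact: tiny_setX.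
move=> [x y] e e0; have e20 : 0 < e / 2 by rewrite divr_gt0.
have [|c Dc xc] := DP x _ _ e20; first by rewrite dS.
have [|c' Dc' yc] := DP' y _ _ e20; first by rewrite dS'.
exists (c, c') => //; apply: le_trans (dsum_norm_le _) _.
by rewrite [leRHS]splitr lerD.
Qed.

Lemma linear_span_fst (S : set Z) z : linear_span S z -> linear_span (fst @` S) z.1.
Proof.
move=> Sz; apply: (@linear_span_min R Z S [set z : Z | linear_span (fst @` S) z.1]) Sz.
- by move=> x Sx; apply: linear_span_incl; exists x.
- exact: linear_span0.
- by move=> x y; exact: linear_spanD.
- by move=> a x; exact: linear_spanZ.
Qed.

End dsum_facts.

(** A direction escaping in X also escapes in the sum, by [lr_norm2_mixed]. *)
Lemma dsum_escaping (R : realType) (r : R) (r1 : (1 <= r%:E)%E) (p : R)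
    (X Y : normedModType R) (K : Type) : 1 <= p ->
  escaping K p X -> escaping K (Num.max p r) (dsum r1 X Y).
Proof.
move=> p1 Xesc S KS e e0; have pe : (1 <= p%:E)%E by rewrite lee_fin.
have KS1 : ~ ([set: K] #<= fst @` S)%card.
  by move=> K1; apply: KS; exact: card_le_trans K1 (card_image_le _ _).
have [v v1 vP] := Xesc _ KS1 e e0.
exists ((v, 0) : dsum r1 X Y).
  have -> : `|(v, 0) : dsum r1 X Y| = lr_norm2 r%:E `|v| `|0 : Y| by [].
  by rewrite normr0 v1 lr_norm2x0.
have mr1 : (1 <= (Num.max p r)%:E)%E by rewrite lee_fin le_max p1.
move=> z Sz t t0; have [e1|e1] := leP 0 (1 - e); last first.
  apply: (@le_trans _ _ 0) => //; apply: mulr_le0_ge0; first exact: ltW.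
  exact: (lr_norm2_ge0 t mr1 (normr_ge0 z)).
have zE : `|z + t *: ((v, 0) : dsum r1 X Y)| = lr_norm2 r%:E `|z.1 + t *: v| `|z.2|.
  have E : z.2 + t *: (0 : Y) = z.2 by rewrite scaler0 addr0.
  exact: (congr1 (fun y => lr_norm2 r%:E `|z.1 + t *: v| `|y|) E).
rewrite zE.
have r1' : 1 <= r by rewrite -lee_fin.
apply: le_trans (ler_wpM2l e1 (lr_norm2_mixed p1 r1' (normr_ge0 z.1) (normr_ge0 z.2) t0)) _.
have L0 := lr_norm2_ge0 t pe (normr_ge0 z.1).
rewrite -(lr_norm2Z r1 e1 L0 (normr_ge0 z.2)).
apply: (ler_lr_norm2 r1).
- exact: (mulr_ge0 e1 L0).
- exact: (mulr_ge0 e1 (normr_ge0 z.2)).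
- exact: (vP _ (linear_span_fst Sz) _ t0).
- apply: (ler_piMl (normr_ge0 z.2)); rewrite gerBl; exact: ltW.
Qed.

Lemma gamma_le_gamma_star (R : realType) (X : normedModType R) :
  (gamma X <= gamma_star X)%E.
Proof.
apply: ereal_inf_le_tmp => _ [s [s0 [P [_ Pd Ps]]] <-].
by exists s => //; split => //; exists P.
Qed.

Lemma gamma_star_dsum_oo (R : realType) (r1 : (1 <= +oo :> \bar R)%E)
    (X Y : normedModType R) :
  (gamma_star (dsum r1 X Y) <= Order.max (gamma_star X) (gamma_star Y))%E.
Proof.
rewrite leNgt gt_max; apply/negP => /andP[/ereal_inf_lt[_ [s [s0 [P [Pz Pd Ps]]] <-] sX]].
move=> /ereal_inf_lt[_ [t [t0 [Q [Qz Qd Qs]]] <-] tY].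
have : (gamma_star (dsum r1 X Y) <= (Num.max s t)%:E)%E.
  apply: ereal_inf_lbound; exists (Num.max s t) => //; split; first by rewrite lt_max s0.
  exists (P `*` Q); split.
  - have [P0 PB] := Pz; have [Q0 QB] := Qz; split.
      by apply: mem_set; split; exact: set_mem.
    move=> x y /set_mem[Px1 Px2] /set_mem[Py1 Py2]; apply: mem_set; split.
      by apply: set_mem; apply: PB; exact: mem_set.
    by apply: set_mem; apply: QB; exact: mem_set.
  - move=> [x y]; have [u Pu xu] := Pd x; have [w Qw yw] := Qd y.
    exists (u, w) => //; rewrite dsum_normE /= ge_max !le_max xu yw.
    by rewrite orbT.
  - move=> [x y] [x' y'] [/= Px Qy] [/= Px' Qy'] ne.
    have [xx'|xx'] := pselect (x = x'); last first.
      by apply: le_trans (dsum_norm_ge1 _); exact: Ps.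
    apply: le_trans (dsum_norm_ge2 _); apply: Qs => //= yy'.
    by apply: ne; rewrite xx' yy'.
by apply/negP; rewrite -ltNge EFin_max gt_max sX.
Qed.

(** * Pairwise distances of finitely many points of Lp *)

Section scalar_kernel.
Context (R : realType).
Implicit Types (a b c t p q h u y : R).

(** The kernel [min s t] is positive semidefinite on nonnegative reals: subtract the
    smallest of the points and induct. *)
Lemma min_kernel_ge0 n (c t : 'I_n -> R) : (forall i, 0 <= t i) ->
  0 <= \sum_i \sum_j c i * c j * Num.min (t i) (t j).
Proof.
elim: n c t => [|n IH] c t t0; first by rewrite big_ord0.
have [i0 [_ i0min]] : exists i0 : 'I_n.+1, true /\ forall j, t i0 <= t j.
  by case: (@arg_minP _ _ _ ord0 xpredT t) => // i _ H; exists i; split=> // j; exact: H.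
have tm0 i : 0 <= t i - t i0 by rewrite subr_ge0.
have -> : \sum_i \sum_j c i * c j * Num.min (t i) (t j) =
    t i0 * (\sum_i c i) ^+ 2 +
    \sum_i \sum_j c (lift i0 i) * c (lift i0 j) *
       Num.min (t (lift i0 i) - t i0) (t (lift i0 j) - t i0).
  rewrite expr2 mulr_suml mulr_sumr.
  have E i j : c i * c j * Num.min (t i) (t j) =
      t i0 * (c i * c j) + c i * c j * Num.min (t i - t i0) (t j - t i0).
    by rewrite -addr_minl; ring.
  under eq_bigr do under eq_bigr do rewrite E.
  under eq_bigr do rewrite big_split /= -mulr_sumr -mulr_sumr.
  rewrite big_split /=; congr (_ + _).
  rewrite (bigD1_ord i0) //= [X in X + _]big1 ?add0r; last first.
    by move=> j _; rewrite subrr min_l ?mulr0.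
  apply: eq_bigr => i _; rewrite (bigD1_ord i0) //= subrr min_r ?mulr0 ?add0r//.
apply: addr_ge0; first by rewrite mulr_ge0 ?sqr_ge0.
by apply: (IH (fun i => c (lift i0 i)) (fun i => t (lift i0 i) - t i0)).
Qed.

Lemma powR_superadd h a b : 1 <= h -> 0 <= a -> 0 <= b -> a `^ h + b `^ h <= (a + b) `^ h.
Proof.
move=> h1 a0 b0; have h0 : 0 < h by exact: lt_le_trans ltr01 h1.
have ab0 := addr_ge0 a0 b0.
have := lr_norm2_anti (lexx 1) h1 a0 b0.
rewrite (lr_norm2E 1 a b) invr1 (powRr1 a0) (powRr1 b0) (powRr1 ab0) => H.
rewrite -(lr_norm2_powR a b h0); apply: ge0_ler_powR => //; first exact: ltW.
by rewrite nnegrE; apply: lr_norm2_ge0; rewrite ?lee_fin.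
Qed.

Lemma powR_midconvex h a b : 1 <= h -> 0 <= a -> 0 <= b ->
  (a + b) `^ h <= 2 `^ (h - 1) * (a `^ h + b `^ h).
Proof.
move=> h1 a0 b0; have h0 : 0 < h by exact: lt_le_trans ltr01 h1.
have he : (1 <= h%:E)%E by rewrite lee_fin.
have ab0 := addr_ge0 a0 b0.
have H : lr_norm2 h%:E (a + b) (a + b) <= lr_norm2 h%:E a b + lr_norm2 h%:E a b.
  have := lr_norm2D he a0 b0 b0 a0.
  apply: (eq_ind_r (fun c => lr_norm2 h%:E (a + b) c <= _ -> _) _ (addrC b a)).
  exact: (eq_ind_r (fun c => _ <= _ + c -> _) id (lr_norm2C h%:E b a)).
have N0 := lr_norm2_ge0 b he a0.
have Nh := lr_norm2_powR a b h0.
have L0 := lr_norm2_ge0 (a + b) he ab0.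
have Lh := lr_norm2_powR (a + b) (a + b) h0.
move: H N0 Nh L0 Lh.
move: (lr_norm2 h%:E a b) (lr_norm2 h%:E (a + b) (a + b)) => N L LN N0.
move: (_ `^ h + _ `^ h) ((a + b) `^ h) => Y X Nh L0 Lh.
have := ge0_ler_powR (ltW h0) L0 (addr_ge0 N0 N0) LN.
have -> : (N + N) `^ h = 2 `^ h * Y.
  by rewrite (_ : N + N = 2 * N); [rewrite (@powRM R 2 N h _ N0)// Nh|ring].
rewrite Lh powRB ?pnatr_eq0 ?implybT// powRr1//.
by move: (2 `^ h) => Z; lra.
Qed.

(** Young's inequality for [y^q] and 1. *)
Lemma powR_bernoulli q y : 0 <= q -> q <= 1 -> 0 <= y -> y `^ q <= 1 + q * (y - 1).
Proof.
rewrite le_eqVlt => /predU1P[<- _ _|q0]; first by rewrite powRr0 mul0r addr0.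
rewrite le_eqVlt => /predU1P[-> y0|q1 y0].
  by rewrite powRr1// mul1r addrC subrK.
have q10 : 0 < 1 - q by rewrite subr_gt0.
have := @conjugate_powR R (y `^ q) 1 q^-1 (1 - q)^-1 (powR_ge0 _ _) ler01.
rewrite !invr_gt0 q0 q10 => /(_ isT isT).
rewrite !invrK subrKC => /(_ erefl); rewrite mulr1 powR1 -powRrM mulfV ?gt_eqF//.
by rewrite powRr1// => H; lra.
Qed.

(** The signed power, i.e. the Mazur map onto L_h, which for [h = p / 2] reduces the
    inequality for [p >= 2] to the parallelogram identity in Hilbert space. *)
Definition mazur h a : R := (if 0 <= a then 1 else -1) * `|a| `^ h.

Lemma mazurP h a : (0 <= a /\ mazur h a = a `^ h) \/ (a < 0 /\ mazur h a = - (- a) `^ h).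
Proof.
rewrite /mazur; case: leP => a0; [left|right]; split=> //.
  by rewrite mul1r ger0_norm.
by rewrite ltr0_norm// mulN1r.
Qed.

Lemma mazur_sq h a : 0 < h -> mazur h a ^+ 2 = `|a| `^ (h * 2).
Proof.
by move=> h0; rewrite powRrM powR_mulrn ?powR_ge0// exprMn; case: ifP => _; rewrite ?sqrrN expr1n mul1r.
Qed.

Lemma mazur_dist h a b : 1 <= h ->
  `|a - b| `^ h <= 2 `^ (h - 1) * `|mazur h a - mazur h b|.
Proof.
move=> h1; have h0 : 0 <= h by exact: le_trans ler01 h1.
have two1 : 1 <= 2 `^ (h - 1) :> R.
  by rewrite -[leLHS](powRr0 2); apply: ler_powR; rewrite ?ler1n// subr_ge0.
have same x y : 0 <= x -> 0 <= y -> `|x - y| `^ h <= 2 `^ (h - 1) * `|x `^ h - y `^ h|.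
  move=> x0 y0; wlog xy : x y x0 y0 / y <= x.
    move=> H; have [/H|/ltW /H] := leP y x; first exact.
    by rewrite distrC (distrC (x `^ h)); exact.
  apply: (@le_trans _ _ `|x `^ h - y `^ h|); last by rewrite ler_peMl.
  have := @powR_superadd h (x - y) y h1; rewrite subr_ge0 xy y0 subrK => /(_ isT isT).
  rewrite (ger0_norm (_ : 0 <= x - y)) ?subr_ge0// => H.
  by rewrite ger0_norm ?subr_ge0 ?lerBrDr// (le_trans _ H)// lerDr powR_ge0.
have opp x y : 0 <= x -> 0 <= y -> `|x + y| `^ h <= 2 `^ (h - 1) * `|x `^ h + y `^ h|.
  move=> x0 y0; rewrite !ger0_norm ?addr_ge0 ?powR_ge0//; exact: powR_midconvex.
case: (mazurP h a) => [[a0 ->]|[a0 ->]]; case: (mazurP h b) => [[b0 ->]|[b0 ->]].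
- exact: same.
- by rewrite opprK; apply: opp => //; rewrite oppr_ge0 ltW.
- rewrite (_ : - (- a) `^ h - b `^ h = - (b `^ h + (- a) `^ h)); last first.
    by rewrite opprD addrC.
  by rewrite normrN distrC; apply: opp => //; rewrite oppr_ge0 ltW.
- rewrite (_ : a - b = - b - - a); last by rewrite opprK addrC.
  rewrite (_ : - (- a) `^ h - - (- b) `^ h = (- b) `^ h - (- a) `^ h).
    by apply: same; rewrite oppr_ge0 ltW.
  by rewrite opprK addrC.
Qed.

Lemma mazur_pair p a b : 2 <= p ->
  `|a - b| `^ p <= 2 `^ (p - 2) * (mazur (p / 2) a - mazur (p / 2) b) ^+ 2.
Proof.
move=> p2; have h1 : 1 <= p / 2 by rewrite ler_pdivlMr// mul1r.
have -> : `|a - b| `^ p = (`|a - b| `^ (p / 2)) ^+ 2.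
  by rewrite -powR_mulrn ?powR_ge0// -powRrM divfK.
have -> : 2 `^ (p - 2) = (2 `^ (p / 2 - 1)) ^+ 2 :> R.
  by rewrite -powR_mulrn ?powR_ge0// -powRrM; congr (_ `^ _); field.
rewrite -(real_normK (num_real (mazur (p / 2) a - mazur (p / 2) b))) -exprMn.
apply: lerXn2r; rewrite ?nnegrE ?powR_ge0 ?mulr_ge0 ?powR_ge0//.
exact: mazur_dist.
Qed.

(** In terms of the signed powers of exponent [p / 2] this is the identity [sum_ij (f_i
    - f_j)^2 = 2 n sum_i f_i^2 - 2 (sum_i f_i)^2]. *)
Lemma pairs_ge2 p n (a : 'I_n -> R) : 2 <= p ->
  \sum_i \sum_j `|a i - a j| `^ p <= 2 `^ (p - 1) * n%:R * \sum_i `|a i| `^ p.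
Proof.
move=> p2; have p0 : 0 < p / 2 by rewrite divr_gt0// (lt_le_trans _ p2).
pose f i := mazur (p / 2) (a i).
have fE i : f i ^+ 2 = `|a i| `^ p by rewrite /f mazur_sq// divfK.
apply: (@le_trans _ _ (\sum_i \sum_j 2 `^ (p - 2) * (f i - f j) ^+ 2)).
  by apply: ler_sum => i _; apply: ler_sum => j _; exact: mazur_pair.
have -> : \sum_i \sum_j 2 `^ (p - 2) * (f i - f j) ^+ 2 =
    2 `^ (p - 1) * (n%:R * \sum_i f i ^+ 2) - 2 `^ (p - 1) * (\sum_i f i) ^+ 2.
  have -> : 2 `^ (p - 1) = 2 `^ (p - 2) * 2 :> R.
    rewrite -[X in _ = _ * X](@powRr1 R 2)// -powRD ?pnatr_eq0 ?implybT//.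
    by congr (_ `^ _); ring.
  under eq_bigr do rewrite -mulr_sumr; rewrite -mulr_sumr -!mulrA -mulrBr.
  congr (_ * _).
  have -> : \sum_i \sum_j (f i - f j) ^+ 2 =
      \sum_i (n%:R * f i ^+ 2 + \sum_j f j ^+ 2 - 2 * (f i * \sum_j f j)).
    apply: eq_bigr => i _; rewrite !mulr_sumr -sumrN.
    rewrite [n%:R * _](_ : _ = \sum_(j < n) f i ^+ 2); last first.
      by rewrite sumr_const card_ord mulr_natl.
    by rewrite -!big_split /=; apply: eq_bigr => j _; ring.
  rewrite !big_split /= sumrN -!mulr_sumr -mulr_suml sumr_const card_ord -[_ *+ n]mulr_natl.
  by rewrite expr2; ring.
under eq_bigr do rewrite fE.
by rewrite mulrA gerBl mulr_ge0 ?powR_ge0// sqr_ge0.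
Qed.

(** For [b <= a] the kernel is [a^(p-1) b], and with [u = b / a] both inequalities
    become [(1 -+ u)^p <= 1 + u^p -+ p u], which follows from Bernoulli's inequality for
    the exponent [p - 1] and from [u^2 <= u^p]. *)
Lemma kernel_pair_pos p a b : 1 <= p -> p <= 2 -> 0 <= a -> 0 <= b ->
  let k := a `^ (p - 1) * b `^ (p - 1) * Num.min (a `^ (2 - p)) (b `^ (2 - p)) in
  `|a - b| `^ p <= a `^ p + b `^ p - p * k /\
  (a + b) `^ p <= a `^ p + b `^ p + p * k.
Proof.
move=> p1 p2; wlog ba : a b / b <= a.
  move=> H a0 b0; have [/H|/ltW /H] := leP b a; first exact.
  move=> /(_ b0 a0) /=; rewrite distrC (addrC b) (addrC (b `^ p)).
  by rewrite (mulrC (b `^ (p - 1))) minC.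
move=> a0; rewrite le_eqVlt => /predU1P[<- k|b0 k].
  have -> : k = 0.
    rewrite /k; have [->|pn2] := eqVneq p 2.
      have -> : 2 - 1 = 1 :> R by ring.
      by rewrite (powRr1 (lexx 0)) mulr0 mul0r.
    rewrite (powR0 (_ : 2 - p != 0)) ?subr_eq0 1?eq_sym// min_r ?powR_ge0//.
    by rewrite mulr0.
  have pn0 : p != 0 by rewrite gt_eqF// (lt_le_trans ltr01).
  by rewrite (powR0 pn0) mulr0 subr0 !addr0 ger0_norm// subr0.
have a1 : 0 < a by exact: lt_le_trans ba.
have p0 : 0 < p by exact: lt_le_trans ltr01 p1.
pose u := b / a; have u0 : 0 < u by rewrite divr_gt0.
have u1 : u <= 1 by rewrite ler_pdivrMr// mul1r.
have bE : b = a * u by rewrite mulrC divfK// gt_eqF.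
have kE : k = a `^ p * u.
  rewrite /k min_r; last by apply: ge0_ler_powR; rewrite ?nnegrE ?subr_ge0 //; exact: ltW.
  rewrite -mulrA -powRD; last by rewrite (gt_eqF b0) implybT.
  have -> : p - 1 + (2 - p) = 1 by ring.
  rewrite (powRr1 (ltW b0)) bE mulrA; congr (_ * _).
  rewrite -[X in _ * X](powRr1 a0) -powRD; last by rewrite (gt_eqF a1) implybT.
  by rewrite subrK.
have bp : b `^ p = a `^ p * u `^ p by rewrite bE powRM// ltW.
have q0 : 0 <= p - 1 by rewrite subr_ge0.
have q1 : p - 1 <= 1 by rewrite lerBlDr.
have usq : (p - 1) * u ^+ 2 <= u `^ p.
  apply: (@le_trans _ _ (u ^+ 2)); first by rewrite ler_piMl// sqr_ge0.
  rewrite -(powR_mulrn 2 (ltW u0)); apply: ger_powR => //; exact/andP.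
have split y : 0 <= y -> y `^ p <= y * (1 + (p - 1) * (y - 1)).
  rewrite le_eqVlt => /predU1P[<-|y0]; first by rewrite powR0 ?mul0r// gt_eqF.
  have -> : y `^ p = y * y `^ (p - 1).
    rewrite -[X in X * _](powRr1 (ltW y0)) -powRD; last by rewrite (gt_eqF y0) implybT.
    by rewrite subrKC.
  by rewrite ler_pM2l//; apply: powR_bernoulli => //; exact: ltW.
have ap : 0 < a `^ p by rewrite powR_gt0.
have um : 0 <= 1 - u by rewrite subr_ge0.
have up : 0 <= 1 + u by rewrite addr_ge0// ltW.
have H1 : (1 - u) `^ p <= 1 + u `^ p - p * u.
  by apply: le_trans (split _ um) _; move: usq; move: (u `^ p) => U; rewrite expr2; lra.
have H2 : (1 + u) `^ p <= 1 + u `^ p + p * u.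
  by apply: le_trans (split _ up) _; move: usq; move: (u `^ p) => U; rewrite expr2; lra.
rewrite kE bp; split.
  have -> : `|a - b| = a * (1 - u) by rewrite ger0_norm ?subr_ge0// mulrBr mulr1 -bE.
  rewrite (@powRM R a (1 - u) p a0 um).
  have -> : a `^ p + a `^ p * u `^ p - p * (a `^ p * u) = a `^ p * (1 + u `^ p - p * u) by ring.
  by rewrite ler_pM2l.
have -> : a + b = a * (1 + u) by rewrite mulrDr mulr1 -bE.
rewrite (@powRM R a (1 + u) p a0 up).
have -> : a `^ p + a `^ p * u `^ p + p * (a `^ p * u) = a `^ p * (1 + u `^ p + p * u) by ring.
by rewrite ler_pM2l.
Qed.

Lemma kernel_pair p a b : 1 <= p -> p <= 2 ->
  `|a - b| `^ p <= `|a| `^ p + `|b| `^ p -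
    p * (mazur (p - 1) a * mazur (p - 1) b * Num.min (`|a| `^ (2 - p)) (`|b| `^ (2 - p))).
Proof.
move=> p1 p2; have [H1 H2] := kernel_pair_pos p1 p2 (normr_ge0 a) (normr_ge0 b).
rewrite /mazur; have [a0|a0] := leP 0 a; have [b0|b0] := leP 0 b.
- rewrite !mul1r; rewrite (ger0_norm a0) (ger0_norm b0) in H1 *; exact: H1.
- rewrite mul1r mulN1r mulrN mulNr mulrN opprK.
  have -> : `|a - b| = `|a| + `|b|.
    by rewrite (ger0_norm a0) (ltr0_norm b0) ger0_norm// addr_ge0// oppr_ge0 ltW.
  exact: H2.
- rewrite mul1r mulN1r !mulNr mulrN opprK.
  have -> : `|a - b| = `|a| + `|b|.
    by rewrite distrC (ger0_norm b0) (ltr0_norm a0) ger0_norm addrC// addr_ge0// oppr_ge0 ltW.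
  exact: H2.
- rewrite !mulN1r mulrNN.
  have -> : `|a - b| = `| `|a| - `|b| |.
    by rewrite (ltr0_norm b0) (ltr0_norm a0) distrC opprK addrC.
  exact: H1.
Qed.

(** Sum [kernel_pair] over all pairs: the kernel is positive semidefinite, being a
    product of a rank one kernel and a minimum kernel, and may be dropped. *)
Lemma pairs_le2 p n (a : 'I_n -> R) : 1 <= p -> p <= 2 ->
  \sum_i \sum_j `|a i - a j| `^ p <= 2 * n%:R * \sum_i `|a i| `^ p.
Proof.
move=> p1 p2; pose c i := mazur (p - 1) (a i); pose t i := `|a i| `^ (2 - p).
apply: (@le_trans _ _ (\sum_i \sum_j (`|a i| `^ p + `|a j| `^ p -
    p * (c i * c j * Num.min (t i) (t j))))).
  by apply: ler_sum => i _; apply: ler_sum => j _; exact: kernel_pair.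
have := @min_kernel_ge0 n c t (fun i => powR_ge0 _ _); set Q := \sum_i _ => Q0.
have -> : \sum_i \sum_j (`|a i| `^ p + `|a j| `^ p - p * (c i * c j * Num.min (t i) (t j)))
    = 2 * n%:R * (\sum_i `|a i| `^ p) - p * Q.
  transitivity (\sum_i (n%:R * `|a i| `^ p + (\sum_j `|a j| `^ p -
      p * \sum_j c i * c j * Num.min (t i) (t j)))).
    apply: eq_bigr => i _; rewrite mulr_sumr -sumrB.
    rewrite [n%:R * _](_ : _ = \sum_(j < n) `|a i| `^ p); last first.
      by rewrite sumr_const card_ord mulr_natl.
    by rewrite -big_split /=; apply: eq_bigr => j _; rewrite addrA.
  rewrite big_split /= -mulr_sumr sumrB -mulr_sumr sumr_const card_ord.
  by rewrite -[_ *+ n]mulr_natl -/Q; ring.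
by rewrite gerBl mulr_ge0// (le_trans ler01).
Qed.

End scalar_kernel.

Section Lp_pairs.
Context d (T : measurableType d) (R : realType) (mu : {measure set T -> \bar R}).
Context (p : R) (p1 : (1 <= p%:E)%E).
Local Notation E := (LspaceType mu p1).

(** Integrate the scalar inequality. *)
Lemma Lp_pairs_of_scalar n (M : R) (u : 'I_n -> E) : 0 <= M ->
  (forall a : 'I_n -> R, \sum_i \sum_j `|a i - a j| `^ p <= M * \sum_i `|a i| `^ p) ->
  \sum_i \sum_j `|u i - u j| `^ p <= M * \sum_i `|u i| `^ p.
Proof.
move=> M0 scal.
have mB i j : measurable_fun setT (lrep (u i) \- lrep (u j)).
  by apply: measurable_funB; exact: measurable_lrep.
have uE i j : (`|u i - u j| `^ p)%:E = integral_powR mu p (lrep (u i) \- lrep (u j))%R.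
  rewrite norm_integral_powR; apply: ae_integral_powR; [exact: measurable_lrep|exact: mB|exact: lrepB].
have mint (f : T -> R) : measurable_fun setT f ->
    measurable_fun setT (fun x => (`|f x| `^ p)%:E : \bar R).
  by move=> mf; exact: measurable_abs_powR.
have msum i : measurable_fun setT
    (fun x => \sum_j (`|lrep (u i) x - lrep (u j) x| `^ p)%:E : \bar R)%E.
  by apply: emeasurable_sum => j; exact: (mint _ (mB i j)).
have mu_ i : measurable_fun setT (fun x => (`|lrep (u i) x| `^ p)%:E : \bar R).
  exact: (mint _ (measurable_lrep (u i))).
have LE : ((\sum_i \sum_j `|u i - u j| `^ p)%:E =
    \int[mu]_x (\sum_i \sum_j (`|lrep (u i) x - lrep (u j) x| `^ p)%:E))%E.
  rewrite ge0_integral_sum//; last by move=> i x _; exact: sume_ge0.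
  rewrite -sumEFin; apply: eq_bigr => i _; rewrite ge0_integral_sum//.
    by rewrite -sumEFin; apply: eq_bigr => j _; exact: uE.
  by move=> j; exact: (mint _ (mB i j)).
have RE : ((M * \sum_i `|u i| `^ p)%:E =
    \int[mu]_x (M%:E * \sum_i (`|lrep (u i) x| `^ p)%:E))%E.
  rewrite ge0_integralZl_EFin//; last 2 first.
  - by move=> x _; exact: sume_ge0.
  - exact: emeasurable_sum.
  rewrite EFinM ge0_integral_sum//; congr (_ * _)%E; rewrite -sumEFin.
  by apply: eq_bigr => i _; exact: norm_integral_powR.
rewrite -lee_fin LE RE.
apply: ge0_le_integral => //.
- by move=> x _; rewrite sume_ge0// => i _; exact: sume_ge0.
- exact: emeasurable_sum.
- by apply: measurable_funeM; exact: emeasurable_sum.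
move=> x _; under eq_bigr do rewrite sumEFin.
by rewrite !sumEFin -EFinM lee_fin; exact: (scal (fun i => lrep (u i) x)).
Qed.

Definition pair_const : R := Num.max 2 (2 `^ (p - 1)).

Lemma Lp_pairs n (u : 'I_n -> E) :
  \sum_i \sum_j `|u i - u j| `^ p <= pair_const * n%:R * \sum_i `|u i| `^ p.
Proof.
have p1' : 1 <= p by rewrite -lee_fin.
have C0 : 0 <= pair_const by rewrite le_max ler0n.
apply: Lp_pairs_of_scalar => [|a]; first by rewrite mulr_ge0.
have S0 : 0 <= n%:R * \sum_i `|a i| `^ p.
  by rewrite mulr_ge0//; apply: sumr_ge0 => i _; exact: powR_ge0.
have [p2|/ltW p2] := leP p 2.
  apply: le_trans (pairs_le2 a p1' p2) _.
  by rewrite -!mulrA ler_wpM2r// le_max lexx.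
apply: le_trans (pairs_ge2 a p2) _.
by rewrite -!mulrA ler_wpM2r// le_max lexx orbT.
Qed.

(** Apply [Lp_pairs] to the differences with the centre of the ball: the n pairs at each
    point contribute [sep^p] each. *)
Lemma separated_in_ball (n : nat) (u : 'I_n.+1 -> E) (z : E) (sep rad : R) :
  0 <= sep -> 0 <= rad -> (forall i j, i != j -> sep <= `|u i - u j|) ->
  (forall i, `|z - u i| <= rad) ->
  n%:R * sep `^ p <= pair_const * n.+1%:R * rad `^ p.
Proof.
move=> sep0 rad0 usep urad.
have p0 : 0 <= p by rewrite (le_trans ler01)// -lee_fin.
have C0 : 0 <= pair_const by rewrite le_max ler0n.
have := Lp_pairs (fun i => u i - z).
have n1 : 0 < n.+1%:R :> R by rewrite ltr0n.
move=> H; rewrite -(ler_pM2l n1).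
apply: (@le_trans _ _ (\sum_i \sum_j `|(u i - z) - (u j - z)| `^ p)).
  apply: (@le_trans _ _ (\sum_(i < n.+1) n%:R * sep `^ p)).
    by rewrite sumr_const card_ord -[leRHS]mulr_natl.
  apply: ler_sum => i _; rewrite (bigD1_ord i)//=.
  apply: (@le_trans _ _ (\sum_(j < n) sep `^ p)).
    by rewrite sumr_const card_ord -[leRHS]mulr_natl.
  rewrite -[leLHS]add0r lerD ?powR_ge0//; apply: ler_sum => j _.
  apply: ge0_ler_powR; rewrite ?nnegrE//.
  by rewrite opprB addrA subrK; apply: usep; exact: neq_lift.
apply: le_trans H _.
have sumrad : \sum_i `|u i - z| `^ p <= n.+1%:R * rad `^ p.
  apply: (@le_trans _ _ (\sum_(i < n.+1) rad `^ p)).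
    by apply: ler_sum => i _; apply: ge0_ler_powR; rewrite ?nnegrE// distrC.
  by rewrite sumr_const card_ord -[leLHS]mulr_natl.
by rewrite [leRHS]mulrC -[leRHS]mulrA [X in _ <= _ * X]mulrC ler_wpM2l// mulr_ge0.
Qed.

End Lp_pairs.

(** * Crowding and the lower bound *)

Section crowding.
Context (R : realType) (X : normedModType R) (K : Type) (m : R).
Hypotheses (m1 : 1 <= m) (Xesc : escaping K m X).

Let m0 : 0 < m. Proof. exact: lt_le_trans ltr01 m1. Qed.

Lemma gain_cancel (c a rho h : R) : 0 < c -> c * (rho + 2 * h) = rho + h -> 0 <= h ->
  c * (a + 3 * h) <= rho -> a <= rho - h.
Proof.
move=> c0 cE h0 H; have : c * (a + 3 * h) <= c * (rho + 2 * h) by rewrite cE; lra.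
by rewrite ler_pM2l//; lra.
Qed.

(** Suppose that all the balls of radius [s + t] contain few points of U. From any x
    move by t along a direction that escapes from the differences [x - u] with u near x.
    Some u in U is within the covering radius of the new point, and this u is near x, so
    the m-th power of its distance to x is smaller, by at least [t^m / 3], than that of
    the covering radius. Hence the m-th power of the covering radius can be lowered by a
    fixed amount as often as one likes, which is absurd. *)
Lemma crowded_ball (U : set X) (s t : R) : s_dense s U -> 0 < t ->
  exists z, ([set: K] #<= [set u | U u /\ (`|z - u| <= s + t)%R])%card.
Proof.
move=> Us t0; apply: contrapT => /forallNP few.
have s0 : 0 <= s by have [u _ /(le_trans _)->] := Us 0.
have me : (1 <= m%:E)%E by rewrite lee_fin.
pose h := t `^ m / 3.
have h0 : 0 < h by rewrite divr_gt0// powR_gt0.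
have closer n x : exists2 u, U u & `|x - u| `^ m <= s `^ m - n%:R * h.
  elim: n x => [|n IH] x.
    have [u Uu xu] := Us x; exists u => //; rewrite mul0r subr0.
    by apply: ge0_ler_powR; rewrite ?nnegrE// ltW.
  set rho := s `^ m - n%:R * h in IH.
  have rho0 : 0 <= rho by have [u _ /(le_trans _)->//] := IH 0; rewrite powR_ge0.
  have q0 : 0 < (rho + h) / (rho + 2 * h) by rewrite divr_gt0//; lra.
  (* This choice of the loss leaves room for h: c^m (a^m + 3 h) <= rho forces
     a^m <= rho - h. *)
  pose c := ((rho + h) / (rho + 2 * h)) `^ m^-1.
  have cm : c `^ m = (rho + h) / (rho + 2 * h).
    by rewrite /c root_powR ?gt_eqF// ltW.
  have c0 : 0 < c by rewrite powR_gt0.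
  have c1 : 0 < 1 - c.
    rewrite subr_gt0 ltNge; apply/negP => c1.
    have : 1 `^ m <= c `^ m by apply: ge0_ler_powR; rewrite ?nnegrE// ltW.
    by rewrite powR1 cm ler_pdivlMr; lra.
  pose S := [set x - u | u in [set u | U u /\ `|x - u| <= s + t]].
  have [v v1 vP] : exists2 v : X, `|v| = 1 & forall y, linear_span S y -> forall t : R,
      0 <= t -> (1 - (1 - c)) * lr_norm2 m%:E `|y| t <= `|y + t *: v|.
    by apply: Xesc c1 => KS; apply: (few x); exact: card_le_trans KS (card_image_le _ _).
  have [u Uu xu] := IH (x + t *: v).
  have xus : `|x + t *: v - u| <= s.
    apply: (@powR_le_cancel _ m) => //; apply: le_trans xu _.
    by rewrite gerBl mulr_ge0// ltW.
  have xut : `|x - u| <= s + t.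
    have -> : x - u = (x + t *: v - u) - t *: v by rewrite addrAC addrK.
    apply: le_trans (ler_normB _ _) _; rewrite normrZ v1 mulr1 (gtr0_norm t0).
    by rewrite lerD2r.
  exists u => //; have Sxu : linear_span S (x - u) by apply: linear_span_incl; exists u.
  have L0 : 0 <= lr_norm2 m%:E `|x - u| t by exact: lr_norm2_ge0.
  have H : c * lr_norm2 m%:E `|x - u| t <= `|x + t *: v - u|.
    by have := vP _ Sxu t (ltW t0); rewrite subKr addrAC.
  have Hm : (c * lr_norm2 m%:E `|x - u| t) `^ m <= `|x + t *: v - u| `^ m.
    apply: ge0_ler_powR H; rewrite ?nnegrE//; first exact: ltW.
    by apply: mulr_ge0 => //; exact: ltW.
  have := le_trans Hm xu.
  move: (lr_norm2_powR `|x - u| t m0) L0; move: (lr_norm2 m%:E _ _) => L LE L0.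
  rewrite (powRM m (ltW c0) L0) LE cm => Hq.
  have -> : s `^ m - n.+1%:R * h = rho - h.
    by rewrite /rho -natr1 mulrDl mul1r opprD addrA.
  apply: (gain_cancel q0 _ (ltW h0)).
    by rewrite divfK// gt_eqF//; lra.
  by have -> : 3 * h = t `^ m by rewrite /h mulrC divfK.
pose n := Num.truncn (s `^ m / h).
have [u _] := closer n.+1 0.
suff : s `^ m < n.+1%:R * h.
  by move=> sn un; have := powR_ge0 `|0 - u| m; move: un sn; lra.
by rewrite -ltr_pdivrMr//; exact: Num.Theory.truncnS_gt.
Qed.

End crowding.
(** The pigeonhole principle for a colouring of a large set by tiny many colours. *)
Lemma infinite_fiber (K T V W : Type) (A : set W) (Q : set T) (C : set V) (f : T -> V) :
  infinite_set [set: K] -> ~ ([set: K] #<= A)%card -> ([set: K] #<= Q)%card ->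
  tiny A C -> (forall u, Q u -> C (f u)) ->
  exists c, infinite_set [set u | Q u /\ f u = c].
Proof.
move=> Kinf KA KQ tC fC; apply: contrapT => fin.
apply: (tiny_small Kinf KA _ KQ).
apply: (@sub_tiny _ _ _ _ (\bigcup_(c in C) [set u | Q u /\ f u = c])).
  by move=> u Qu; exists (f u) => //; exact: fC.
apply: tiny_bigcup => // c _; left; apply: contrapT => inf.
by apply: fin; exists c.
Qed.

Lemma dens_lt_spans (R : realType) (Y : normedModType R) (K : Type) :
  dens_lt Y [set: K] -> exists2 S : set Y, densely_spans S & ~ ([set: K] #<= S)%card.
Proof.
move=> [A [[[S Sd SA] _] _ /negP KA]]; exists S => // KS; apply: KA.
by move: SA; rewrite card_eq_le => /andP[SA _]; exact: card_le_trans KS SA.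
Qed.

Section lower_bound.
Context d (T : measurableType d) (R : realType) (mu : {measure set T -> \bar R}).
Context (p : R) (p1 : (1 <= p%:E)%E).
Local Notation E := (LspaceType mu p1).

Let p_ge1 : 1 <= p. Proof. by rewrite -lee_fin. Qed.
Let p_gt0 : 0 < p. Proof. exact: lt_le_trans ltr01 p_ge1. Qed.

Lemma le_of_multiples (a b : R) : (forall n, n%:R * a <= n.+1%:R * b) -> a <= b.
Proof.
move=> H; rewrite leNgt; apply/negP => ba; have ab0 : 0 < a - b by rewrite subr_gt0.
pose n := Num.truncn (b / (a - b)).
have := Num.Theory.truncnS_gt (b / (a - b)); rewrite ltr_pdivrMr// -/n.
by have := H n.+1; rewrite -[n.+2%:R]natr1 mulrDl mul1r mulrBr; lra.
Qed.

Lemma le_of_perturbed (k s : R) : 0 <= k ->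
  (forall e, 0 < e -> e < 1 -> 2 - 2 * e <= k * (s + e)) -> 2 <= k * s.
Proof.
move=> k0 H; rewrite leNgt; apply/negP => ks.
pose e := Num.min (1 / 2) ((2 - k * s) / (2 * (k + 2))).
have k20 : 0 < 2 * (k + 2) by lra.
have e0 : 0 < e by rewrite lt_min !divr_gt0// subr_gt0.
have e1 : e <= 1 / 2 by rewrite ge_min lexx.
have e2 : e * (2 * (k + 2)) <= 2 - k * s by rewrite -ler_pdivlMr// ge_min lexx orbT.
by have := H e e0; have : 0 < e * (2 * (k + 2)) by [exact: mulr_gt0]; move: e1 e2; lra.
Qed.

(** The colour of a point u of U is a member of an e-net of a ball of Y that is close to
    the second coordinate of a point of P above u. *)
Lemma covering_radius_ge (K : Type) (r : \bar R) (r1 : (1 <= r)%E)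
    (Y : normedModType R) (P : set (dsum r1 E Y)) (s : R) :
  infinite_set [set: K] -> has_dens E [set: K] -> dens_lt Y [set: K] ->
  0 <= s -> s_dense s P -> s_separated 2 P -> 2 <= pair_const p `^ p^-1 * s.
Proof.
move=> Kinf Edens /dens_lt_spans[S Sd KS] s0 Pd Ps.
have C0 : 0 <= pair_const p by rewrite le_max ler0n.
apply: le_of_perturbed => [|e e0 e1]; first exact: powR_ge0.
pose U := [set u | exists w, P (u, w) /\ `|w| <= s].
have Ud : s_dense s U.
  move=> x; have [[u w] Puw xu] := Pd (x, 0).
  exists u; last exact: le_trans (dsum_norm_ge1 _) xu.
  exists w; split=> //; apply: le_trans xu; apply: le_trans (dsum_norm_ge2 _).
  by rewrite /= sub0r normrN.
have [z KQ] := crowded_ball p_ge1 (Lp_escaping Kinf Edens) Ud e0.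
set Q := [set u | _] in KQ.
have [C tC CP] := tiny_net s (small_tiny KS) e0.
have : forall u, exists q : Y * Y, U u -> [/\ P (u, q.1), C q.2 & `|q.1 - q.2| <= e].
  move=> u; have [[w [Puw ws]]|nU] := pselect (U u); last by exists (0, 0).
  by have [|c Cc wc] := CP w _ ws; [rewrite Sd|exists (w, c)].
move=> /choice[q qP].
have [|c] := infinite_fiber (f := fun u => (q u).2) Kinf KS KQ tC.
  by move=> u [/qP[]].
move=> /infiniteP/(inj_of_card_le (0 : E))[f [fQ finj]].
have sep i j : i != j -> 2 - 2 * e <= `|f i - f j|.
  move=> ij; have [[/qP[Pi _ wi] _] ci] := fQ i I; have [[/qP[Pj _ wj] _] cj] := fQ j I.
  have fij : (f i, (q (f i)).1) <> (f j, (q (f j)).1).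
    by move=> [fij _]; move/eqP: ij; apply; exact: finj.
  have := le_trans (Ps _ _ Pi Pj fij) (dsum_norm_le _).
  rewrite /= => H; have : `|(q (f i)).1 - (q (f j)).1| <= e + e.
    apply: le_trans (ler_distD c _ _) _; apply: lerD; first by rewrite -[c in leLHS]ci.
    by rewrite distrC -[c in leLHS]cj.
  by move: H; lra.
have e20 : 0 <= 2 - 2 * e by lra.
have se0 : 0 <= s + e by rewrite addr_ge0// ltW.
apply: (powR_le_cancel p_gt0 e20); first by rewrite mulr_ge0// powR_ge0.
rewrite (powRM _ (powR_ge0 _ _) se0) root_powR ?gt_eqF//.
apply: le_of_multiples => n.
rewrite mulrA [_ * pair_const p]mulrC.
apply: (separated_in_ball (u := fun i : 'I_n.+1 => f i) (z := z) (p1 := p1)) => //.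
- by move=> i j ij; apply: sep.
- by move=> i; have [[_]] := fQ i I.
Qed.

Lemma gamma_dsum_ge (K : Type) (r : \bar R) (r1 : (1 <= r)%E) (Y : normedModType R) :
  infinite_set [set: K] -> has_dens E [set: K] -> dens_lt Y [set: K] ->
  ((Num.min (2 / 2 `^ p^-1) (2 / 2 `^ (1 - p^-1)))%:E <= gamma (dsum r1 E Y))%E.
Proof.
move=> Kinf Edens Ydens; apply: le_ereal_inf_tmp => _ [s [s0 [P [Pd Ps]]] <-].
have := covering_radius_ge Kinf Edens Ydens (ltW s0) Pd Ps.
rewrite lee_fin ge_min /pair_const maxEle; case: ifP => _ H.
  apply/orP; right; rewrite ler_pdivrMr ?powR_gt0// mulrC.
  by move: H; rewrite -powRrM mulrBl mulfV ?gt_eqF// mul1r.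
by apply/orP; left; rewrite ler_pdivrMr ?powR_gt0// mulrC.
Qed.

End lower_bound.

(** * The covering constants of the direct sum *)

Section upper_bounds.
Context d (T : measurableType d) (R : realType) (mu : {measure set T -> \bar R}).
Context (p : R) (p1 : (1 <= p%:E)%E) (K : Type).
Hypotheses (Kinf : infinite_set [set: K]) (Kdens : has_dens (LspaceType mu p1) [set: K]).
Local Notation E := (LspaceType mu p1).

Let p_ge1 : 1 <= p. Proof. by rewrite -lee_fin. Qed.

Let Espans : exists2 S : set E, densely_spans S & (S #<= [set: K])%card.
Proof.
have [[S Sd SK] _] := Kdens; exists S => //.
by move: SK; rewrite card_eq_le => /andP[].
Qed.

Lemma gamma_star_Lp : (gamma_star E <= (2 / 2 `^ p^-1)%:E)%E.
Proof.
apply: (gamma_star_escaping Kinf p_ge1 (Lp_escaping Kinf Kdens)).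
have [S Sd SK] := Espans.
have [|D tD DP] := @tiny_dense _ E _ [set: K] S Kinf; first by right.
exists D; first exact: tiny_card_le.
by move=> x; apply: DP; rewrite Sd.
Qed.

Lemma gamma_star_dsum (r : R) (r1 : (1 <= r%:E)%E) (Y : normedModType R) :
  dens_lt Y [set: K] ->
  (gamma_star (dsum r1 E Y) <= (2 / 2 `^ (Num.max p r)^-1)%:E)%E.
Proof.
move=> /dens_lt_spans[S' Sd' KS'].
have m1 : 1 <= Num.max p r by rewrite le_max p_ge1.
apply: (gamma_star_escaping Kinf m1 (dsum_escaping (r1 := r1) (Y := Y) p_ge1 (Lp_escaping Kinf Kdens))).
have [S Sd SK] := Espans; apply: (dense_dsum r1 Kinf Sd SK Sd').
by have [//|] := card_le_total S' [set: K].
Qed.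

End upper_bounds.

Lemma fine_conjugate (R : realType) (p : R) (q : \bar R) : 1 <= p ->
  ((p%:E)^-1 + q^-1 = 1)%E -> fine (q^-1)%E = 1 - p^-1.
Proof.
move=> p1; rewrite inver gt_eqF ?(lt_le_trans _ p1)//.
by case: (q^-1)%E => [a||]//= [<-]; rewrite addrAC subrr add0r.
Qed.

Theorem theorem6p12 (R : realType) (p : R) (p1 : (1 <= p%:E)%E)
    (q : \bar R) (pq : ((p%:E)^-1 + q^-1 = 1)%E)
    (kappa : Type) (kappa_infinite : infinite_set [set: kappa])
    (d : measure_display) (T : measurableType d) (mu : {measure set T -> \bar R})
    (dens_Lp : has_dens (LspaceType mu p1) [set: kappa])
    (Y : normedModType R) (dens_Y : dens_lt Y [set: kappa]) :
  let lower := Num.min (2 / 2 `^ p^-1) (2 / 2 `^ fine (q^-1)%E) in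
  [/\ forall (r : R) (r1 : (1 <= r%:E)%E), r <= p ->
        [/\ (lower%:E <= gamma (dsum r1 (LspaceType mu p1) Y))%E,
            (gamma (dsum r1 (LspaceType mu p1) Y) <=
             gamma_star (dsum r1 (LspaceType mu p1) Y))%E &
            (gamma_star (dsum r1 (LspaceType mu p1) Y) <=
             (2 / 2 `^ p^-1)%:E)%E],
      forall (r : R) (r1 : (1 <= r%:E)%E), p <= r ->
        [/\ (lower%:E <= gamma (dsum r1 (LspaceType mu p1) Y))%E,
            (gamma (dsum r1 (LspaceType mu p1) Y) <=
             gamma_star (dsum r1 (LspaceType mu p1) Y))%E &
            (gamma_star (dsum r1 (LspaceType mu p1) Y) <=
             (2 / 2 `^ r^-1)%:E)%E] &
      let r1 : (1 <= +oo :> \bar R)%E := leey 1%E in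
      [/\ (lower%:E <= gamma (dsum r1 (LspaceType mu p1) Y))%E,
          (gamma (dsum r1 (LspaceType mu p1) Y) <=
           gamma_star (dsum r1 (LspaceType mu p1) Y))%E &
          (gamma_star (dsum r1 (LspaceType mu p1) Y) <=
           Order.max (2 / 2 `^ p^-1)%:E (gamma_star Y))%E]].
Proof.
move=> lower.
have lowerP (r : \bar R) (r1 : (1 <= r)%E) :
    (lower%:E <= gamma (dsum r1 (LspaceType mu p1) Y))%E.
  rewrite /lower (fine_conjugate _ pq); last by rewrite -lee_fin.
  exact: (gamma_dsum_ge r1 kappa_infinite dens_Lp dens_Y).
have upper (r : R) (r1 : (1 <= r%:E)%E) := gamma_star_dsum kappa_infinite dens_Lp r1 dens_Y.
split=> [r r1 lrep|r r1 pr|].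
- split; [exact: lowerP|exact: gamma_le_gamma_star|].
  by have := upper r r1; rewrite max_l.
- split; [exact: lowerP|exact: gamma_le_gamma_star|].
  by have := upper r r1; rewrite max_r.
- split; [exact: lowerP|exact: gamma_le_gamma_star|].
  apply: le_trans (gamma_star_dsum_oo _ _ _) _; rewrite ge_max !le_max lexx orbT andbT.
  by rewrite (gamma_star_Lp kappa_infinite dens_Lp).
Qed.
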